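(* Suppose $G$ is a finitely generated group that does not contain a non-trivial normal abelian subgroup. Let $\mathcal{D}(G)\subset\mathrm{Hom}(G,\mathrm{PGL}(n+1,\mathbb{R}))$ be the subset of holonomies of properly convex $n$-manifolds with fundamental group $G$. Then the image $\chi(\mathcal{D}(G))$ is closed in the character variety $\mathcal{X}(G)$.
   Context: A subset $\Omega\subset\mathbb{RP}^n$ is convex if every pair of points in $\Omega$ is contained in a segment of a projective line that lies in $\Omega$. It is properly convex if in addition it is (non-empty and) open and its closure contains no projective line. A properly convex $n$-manifold is a quotient $\Omega/\Gamma$ where $\Omega\subset\mathbb{RP}^n$ is properly convex and $\Gamma\subset\mathrm{PGL}(n+1,\mathbb{R})$ is a discrete subgroup that preserves $\Omega$ and acts freely on it. Thus $\rho\in\mathcal{D}(G)$ if and only if $\rho$ is injective with discrete image and there is a properly convex $\Omega\subset\mathbb{RP}^n$ preserved by $\rho(G)$ on which $\rho(G)$ acts freely. The character variety is $\mathcal{X}(G)=\mathrm{Hom}(G,\mathrm{PGL}(n+1,\mathbb{R}))/\!/\mathrm{PGL}(n+1,\mathbb{R})$, the (real) geometric invariant theory quotient of $\mathrm{Hom}(G,\mathrm{PGL}(n+1,\mathbb{R}))$ by the conjugation action, and $\chi:\mathrm{Hom}(G,\mathrm{PGL}(n+1,\mathbb{R}))\to\mathcal{X}(G)$ is the projection. Concretely, $\mathrm{Hom}(G,\mathrm{PGL}(n+1,\mathbb{R}))$ has the topology of pointwise convergence, $\chi(\rho)=\chi(\rho')$ if and only if the closures of the conjugation orbits of $\rho$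 and $\rho'$ intersect, and $\mathcal{X}(G)$ has the quotient topology (which is Hausdorff). *)

(* Defs.v *)
From HB Require Import structures.
From Stdlib Require Import Relation_Operators.
From mathcomp Require Import all_boot all_order all_algebra.
From mathcomp Require Import generic_quotient.
From mathcomp Require Import boolp classical_sets functions reals topology.
From mathcomp Require Import normedtype.

Set Implicit Arguments.
Unset Strict Implicit.
Unset Printing Implicit Defensive.

Import GRing.Theory Num.Theory.
Import numFieldNormedType.Exports.
Local Open Scope classical_set_scope.
Local Open Scope quotient_scope.
Local Open Scope ring_scope.

Section ProjectiveSpace.
Variables (R : realType) (n : nat).

Definition nzvec : Type := [set v : 'cV[R]_n.+1 | v != 0].
HB.instance Definition _ := SubType.on nzvec.
HB.instance Definition _ := Topological.on nzvec.

Definition vec_prop (u v : nzvec) : bool :=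
  `[< exists2 c : R, c != 0 & val u = c *: val v >].

Lemma vec_prop_refl : reflexive vec_prop.
Proof. by move=> u; apply/asboolP; exists 1; rewrite ?oner_eq0 ?scale1r. Qed.

Lemma vec_prop_sym : symmetric vec_prop.
Proof.
suff h u v : vec_prop u v -> vec_prop v u by move=> u v; apply/idP/idP; exact: h.
move=> /asboolP[c c0 uv]; apply/asboolP; exists c^-1; first by rewrite invr_eq0.
by rewrite uv scalerA mulVf// scale1r.
Qed.

Lemma vec_prop_trans : transitive vec_prop.
Proof.
move=> v u w /asboolP[c c0 uv] /asboolP[d d0 vw]; apply/asboolP; exists (c * d).
  by rewrite mulf_neq0.
by rewrite uv vw scalerA.
Qed.

Canonical vec_prop_equiv :=
  EquivRel vec_prop vec_prop_refl vec_prop_sym vec_prop_trans.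

Definition projspace : Type := quotient_topology {eq_quot vec_prop_equiv}.
HB.instance Definition _ := Topological.on projspace.
HB.instance Definition _ := Quotient.on projspace.

Definition proj_pt (v : nzvec) : projspace := \pi_projspace v.

Lemma projP (u v : nzvec) :
  proj_pt u = proj_pt v <-> exists2 c : R, c != 0 & val u = c *: val v.
Proof.
by rewrite (rwP (@eqP {eq_quot vec_prop_equiv} (\pi u) (\pi v))) eqmodE /=;
  split => /asboolP.
Qed.

Lemma proj_repr (p : projspace) : proj_pt (repr p) = p.
Proof. exact: reprK. Qed.

End ProjectiveSpace.

Section ProjectiveLinearGroup.
Variables (R : realType) (n : nat).

Definition gl : Type := [set A : 'M[R]_n.+1 | A \in unitmx].
HB.instance Definition _ := SubType.on gl.
HB.instance Definition _ := Topological.on gl.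

Definition gl_prop (A B : gl) : bool :=
  `[< exists2 c : R, c != 0 & val A = c *: val B >].

Lemma gl_prop_refl : reflexive gl_prop.
Proof. by move=> u; apply/asboolP; exists 1; rewrite ?oner_eq0 ?scale1r. Qed.

Lemma gl_prop_sym : symmetric gl_prop.
Proof.
suff h u v : gl_prop u v -> gl_prop v u by move=> u v; apply/idP/idP; exact: h.
move=> /asboolP[c c0 uv]; apply/asboolP; exists c^-1; first by rewrite invr_eq0.
by rewrite uv scalerA mulVf// scale1r.
Qed.

Lemma gl_prop_trans : transitive gl_prop.
Proof.
move=> v u w /asboolP[c c0 uv] /asboolP[d d0 vw]; apply/asboolP; exists (c * d).
  by rewrite mulf_neq0.
by rewrite uv vw scalerA.
Qed.

Canonical gl_prop_equiv :=
  EquivRel gl_prop gl_prop_refl gl_prop_sym gl_prop_trans.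

Definition pgl : Type := quotient_topology {eq_quot gl_prop_equiv}.
HB.instance Definition _ := Topological.on pgl.
HB.instance Definition _ := Quotient.on pgl.

Definition projgl (A : gl) : pgl := \pi_pgl A.

Lemma projglP (A B : gl) :
  projgl A = projgl B <-> exists2 c : R, c != 0 & val A = c *: val B.
Proof.
by rewrite (rwP (@eqP {eq_quot gl_prop_equiv} (\pi A) (\pi B))) eqmodE /=;
  split => /asboolP.
Qed.

Lemma projgl_repr (a : pgl) : projgl (repr a) = a.
Proof. exact: reprK. Qed.

Lemma gl_unit (A : gl) : val A \in unitmx.
Proof. exact: set_mem (valP A). Qed.

Definition mkgl (A : 'M[R]_n.+1) (hA : A \in unitmx) : gl := exist _ A (mem_set hA).

Definition gl1 : gl := mkgl (unitmx1 R n.+1).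

Lemma glM_subproof (A B : gl) : val A *m val B \in unitmx.
Proof. by rewrite unitmx_mul !gl_unit. Qed.

Definition glM (A B : gl) : gl := mkgl (glM_subproof A B).

Lemma glV_subproof (A : gl) : invmx (val A) \in unitmx.
Proof. by rewrite unitmx_inv gl_unit. Qed.

Definition glV (A : gl) : gl := mkgl (glV_subproof A).

Definition pgl1 : pgl := projgl gl1.
Definition pglM (a b : pgl) : pgl := projgl (glM (repr a) (repr b)).
Definition pglV (a : pgl) : pgl := projgl (glV (repr a)).

Lemma pglM_proj (A B : gl) : pglM (projgl A) (projgl B) = projgl (glM A B).
Proof.
have /projglP[c c0 hc] := projgl_repr (projgl A).
have /projglP[d d0 hd] := projgl_repr (projgl B).
apply/projglP; exists (c * d); first by rewrite mulf_neq0.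
by rewrite /= hc hd -scalemxAl -scalemxAr scalerA.
Qed.

Lemma pglV_proj (A : gl) : pglV (projgl A) = projgl (glV A).
Proof.
have /projglP[c c0 hc] := projgl_repr (projgl A).
apply/projglP; exists c^-1; first by rewrite invr_eq0.
by rewrite /= hc invmxZ ?gl_unit// unitmxZ ?unitfE// gl_unit.
Qed.

Lemma pglMA : associative pglM.
Proof.
move=> a b c; rewrite -(projgl_repr a) -(projgl_repr b) -(projgl_repr c).
by rewrite !pglM_proj; congr projgl; apply: val_inj; rewrite /= mulmxA.
Qed.

Lemma pglM1g : left_id pgl1 pglM.
Proof.
move=> a; rewrite -(projgl_repr a) pglM_proj; congr projgl.
by apply: val_inj; rewrite /= mul1mx.
Qed.

Lemma pglMg1 : right_id pgl1 pglM.
Proof.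
move=> a; rewrite -(projgl_repr a) pglM_proj; congr projgl.
by apply: val_inj; rewrite /= mulmx1.
Qed.

Lemma pglMVg : left_inverse pgl1 pglV pglM.
Proof.
move=> a; rewrite -(projgl_repr a) pglV_proj pglM_proj; congr projgl.
by apply: val_inj; rewrite /= mulVmx// gl_unit.
Qed.

Lemma pglMgV : right_inverse pgl1 pglV pglM.
Proof.
move=> a; rewrite -(projgl_repr a) pglV_proj pglM_proj; congr projgl.
by apply: val_inj; rewrite /= mulmxV// gl_unit.
Qed.

HB.instance Definition _ :=
  isGroup.Build pgl pglMA pglM1g pglMg1 pglMVg pglMgV.

Lemma act_subproof (A : gl) (v : nzvec R n) :
  [set w : 'cV[R]_n.+1 | w != 0] (val A *m val v).
Proof.
apply/eqP => /(congr1 (mulmx (invmx (val A)))); rewrite mulKmx ?gl_unit//.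
by rewrite mulmx0; apply/eqP; exact: set_mem (valP v).
Qed.

Definition gl_act (A : gl) (v : nzvec R n) : nzvec R n :=
  exist _ (val A *m val v) (mem_set (act_subproof A v)).

Definition pgl_act (a : pgl) (p : projspace R n) : projspace R n :=
  proj_pt (gl_act (repr a) (repr p)).

Lemma pgl_act_proj (A : gl) (v : nzvec R n) :
  pgl_act (projgl A) (proj_pt v) = proj_pt (gl_act A v).
Proof.
have /projglP[c c0 hc] := projgl_repr (projgl A).
have /projP[d d0 hd] := proj_repr (proj_pt v).
apply/projP; exists (c * d); first by rewrite mulf_neq0.
by rewrite /= hc hd -scalemxAl -scalemxAr scalerA.
Qed.

End ProjectiveLinearGroup.

Section Convexity.
Variables (R : realType) (n : nat).
Implicit Types (u v w : nzvec R n) (Omega : set (projspace R n)).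

Definition proj_line u v : set (projspace R n) :=
  [set proj_pt w | w in [set w | exists s t : R, val w = s *: val u + t *: val v]].

(* The two segments joining proj_pt u to proj_pt v are proj_segment u v and
   proj_segment u (- v); when proj_pt u = proj_pt v the segment is one point. *)
Definition proj_segment u v : set (projspace R n) :=
  [set proj_pt w | w in [set w | exists s t : R,
    [/\ 0 <= s, 0 <= t & val w = s *: val u + t *: val v]]].

Definition proj_convex Omega :=
  forall p q, Omega p -> Omega q -> exists u v,
    [/\ proj_segment u v p, proj_segment u v q & proj_segment u v `<=` Omega].

Definition properly_convex Omega :=
  [/\ Omega !=set0, open Omega, proj_convex Omega &
    forall u v, proj_pt u != proj_pt v -> ~ (proj_line u v `<=` closure Omega)].

End Convexity.

Section Groups.
Variable G : groupType.
Local Open Scope group_scope.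

Definition is_subgroup (H : set G) := group_closed (mem H).

Definition finitely_generated :=
  exists s : seq G, smallest is_subgroup [set` s] = setT.

Definition is_normal (H : set G) := forall g h : G, H h -> H (h ^ g).

Definition is_abelian (H : set G) := forall x y : G, H x -> H y -> commute x y.

Definition no_normal_abelian_subgroup :=
  forall H : set G,
    is_subgroup H -> is_normal H -> is_abelian H -> H = [set 1].

End Groups.

Section CharacterVariety.
Variables (R : realType) (n : nat) (G : groupType).
Local Open Scope group_scope.

Definition homspace : Type :=
  [set f : {ptws G -> pgl R n} | {morph f : x y / x * y}].
HB.instance Definition _ := SubType.on homspace.
HB.instance Definition _ := Topological.on homspace.

Definition conj_orbit (rho : homspace) : set homspace :=
  [set sigma : homspace | exists a : pgl R n,
     forall g : G, (val sigma : G -> _) g = (val rho : G -> _) g ^ a].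

Definition closures_meet (rho sigma : homspace) : Prop :=
  closure (conj_orbit rho) `&` closure (conj_orbit sigma) !=set0.

(* For finitely generated G, geometric invariant theory says that closures_meet
   is already transitive, so it coincides with the equivalence relation it
   generates; generating makes the quotient well defined without that theorem. *)
Definition git_rel (rho sigma : homspace) : bool :=
  `[< clos_refl_sym_trans homspace closures_meet rho sigma >].

Lemma git_rel_refl : reflexive git_rel.
Proof. by move=> r; apply/asboolP; exact: rst_refl. Qed.

Lemma git_rel_sym : symmetric git_rel.
Proof. by move=> r s; apply/asboolP/asboolP => ?; exact: rst_sym. Qed.

Lemma git_rel_trans : transitive git_rel.
Proof.
move=> s r t /asboolP rs /asboolP st; apply/asboolP.
by apply: rst_trans rs st.
Qed.

Canonical git_rel_equiv :=
  EquivRel git_rel git_rel_refl git_rel_sym git_rel_trans.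

Definition charvar : Type := quotient_topology {eq_quot git_rel_equiv}.
HB.instance Definition _ := Topological.on charvar.
HB.instance Definition _ := Quotient.on charvar.

Definition chi (rho : homspace) : charvar := \pi_charvar rho.

Lemma chiP (rho sigma : homspace) :
  chi rho = chi sigma <-> clos_refl_sym_trans homspace closures_meet rho sigma.
Proof.
by rewrite (rwP (@eqP {eq_quot git_rel_equiv} (\pi rho) (\pi sigma))) eqmodE /=;
  split => /asboolP.
Qed.

(* Omega is contractible, so the quotient of Omega by the discrete group
   range r acting freely has fundamental group range r, and r identifies it
   with G. *)
Definition holonomies : set homspace :=
  [set rho : homspace | let r : G -> pgl R n := val rho in
    [/\ injective r,
        range r `<=` isolated (range r) &
        exists Omega : set (projspace R n),
          [/\ properly_convex Omega,
              forall g, pgl_act (r g) @` Omega = Omega &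
              forall g p, Omega p -> pgl_act (r g) p = p -> r g = 1]]].

End CharacterVariety.

(* Main.v *)
(* Let sigma range over holonomies whose classes tend to chi(rho), along an
   ultrafilter. Lift sigma to a representation A by matrices of determinant +-1
   preserving a sharp convex cone C. Conjugate A so that, up to a factor, its
   generators have the least possible norm, then place C so that it contains the
   positive orthant and its points have coordinates bounded by a multiple of the
   coordinate sum; a simplex of maximal volume in C shows that the second step
   only costs a bounded factor. The traces of A converge up to sign. If the
   generators were unbounded, rescaling them would give in the limit matrices all
   of whose words have trace zero; such matrices can be conjugated arbitrarily
   close to zero, against minimality. So A converges to some L preserving a limit
   cone.

   An element z of almost least size near the identity commutes with its
   conjugates by short words, because commutators of small elements are smaller.
   The short conjugates of z span the space of all conjugates of z, so the
   conjugates of z commute and generate a normal abelian subgroup. Hence the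
   discreteness is uniform, and L is discrete and faithful. It acts freely on the
   interior of the limit cone: a fixed point there makes the powers of an element
   bounded up to scale, hence the element torsion, but G acts freely on convex
   sets and so is torsion free.

   Finally L and rho have, up to signs, lifts with equal traces on all words.
   Two families of matrices with the same traces degenerate to a common family,
   so they define the same point of the character variety. *)
From Stdlib Require Import Relation_Operators.
Require Import Defs.
From mathcomp Require Import all_boot all_order all_algebra.
From mathcomp Require Import boolp classical_sets functions reals topology.
From mathcomp Require Import normedtype sequences exp ring lra.

Set Implicit Arguments.
Unset Strict Implicit.
Unset Printing Implicit Defensive.

Import Order.TTheory GRing.Theory Num.Theory.
Import numFieldNormedType.Exports.
Local Open Scope classical_set_scope.
Local Open Scope ring_scope.

(** * Representations of free monoids *)

(** Elements of PGL have no trace, so representations are compared through unimodular lifts, unique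
    up to sign, by the traces of all words in them. Signs therefore have to be carried through every
    comparison and every limit.

    Conjugators, cones and signs are chosen separately for each representation and need not vary
    continuously. Along an ultrafilter all bounded choices converge at once, without passing to
    subsequences.

    Two normalisations compete: small generators make the matrices converge, a round cone keeps the
    limit cone from degenerating. They are compatible because on a cone in good position the
    coordinate sum controls the norm. A matrix preserving such a cone is thus bounded by one scalar,
    the coordinate sum of its value at [one_cv], and optimality of the simplex bounds this scalar by
    the norm before the change of basis.

    The approximating representations come with discreteness constants that might tend to zero, and
    the limit could then fail to be faithful. This is why a constant is needed that depends only on
    a bound for the generators. *)

Section LinearAlgebra.
Variable F : fieldType.

(** Turns a subspace given by a predicate into a row space: among matrices with rows in [L], one of
    maximal rank spans it, since a vector of [L] outside the span would raise the rank. *)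
Lemma linear_pred_mx (n : nat) (L : 'rV[F]_n -> Prop) :
  L 0 -> (forall a u v, L u -> L v -> L (a *: u + v)) ->
  exists U : 'M[F]_n, forall v, L v <-> (v <= U)%MS.
Proof.
move=> L0 LD.
have Lspan m (U : 'M[F]_(m, n)) : (forall i, L (row i U)) -> forall v, (v <= U)%MS -> L v.
  move=> LU v /submxP[w ->]; rewrite mulmx_sum_row.
  elim/big_ind: _ => // [x y Lx Ly|i _]; first by rewrite -[x]scale1r; exact: LD.
  by rewrite -[_ *: _]addr0; apply: LD.
pose P r := `[< exists U : 'M[F]_n, (forall i, L (row i U)) /\ \rank U = r >].
have P0 : exists r, P r.
  by exists 0%N; apply/asboolP; exists 0; split=> [i|]; rewrite ?mxrank0 ?row0.
have Pb r : P r -> (r <= n)%N by move=> /asboolP[U [_ <-]]; exact: rank_leq_row.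
have [r /asboolP[U [LU rU]] maxU] := ex_maxnP P0 Pb.
exists U => v; split; last exact: Lspan LU v.
move=> Lv; apply: contraT => vU.
have LUv : forall w, (w <= U + v)%MS -> L w.
  move=> w; rewrite addsmxE; apply: Lspan => i.
  rewrite -(splitK i); case: fintype.split => j /=.
    by rewrite rowKu; exact: LU.
  by rewrite rowKd (_ : row j v = v) ?row_id //; apply/rowP => k; rewrite mxE ord1.
have /maxU : P (\rank (U + v)%MS).
  apply/asboolP; exists (U + v)%MS; split=> // i; apply: LUv.
  exact: row_sub.
rewrite -rU leqNgt ltn_neqAle mxrankS ?addsmxSl// andbT => /negPn/eqP/esym rUv.
have [_ /esym] := mxrank_leqif_sup (addsmxSl U v); rewrite rUv eqxx.
by move=> h; case/negP: vU; exact: submx_trans (addsmxSr U v) h.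
Qed.

Lemma rect_inv_dim (m n : nat) (P : 'M[F]_(m, n)) (Q : 'M_(n, m)) :
  P *m Q = 1%:M -> Q *m P = 1%:M -> m = n.
Proof.
move=> PQ QP; have := mxrankM_maxl P Q; rewrite PQ mxrank1 => h1.
have := mxrankM_maxl Q P; rewrite QP mxrank1 => h2.
apply/eqP; rewrite eqn_leq (leq_trans h1) ?rank_leq_col//.
by rewrite (leq_trans h2) ?rank_leq_col.
Qed.

(** In a rank factorisation of an idempotent the factors in reverse order multiply to the identity.
    In characteristic zero the trace thus detects whether an idempotent vanishes. *)
Lemma idem_trace (n : nat) (f : 'M[F]_n) : f *m f = f -> \tr f = (\rank f)%:R.
Proof.
move=> ff; have rc : row_base f *m col_base f = 1%:M.
  apply: (row_free_inj (row_base_free f)); rewrite mul1mx.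
  apply: (row_full_inj (col_base_full f)).
  by rewrite -[X in _ *m X]mulmxA mulmxA (mulmx_base f).
by have := congr1 mxtrace (mulmx_base f); rewrite mxtrace_mulC rc mxtrace1.
Qed.

Section Families.
Variable I : Type.
Implicit Types (p q : seq (F * seq I)) (w : seq I).

Definition wordmx n (A : I -> 'M[F]_n) w : 'M[F]_n :=
  foldr (fun i X => A i *m X) 1%:M w.

(** A list of coefficients and words is a noncommutative polynomial. Being formal, it can be
    evaluated in two families of different sizes, whose generated algebras have no elements in
    common. *)
Definition ncev n (A : I -> 'M[F]_n) p : 'M[F]_n :=
  \sum_(c <- p) c.1 *: wordmx A c.2.

Definition ncmul p q := [seq (c.1 * d.1, c.2 ++ d.2) | c <- p, d <- q].
Definition ncC (a : F) : seq (F * seq I) := [:: (a, [::])].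

Fixpoint ncpow p k := if k is k'.+1 then ncmul p (ncpow p k') else ncC 1.

Definition nchorner (h : {poly F}) p :=
  flatten [seq ncmul (ncC h`_i) (ncpow p i) | i <- iota 0 (size h)].

Definition sametrace n m (A : I -> 'M[F]_n) (B : I -> 'M[F]_m) :=
  forall w, \tr (wordmx A w) = \tr (wordmx B w).

Lemma wordmx_cat n (A : I -> 'M[F]_n) w1 w2 :
  wordmx A (w1 ++ w2) = wordmx A w1 *m wordmx A w2.
Proof. by elim: w1 => [|i w IH] /=; rewrite ?mul1mx// IH mulmxA. Qed.

Lemma wordmx_intertwine n m (A : I -> 'M[F]_n) (B : I -> 'M[F]_m) (P : 'M_(m, n)) w :
  (forall i, P *m A i = B i *m P) -> P *m wordmx A w = wordmx B w *m P.
Proof.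
move=> PAB; elim: w => [|i w IH] /=; first by rewrite mulmx1 mul1mx.
by rewrite mulmxA PAB -mulmxA IH mulmxA.
Qed.

Lemma ncev_intertwine n m (A : I -> 'M[F]_n) (B : I -> 'M[F]_m) (P : 'M_(m, n)) p :
  (forall i, P *m A i = B i *m P) -> P *m ncev A p = ncev B p *m P.
Proof.
move=> PAB; rewrite mulmx_sumr mulmx_suml; apply: eq_bigr => c _.
by rewrite -scalemxAr -scalemxAl (wordmx_intertwine _ PAB).
Qed.

Lemma ncevD n (A : I -> 'M[F]_n) p q : ncev A (p ++ q) = ncev A p + ncev A q.
Proof. by rewrite /ncev big_cat. Qed.

Lemma ncevM n (A : I -> 'M[F]_n) p q : ncev A (ncmul p q) = ncev A p *m ncev A q.
Proof.
rewrite /ncev /ncmul; elim: p => [|c p IH]; first by rewrite !big_nil mul0mx.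
rewrite allpairs_cons big_cat /= IH big_cons mulmxDl big_map; congr (_ + _).
rewrite mulmx_sumr; apply: eq_bigr => d _ /=.
by rewrite wordmx_cat -scalemxAr -scalemxAl scalerA mulrC.
Qed.

Lemma ncevC n (A : I -> 'M[F]_n) a : ncev A (ncC a) = a%:M.
Proof. by rewrite /ncev big_seq1 /= scalemx1. Qed.

Lemma ncev_gen n (A : I -> 'M[F]_n) i : ncev A [:: (1, [:: i])] = A i.
Proof. by rewrite /ncev big_seq1 /= scale1r mulmx1. Qed.

Lemma ncev_horner n (A : I -> 'M[F]_n.+1) h p :
  ncev A (nchorner h p) = horner_mx (ncev A p) h.
Proof.
have powE k : ncev A (ncpow p k) = ncev A p ^+ k.
  by elim: k => [|k IH] /=; rewrite ?ncevC ?expr0// ncevM IH exprS.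
rewrite -{2}[h]coefK poly_def rmorph_sum /= /nchorner /ncev big_flatten /= big_map.
rewrite -{1}[size h]subn0 -/(index_iota _ _) big_mkord; apply: eq_bigr => k _.
rewrite -/(ncev A _) ncevM ncevC powE linearZ /= rmorphXn /= horner_mx_X.
by rewrite mul_scalar_mx.
Qed.

Lemma sametrace_ncev n m (A : I -> 'M[F]_n) (B : I -> 'M[F]_m) p :
  sametrace A B -> \tr (ncev A p) = \tr (ncev B p).
Proof.
move=> AB; rewrite /ncev !raddf_sum; apply: eq_bigr => c _ /=.
by rewrite !mxtraceZ AB.
Qed.

Definition blockdiag n m (A : I -> 'M[F]_n) (B : I -> 'M[F]_m) i : 'M[F]_(n + m) :=
  block_mx (A i) 0 0 (B i).

Lemma wordmx_tri n m (a : I -> 'M[F]_n) (b : I -> 'M[F]_(m, n)) (d : I -> 'M[F]_m) w :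
  exists b', wordmx (fun i => block_mx (a i) 0 (b i) (d i)) w =
    block_mx (wordmx a w) 0 b' (wordmx d w).
Proof.
elim: w => [|i w [b' IH]] /=; first by exists 0; rewrite scalar_mx_block.
by exists (b i *m wordmx a w + d i *m b'); rewrite IH mulmx_block !(mulmx0, mul0mx, addr0, add0r).
Qed.

Lemma wordmx_diag n m (a : I -> 'M[F]_n) (d : I -> 'M[F]_m) w :
  wordmx (blockdiag a d) w = block_mx (wordmx a w) 0 0 (wordmx d w).
Proof.
elim: w => [|i w IH] /=; first by rewrite scalar_mx_block.
by rewrite IH mulmx_block !(mulmx0, mul0mx, addr0, add0r).
Qed.

Lemma ncev_diag n m (a : I -> 'M[F]_n) (d : I -> 'M[F]_m) p :
  ncev (blockdiag a d) p = block_mx (ncev a p) 0 0 (ncev d p).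
Proof.
rewrite /ncev; elim: p => [|c p IH]; first by rewrite !big_nil block_mx0.
by rewrite !big_cons IH wordmx_diag scale_block_mx add_block_mx !scaler0 !addr0.
Qed.

End Families.
End LinearAlgebra.
Arguments ncC {F I} a.

(** * Fitting idempotents as noncommutative polynomials *)

Section Fitting.
Variables (F : fieldType) (I : Type).
Implicit Types (p q : seq (F * seq I)) (w : seq I) (h : {poly F}).

(** The idempotent [ncev A (ncmul p r)] projects onto the part where [p] acts invertibly. Write [h]
    as a power of X times [g] with nonzero [g.[0]]; a Bezout relation between a power of X and [g]
    splits 1 into two complementary idempotents at [p]. As [r] depends only on [p] and [h], it
    serves all families annihilated by [h] at once. *)
Lemma nc_fitting p h : h != 0 -> exists r : seq (F * seq I),
  forall n (A : I -> 'M[F]_n), ncev A (nchorner h p) = 0 ->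
  [/\ ncev A (ncmul p r) *m ncev A (ncmul p r) = ncev A (ncmul p r), ncev A p *m ncev A r = ncev A r *m ncev A p &
      forall v : 'rV_n, v *m ncev A p = v -> v *m ncev A (ncmul p r) = v].
Proof.
move=> h0.
have [a [g g0 ->]] : exists a, exists2 g : {poly F}, g.[0] != 0 & h = 'X^a * g.
  have [a [g + hE]] := multiplicity_XsubC h 0; rewrite h0 /= => g0.
  by exists a, g => //; rewrite hE mulrC subr0.
(* The exponent exceeds [a] by one so that the idempotent keeps a factor [p] even when [a = 0]. *)
pose b := a.+1.
have cop : coprimep 'X^b g.
  rewrite coprimep_pexpl// -['X]subr0 -polyC0 coprimep_sym coprimep_XsubC.
  by rewrite /root g0.
have [[u w] /= uw] := Bezout_eq1_coprimepP _ _ cop.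
exists (nchorner (u * 'X^a) p) => -[|n] A.
  by move=> _; split=> [||v _]; apply/matrixP => i j; case: (notF (ltn_ord j)).
rewrite ncev_horner ncevM ncev_horner; set x := ncev A p => hx.
set f := x *m _.
have hM k l : horner_mx x (k * l) = horner_mx x k *m horner_mx x l by exact: rmorphM.
have fE : f = horner_mx x (u * 'X^b) by rewrite exprS mulrCA hM horner_mx_X.
have xC : x *m horner_mx x (u * 'X^a) = horner_mx x (u * 'X^a) *m x.
  by have := congr1 (horner_mx x) (mulrC 'X (u * 'X^a)); rewrite !hM horner_mx_X.
have f1 : 1 - f = horner_mx x (w * g).
  by rewrite fE -(rmorph1 (horner_mx x)) -uw rmorphD /= addrC addKr.
split=> //.
  apply/esym/eqP; rewrite -subr_eq0 -{1}[f]mulmx1 -mulmxBr [1%:M - f]f1 fE -hM.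
  have -> : u * 'X^b * (w * g) = u * 'X * w * ('X^a * g) by rewrite exprS; ring.
  by rewrite hM hx mulmx0.
move=> v vx.
have vh k : v *m horner_mx x k = k.[1] *: v.
  rewrite -{1}[k]coefK poly_def rmorph_sum /= mulmx_sumr horner_coef scaler_suml.
  apply: eq_bigr => i _; rewrite linearZ /= rmorphXn /= horner_mx_X expr1n mulr1.
  rewrite -scalemxAr; congr (_ *: _).
  by elim: (nat_of_ord i) => [|j IH]; rewrite ?expr0 ?mulmx1// exprS mulmxA vx.
have [->|v0] := eqVneq v 0; first by rewrite mul0mx.
have := vh ('X^a * g); rewrite hx mulmx0 => /esym/eqP.
rewrite scaler_eq0 (negbTE v0) orbF hornerM hornerXn expr1n mul1r => /eqP g1.
apply/eqP; rewrite -subr_eq0 -oppr_eq0 opprB -{1}[v]mulmx1 -mulmxBr [_ - _]f1.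
by rewrite vh hornerM g1 mulr0 scale0r.
Qed.

Lemma nc_Cayley_Hamilton n (A : I -> 'M[F]_n) p h :
  char_poly (ncev A p) %| h -> ncev A (nchorner h p) = 0.
Proof.
case: n A => [|n] A; first by move=> _; apply/matrixP => i j; case: (notF (ltn_ord i)).
move=> /dvdpP[k ->]; rewrite ncev_horner rmorphM /=.
by rewrite Cayley_Hamilton mulr0.
Qed.

End Fitting.

(** * Stable subspaces and simple families *)

Section Stable.
Variables (F : fieldType) (I : Type).
Implicit Types (p q : seq (F * seq I)).

Definition stablefam n (A : I -> 'M[F]_n) (U : 'M[F]_n) :=
  forall i, (U *m A i <= U)%MS.

Definition simplefam n (A : I -> 'M[F]_n) :=
  (0 < n)%N /\ forall U, stablefam A U -> U != 0 -> row_full U.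

Lemma cyclic_fam n (A : I -> 'M[F]_n) (v : 'rV_n) : exists2 U : 'M[F]_n,
  stablefam A U & forall w, (w <= U)%MS <-> exists p, w = v *m ncev A p.
Proof.
have [||U UP] := @linear_pred_mx F n (fun w => exists p, w = v *m ncev A p).
- by exists [::]; rewrite /ncev big_nil mulmx0.
- move=> a x y [p ->] [q ->]; exists (ncmul (ncC a) p ++ q).
  by rewrite ncevD ncevM ncevC mul_scalar_mx mulmxDr scalemxAr.
exists U => [i|w]; last by split=> /UP.
apply/row_subP => k; rewrite row_mul.
have /UP[p ->] := row_sub k U; apply/UP; exists (ncmul p [:: (1, [:: i])]).
by rewrite ncevM ncev_gen mulmxA.
Qed.

Lemma simplefam_cyclic n (A : I -> 'M[F]_n) (v w : 'rV_n) :
  simplefam A -> v != 0 -> exists p, w = v *m ncev A p.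
Proof.
move=> [_ sA] v0; have [U stU UP] := cyclic_fam A v.
have vU : (v <= U)%MS by apply/UP; exists (ncC 1); rewrite ncevC mulmx1.
apply/UP/submx_full/sA => //; apply: contraNneq v0 => U0.
by rewrite -submx0 -U0.
Qed.

Lemma min_stable n (A : I -> 'M[F]_n) : (0 < n)%N -> exists U : 'M[F]_n,
  [/\ stablefam A U, U != 0 &
    forall V : 'M_n, stablefam A V -> (V <= U)%MS -> V != 0 -> (U <= V)%MS].
Proof.
move=> n0.
pose P r := `[< exists U : 'M[F]_n, [/\ stablefam A U, U != 0 & \rank U = r] >].
have exP : exists r, P r.
  exists n; apply/asboolP; exists 1%:M; split=> [i||]; rewrite ?submx1 ?mxrank1//.
  by rewrite -mxrank_eq0 mxrank1 -lt0n.
have [r /asboolP[U [stU U0 rU]] minU] := ex_minnP exP.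
exists U; split=> // V stV VU V0.
rewrite -(geq_leqif (mxrank_leqif_sup VU)) rU.
by apply: minU; apply/asboolP; exists V.
Qed.

(* The type of the second block is [\rank U^C] rather than [n - \rank U], and
   [P], [Q] are rectangular, so that no casts are needed. *)
Lemma stable_split n (A : I -> 'M[F]_n) (U : 'M[F]_n) : stablefam A U ->
  exists P Q (a : I -> 'M[F]_(\rank U)) b (d : I -> 'M[F]_(\rank U^C)%MS),
  [/\ P *m Q = 1%:M, Q *m P = 1%:M,
      forall i, P *m A i *m Q = block_mx (a i) 0 (b i) (d i) &
      forall i, a i *m row_base U = row_base U *m A i].
Proof.
move=> stU; pose P := col_mx (row_base U) (row_base U^C)%MS.
have fullP : row_full P.
  rewrite -sub1mx -addsmxE (adds_eqmx (eq_row_base U) (eq_row_base _)).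
  by rewrite sub1mx addsmx_compl_full.
have freeP : row_free P.
  by rewrite /row_free (eqP fullP) mxrank_compl subnKC ?rank_leq_col.
have PQ := mulmxVp freeP; have QP := mulVpmx fullP.
move: (pinvmx P) PQ QP => Q PQ QP.
have R1Q : row_base U *m Q = row_mx 1%:M 0.
  by have := congr1 usubmx PQ; rewrite mul_col_mx scalar_mx_block /block_mx !col_mxKu.
have ex i : exists X, row_base U *m A i = X *m row_base U.
  apply/submxP; rewrite eq_row_base.
  by apply: submx_trans (stU i); rewrite submxMr// eq_row_base.
pose M i := P *m A i *m Q.
exists P, Q, (fun i => projT1 (cid (ex i))), (fun i => dlsubmx (M i)), (fun i => drsubmx (M i)).
split=> // i; last by case: cid.
rewrite -[LHS]submxK; case: cid => X /= XE; congr block_mx.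
  by rewrite /P mul_col_mx XE mul_col_mx -mulmxA R1Q mul_mx_row mulmx1 mulmx0 /ulsubmx col_mxKu row_mxKl.
by rewrite /P mul_col_mx XE mul_col_mx -mulmxA R1Q mul_mx_row mulmx1 mulmx0 /ursubmx col_mxKu row_mxKr.
Qed.

Lemma min_stable_simple n (A : I -> 'M[F]_n) (U : 'M[F]_n) (a : I -> 'M_(\rank U)) :
  U != 0 -> (forall V : 'M_n, stablefam A V -> (V <= U)%MS -> V != 0 -> (U <= V)%MS) ->
  (forall i, a i *m row_base U = row_base U *m A i) -> simplefam a.
Proof.
move=> U0 minU aE; split; first by rewrite lt0n mxrank_eq0.
move=> V stV V0; pose W := <<V *m row_base U>>%MS.
have WE : (W :=: V *m row_base U)%MS by exact: genmxE.
have rW : \rank W = \rank V by rewrite WE mxrankMfree ?row_base_free.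
have /mxrankS : (U <= W)%MS.
  apply: minU => [i||].
  - rewrite (eqmxMr _ WE) WE -mulmxA -aE mulmxA; exact: submxMr (stV i).
  - by rewrite WE -(eq_row_base U) submxMl.
  - by rewrite -mxrank_eq0 rW mxrank_eq0.
by rewrite rW /row_full eqn_leq rank_leq_col.
Qed.

End Stable.

(** * Degenerations of families of matrices *)

Section MatrixLimits.
Variables (R : realType) (T : Type) (U : set_system T).
Context {UF : Filter U}.

Definition mcvg m n (X : T -> 'M[R]_(m, n)) (L : 'M[R]_(m, n)) :=
  forall i j, X ^~ i ^~ j @ U --> L i j.

Lemma cvg_bigsum (J : Type) (r : seq J) (P : pred J) (f : J -> T -> R) (l : J -> R) :
  (forall j, P j -> f j @ U --> l j) ->
  (fun t => \sum_(j <- r | P j) f j t) @ U --> \sum_(j <- r | P j) l j.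
Proof.
move=> fl; elim: r => [|j r IH].
  by under eq_cvg do rewrite big_nil; rewrite big_nil; exact: cvg_cst.
rewrite big_cons; under eq_cvg do rewrite big_cons.
by case: ifP => // Pj; apply: cvgD => //; exact: fl.
Qed.

Lemma cvg_bigprod (J : Type) (r : seq J) (f : J -> T -> R) (l : J -> R) :
  (forall j, f j @ U --> l j) ->
  (fun t => \prod_(j <- r) f j t) @ U --> \prod_(j <- r) l j.
Proof.
move=> fl; elim: r => [|j r IH].
  by under eq_cvg do rewrite big_nil; rewrite big_nil; exact: cvg_cst.
rewrite big_cons; under eq_cvg do rewrite big_cons.
by apply: cvgM => //; exact: fl.
Qed.

Lemma mcvg_cst m n (L : 'M[R]_(m, n)) : mcvg (fun=> L) L.
Proof. by move=> i j; exact: cvg_cst. Qed.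

Lemma mcvg_near m n (X Y : T -> 'M[R]_(m, n)) L :
  (\forall t \near U, X t = Y t) -> mcvg X L -> mcvg Y L.
Proof.
move=> XY XL i j; apply: cvg_trans (XL i j); apply: near_eq_cvg.
by apply: filterS XY => t ->.
Qed.

Lemma mcvgD m n (X Y : T -> 'M[R]_(m, n)) L M :
  mcvg X L -> mcvg Y M -> mcvg (fun t => X t + Y t) (L + M).
Proof.
by move=> XL YM i j; rewrite mxE; under eq_cvg do rewrite mxE; apply: cvgD.
Qed.

Lemma mcvgZ m n (a : T -> R) (X : T -> 'M[R]_(m, n)) (b : R) L :
  a @ U --> b -> mcvg X L -> mcvg (fun t => a t *: X t) (b *: L).
Proof.
by move=> ab XL i j; rewrite mxE; under eq_cvg do rewrite mxE; apply: cvgM.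
Qed.

Lemma mcvgB m n (X Y : T -> 'M[R]_(m, n)) L M :
  mcvg X L -> mcvg Y M -> mcvg (fun t => X t - Y t) (L - M).
Proof.
by move=> XL YM i j; rewrite !mxE; under eq_cvg do rewrite !mxE; apply: cvgB.
Qed.

Lemma mcvgM m n p (X : T -> 'M[R]_(m, n)) (Y : T -> 'M[R]_(n, p)) L M :
  mcvg X L -> mcvg Y M -> mcvg (fun t => X t *m Y t) (L *m M).
Proof.
move=> XL YM i j; rewrite mxE; under eq_cvg do rewrite mxE.
by apply: cvg_bigsum => k _; apply: cvgM.
Qed.

Lemma mcvg_trace n (X : T -> 'M[R]_n) L : mcvg X L -> (fun t => \tr (X t)) @ U --> \tr L.
Proof. by move=> XL; apply: cvg_bigsum => k _. Qed.

Lemma mcvg_det n (X : T -> 'M[R]_n) L : mcvg X L -> (fun t => \det (X t)) @ U --> \det L.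
Proof.
move=> XL; apply: cvg_bigsum => s _; apply: cvgM; first exact: cvg_cst.
by apply: cvg_bigprod.
Qed.

Lemma mcvg_unique {UP : ProperFilter U} m n (X : T -> 'M[R]_(m, n)) L M :
  mcvg X L -> mcvg X M -> L = M.
Proof.
move=> XL XM; apply/matrixP => i j.
exact: (cvg_unique (@Rhausdorff R) (XL i j) (XM i j)).
Qed.

Lemma mcvg_block m1 m2 n1 n2 X11 X12 X21 X22 L11 L12 L21 L22 :
  @mcvg m1 n1 X11 L11 -> @mcvg m1 n2 X12 L12 -> @mcvg m2 n1 X21 L21 ->
  @mcvg m2 n2 X22 L22 ->
  mcvg (fun t => block_mx (X11 t) (X12 t) (X21 t) (X22 t)) (block_mx L11 L12 L21 L22).
Proof.
move=> h1 h2 h3 h4 i j; rewrite -(splitK i) -(splitK j).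
case: (fintype.split i) => k; case: (fintype.split j) => l /=.
- by rewrite block_mxEul; under eq_cvg do rewrite block_mxEul; exact: h1.
- by rewrite block_mxEur; under eq_cvg do rewrite block_mxEur; exact: h2.
- by rewrite block_mxEdl; under eq_cvg do rewrite block_mxEdl; exact: h3.
- by rewrite block_mxEdr; under eq_cvg do rewrite block_mxEdr; exact: h4.
Qed.

Lemma mcvg_wordmx (I : Type) n (X : T -> I -> 'M[R]_n) L w :
  (forall i, mcvg (X ^~ i) (L i)) -> mcvg (fun t => wordmx (X t) w) (wordmx L w).
Proof.
by move=> XL; elim: w => [|i w IH] /=; [exact: mcvg_cst|exact: mcvgM].
Qed.

Lemma mcvg_ncev (I : Type) n (X : T -> I -> 'M[R]_n) L p :
  (forall i, mcvg (X ^~ i) (L i)) -> mcvg (fun t => ncev (X t) p) (ncev L p).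
Proof.
move=> XL i j; rewrite summxE; under eq_cvg do rewrite summxE.
apply: cvg_bigsum => c _; rewrite mxE; under eq_cvg do rewrite mxE.
by apply: cvgM; [exact: cvg_cst|exact: mcvg_wordmx].
Qed.

End MatrixLimits.

Section Degenerations.
Variables (R : realType) (I : Type).
Implicit Types (p q : seq (R * seq I)).

Definition rectinv m n (P : 'M[R]_(m, n)) (Q : 'M_(n, m)) :=
  P *m Q = 1%:M /\ Q *m P = 1%:M.

(** A limit of conjugates of [A]. The two sizes are equal by [rect_inv_dim] but remain distinct
    terms, since one of them is often a sum of ranks. *)
Definition degen1 n m (A : I -> 'M[R]_n) (B : I -> 'M[R]_m) :=
  exists P Q, (forall k : nat, rectinv (P k) (Q k)) /\
    forall i, mcvg \oo (fun k => P k *m A i *m Q k) (B i).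

(** Chains of limits of conjugates: transitivity is then free, and traces, polynomial relations and
    the class under [chi] are followed one link at a time. *)
Inductive degen n (A : I -> 'M[R]_n) : forall m, (I -> 'M[R]_m) -> Prop :=
| degen_refl : degen A A
| degen_step m (B : I -> 'M_m) m' (B' : I -> 'M_m') :
    degen A B -> degen1 B B' -> degen A B'.

Lemma degen1_conj n m (A : I -> 'M[R]_n) (B : I -> 'M[R]_m) P Q :
  rectinv P Q -> (forall i, P *m A i *m Q = B i) -> degen1 A B.
Proof.
move=> PQ AB; exists (fun=> P), (fun=> Q); split=> // i.
by rewrite AB; exact: mcvg_cst.
Qed.

(** Conjugation by the diagonal blocks 1 and 1/(k+1) fixes the diagonal blocks and divides the lower
    left one by k+1. *)
Lemma degen1_tri n m (a : I -> 'M[R]_n) (b : I -> 'M_(m, n)) (d : I -> 'M[R]_m) :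
  degen1 (fun i => block_mx (a i) 0 (b i) (d i)) (blockdiag a d).
Proof.
pose P (k : nat) : 'M[R]_(n + m) := block_mx 1%:M 0 0 (k.+1%:R^-1)%:M.
pose Q (k : nat) : 'M[R]_(n + m) := block_mx 1%:M 0 0 (k.+1%:R)%:M.
exists P, Q; split=> [k|i].
  by split; rewrite mulmx_block !(mulmx0, mul0mx, addr0, add0r) mulmx1 -scalar_mxM
    ?mulVf ?mulfV ?pnatr_eq0// -scalar_mx_block.
have -> : (fun k => P k *m block_mx (a i) 0 (b i) (d i) *m Q k) =
          (fun k => block_mx (a i) 0 (k.+1%:R^-1 *: b i) (d i)).
  apply/funext => k; rewrite !mulmx_block !(mulmx0, mul0mx, addr0, add0r) !mulmx1 !mul1mx.
  by rewrite !mul_scalar_mx -scalemxAl mul_mx_scalar scalerA mulVf ?pnatr_eq0// scale1r.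
apply: mcvg_block; [exact: mcvg_cst|exact: mcvg_cst| |exact: mcvg_cst].
rewrite -[X in mcvg _ _ X](scale0r (b i)); apply: (@mcvgZ _ _ _ _ _ _ _ (fun=> b i)); last exact: mcvg_cst.
exact: cvg_harmonic.
Qed.

Lemma degen_trans n m l (A : I -> 'M[R]_n) (B : I -> 'M[R]_m) (C : I -> 'M[R]_l) :
  degen A B -> degen B C -> degen A C.
Proof. by move=> AB; elim=> [|m1 B1 m2 B2 _ IH s] //; exact: degen_step IH s. Qed.

Lemma degen1W n m (A : I -> 'M[R]_n) (B : I -> 'M[R]_m) : degen1 A B -> degen A B.
Proof. by apply: degen_step; exact: degen_refl. Qed.

Lemma degen_blockdiag l (c : I -> 'M[R]_l) n m (A : I -> 'M[R]_n) (B : I -> 'M[R]_m) :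
  degen A B -> degen (blockdiag c A) (blockdiag c B).
Proof.
elim=> [|m1 B1 m2 B2 _ IH [P [Q [PQ lim]]]]; first exact: degen_refl.
apply: degen_step IH _.
exists (fun k => block_mx 1%:M 0 0 (P k)), (fun k => block_mx 1%:M 0 0 (Q k)).
split=> [k|i].
  have [h1 h2] := PQ k.
  by split; rewrite mulmx_block !(mulmx0, mul0mx, addr0, add0r) mulmx1 ?h1 ?h2 -scalar_mx_block.
under [X in mcvg _ X]funext do rewrite !mulmx_block !(mulmx0, mul0mx, addr0, add0r) mulmx1 mul1mx.
by apply: mcvg_block => //; exact: mcvg_cst.
Qed.

Lemma degen_ncev n m (A : I -> 'M[R]_n) (B : I -> 'M[R]_m) p :
  degen A B -> ncev A p = 0 -> ncev B p = 0.
Proof.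
move=> AB A0; elim: AB => // m1 B1 m2 B2 _ IH [P [Q [PQ lim]]].
apply: mcvg_unique (mcvg_ncev (p := p) lim) _.
rewrite [X in mcvg _ X](_ : _ = fun=> 0); first exact: mcvg_cst.
apply/funext => k; have [h1 h2] := PQ k.
rewrite -[LHS]mulmx1 -h1 mulmxA -(ncev_intertwine (P := P k) (A := B1)) ?IH ?mulmx0 ?mul0mx//.
by move=> i; rewrite -!mulmxA h2 mulmx1.
Qed.

Lemma degen_sametrace n m (A : I -> 'M[R]_n) (B : I -> 'M[R]_m) :
  degen A B -> sametrace A B.
Proof.
move=> AB w; elim: AB => // m1 B1 m2 B2 _ -> [P [Q [PQ lim]]].
apply: (cvg_unique (@Rhausdorff R)) (mcvg_trace (mcvg_wordmx (w := w) lim)).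
rewrite (_ : (fun t => _) = fun=> \tr (wordmx B1 w)); first exact: cvg_cst.
apply/funext => k; have [h1 h2] := PQ k.
rewrite -[wordmx _ _]mulmx1 -h1 mulmxA -(wordmx_intertwine (P := P k) (A := B1)).
  by rewrite -mulmxA mxtrace_mulC -mulmxA h2 mulmx1.
by move=> i; rewrite -!mulmxA h2 mulmx1.
Qed.

Lemma degen_stable n (A : I -> 'M[R]_n) (U : 'M[R]_n) : stablefam A U ->
  exists (a : I -> 'M[R]_(\rank U)) (d : I -> 'M[R]_(\rank U^C)%MS),
  degen A (blockdiag a d) /\ forall i, a i *m row_base U = row_base U *m A i.
Proof.
move=> /stable_split[P [Q [a [b [d [PQ QP AE aE]]]]]].
exists a, d; split=> //; apply: degen_step (degen1_tri a b d).
by apply: degen1W; apply: degen1_conj AE.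
Qed.

Lemma degen_swap n1 n2 n3 (a : I -> 'M[R]_n1) (b : I -> 'M[R]_n2) (c : I -> 'M[R]_n3) :
  degen (blockdiag a (blockdiag b c)) (blockdiag b (blockdiag a c)).
Proof.
pose P : 'M[R]_(n2 + (n1 + n3), n1 + (n2 + n3)) :=
  col_mx (row_mx 0 (row_mx 1%:M 0))
         (col_mx (row_mx 1%:M (row_mx 0 0)) (row_mx 0 (row_mx 0 1%:M))).
pose Q : 'M[R]_(n1 + (n2 + n3), n2 + (n1 + n3)) :=
  col_mx (row_mx 0 (row_mx 1%:M 0))
         (col_mx (row_mx 1%:M (row_mx 0 0)) (row_mx 0 (row_mx 0 1%:M))).
have PQ : rectinv P Q.
  split; rewrite /P /Q !mul_col_mx !mul_row_col !mul_mx_row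
    !(mul0mx, mul1mx, mulmx0, mulmx1, add0r, addr0, add_row_mx, row_mx0)
    !scalar_mx_block /block_mx; congr col_mx;
    by rewrite -[LHS]/(block_mx _ _ _ _) block_mxEh col_mx0.
apply: degen1W; apply: (degen1_conj PQ) => i.
have [PQ1 QP1] := PQ; rewrite -[RHS]mulmx1 -PQ1 mulmxA; congr (_ *m Q).
rewrite /P /blockdiag !mul_col_mx !mul_row_block !mul_row_col !mul_mx_row.
rewrite !mul_block_col !mul_mx_row !add_row_mx.
by rewrite !(mul0mx, mul1mx, mulmx0, mulmx1, add0r, addr0, row_mx0, add_row_mx).
Qed.

End Degenerations.

(** * The entrywise l1 norm *)

Section EntrywiseNorm.
Variable R : realType.

Definition nrm m n (X : 'M[R]_(m, n)) := \sum_i \sum_j `|X i j|.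

Lemma nrm_ge0 m n (X : 'M[R]_(m, n)) : 0 <= nrm X.
Proof. by do 2!apply: sumr_ge0 => ? _. Qed.

Lemma entry_le_nrm m n (X : 'M[R]_(m, n)) i j : `|X i j| <= nrm X.
Proof.
rewrite /nrm (bigD1 i)//= (bigD1 j)//= -addrA lerDl addr_ge0//.
  exact: sumr_ge0.
by do 2!apply: sumr_ge0 => ? _.
Qed.

Lemma nrm0 m n : nrm (0 : 'M[R]_(m, n)) = 0.
Proof. by do 2!rewrite /nrm big1// => ? _; rewrite mxE normr0. Qed.

Lemma nrm_eq0 m n (X : 'M[R]_(m, n)) : nrm X <= 0 -> X = 0.
Proof.
move=> X0; apply/matrixP => i j; apply/eqP; rewrite mxE -normr_le0.
exact: le_trans (entry_le_nrm X i j) X0.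
Qed.

Lemma nrmD m n (X Y : 'M[R]_(m, n)) : nrm (X + Y) <= nrm X + nrm Y.
Proof.
rewrite /nrm -big_split; apply: ler_sum => i _; rewrite -big_split /=.
by apply: ler_sum => j _; rewrite mxE ler_normD.
Qed.

Lemma nrmN m n (X : 'M[R]_(m, n)) : nrm (- X) = nrm X.
Proof. by do 2!apply: eq_bigr => ? _; rewrite mxE normrN. Qed.

Lemma nrmB m n (X Y : 'M[R]_(m, n)) : nrm (X - Y) <= nrm X + nrm Y.
Proof. by rewrite -(nrmN Y) nrmD. Qed.

Lemma nrmBC m n (X Y : 'M[R]_(m, n)) : nrm (X - Y) = nrm (Y - X).
Proof. by rewrite -nrmN opprB. Qed.

Lemma nrm_triangle m n (X Y Z : 'M[R]_(m, n)) : nrm (X - Z) <= nrm (X - Y) + nrm (Y - Z).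
Proof. by rewrite -{1}(subrK Y X) -addrA nrmD. Qed.

Lemma nrmZ m n a (X : 'M[R]_(m, n)) : nrm (a *: X) = `|a| * nrm X.
Proof.
rewrite /nrm mulr_sumr; apply: eq_bigr => i _; rewrite mulr_sumr.
by apply: eq_bigr => j _; rewrite mxE normrM.
Qed.

Lemma nrmM m n p (X : 'M[R]_(m, n)) (Y : 'M[R]_(n, p)) : nrm (X *m Y) <= nrm X * nrm Y.
Proof.
rewrite /nrm mulr_suml; apply: ler_sum => i _.
apply: (@le_trans _ _ (\sum_j \sum_k `|X i k| * `|Y k j|)).
  apply: ler_sum => j _; rewrite mxE; apply: le_trans (ler_norm_sum _ _ _) _.
  by apply: ler_sum => k _; rewrite normrM.
rewrite exchange_big mulr_suml; apply: ler_sum => k _ /=.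
rewrite -mulr_sumr ler_wpM2l// [leRHS](bigD1 k)//= lerDl.
by do 2!apply: sumr_ge0 => ? _.
Qed.

Lemma nrm_block m1 m2 n1 n2 (A : 'M[R]_(m1, n1)) (B : 'M[R]_(m1, n2)) (C : 'M[R]_(m2, n1)) D :
  nrm (block_mx A B C D) = nrm A + nrm B + (nrm C + nrm D).
Proof.
rewrite /nrm big_split_ord /=; congr (_ + _); rewrite -big_split /=; apply: eq_bigr => i _;
  rewrite big_split_ord; congr (_ + _); apply: eq_bigr => j _.
- by rewrite block_mxEul.
- by rewrite block_mxEur.
- by rewrite block_mxEdl.
- by rewrite block_mxEdr.
Qed.

Lemma nrm_scalar n a : nrm (a%:M : 'M[R]_n) = n%:R * `|a|.
Proof.
rewrite /nrm (eq_bigr (fun=> `|a|)) ?sumr_const ?card_ord ?mulr_natl// => i _.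
rewrite (bigD1 i)//= big1 ?addr0 ?mxE ?eqxx// => j ji.
by rewrite mxE eq_sym (negbTE ji) normr0.
Qed.

Lemma nrm_trace n (X : 'M[R]_n) : `|\tr X| <= nrm X.
Proof.
apply: le_trans (ler_norm_sum _ _ _) _; apply: ler_sum => i _.
by rewrite [leRHS](bigD1 i)//= lerDl sumr_ge0.
Qed.

Lemma cvg_nrm (T : Type) (U : set_system T) {UF : Filter U} m n (X : T -> 'M[R]_(m, n)) L :
  mcvg U X L -> (fun t => nrm (X t)) @ U --> nrm L.
Proof.
by move=> XL; apply: cvg_bigsum => i _; apply: cvg_bigsum => j _; exact: cvg_norm.
Qed.

Lemma mcvgP (T : Type) (U : set_system T) {UF : Filter U} m n (X : T -> 'M[R]_(m, n)) L :
  mcvg U X L <-> forall e, 0 < e -> \forall t \near U, nrm (X t - L) < e.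
Proof.
split=> [XL e e0|h i j].
  have : mcvg U (fun t => X t - L) (L - L) by apply: mcvgB => //; exact: mcvg_cst.
  move=> /cvg_nrm; rewrite subrr nrm0 => /cvgrPdist_lt /(_ e e0).
  by apply: filterS => t; rewrite sub0r normrN ger0_norm ?nrm_ge0.
apply/cvgrPdist_lt => e /h; apply: filterS => t; apply: le_lt_trans.
by rewrite distrC; have := entry_le_nrm (X t - L) i j; rewrite !mxE.
Qed.

End EntrywiseNorm.

(** * Families with the same traces *)

Section NilTraces.
Variables (R : realType).

(** If a minimal stable subspace is not killed, minimality gives a row [x] and a polynomial [p] such
    that [A i] followed by [p] fixes [x]. The Fitting idempotent of this product also fixes [x]; but
    it begins with [A i], so its trace is a combination of traces of nonempty words. Its rank is
    therefore zero, which is absurd. *)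
Lemma nil_common_kernel (I : Type) n (A : I -> 'M[R]_n) : (0 < n)%N ->
  (forall i w, \tr (wordmx A (i :: w)) = 0) ->
  exists2 v : 'rV_n, v != 0 & forall i, v *m A i = 0.
Proof.
move=> n0 trA; have [U [stU U0 minU]] := min_stable A n0.
have trI i p : \tr (A i *m ncev A p) = 0.
  rewrite mulmx_sumr raddf_sum big1// => c _ /=.
  by rewrite -scalemxAr mxtraceZ (trA i) mulr0.
have [UA|] := pselect (forall i, U *m A i = 0).
  have [k Uk] : exists k, row k U != 0.
    apply/existsP; apply: contra_neqT U0 => /existsPn h.
    by apply/row_matrixP => k; rewrite row0; apply/eqP; rewrite -[_ == _]negbK h.
  by exists (row k U) => // i; rewrite -row_mul UA row0.
move=> /existsNP[i /eqP UA].
have [k Uk] : exists k, row k U *m A i != 0.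
  apply/existsP; apply: contra_neqT UA => /existsPn h.
  by apply/row_matrixP => k; rewrite row_mul row0; apply/eqP; rewrite -[_ == _]negbK h.
set x := row k U in Uk; have [W stW WP] := cyclic_fam A (x *m A i).
have UW : (U <= W)%MS.
  apply: submx_trans (capmxSl W U); apply: minU => [j||].
  - by rewrite sub_capmx; apply/andP; split;
      [apply: submx_trans (stW j)|apply: submx_trans (stU j)]; rewrite submxMr ?capmxSl ?capmxSr.
  - exact: capmxSr.
  apply: contraNneq Uk => WU0; rewrite -submx0 -WU0 sub_capmx; apply/andP; split.
    by apply/WP; exists (ncC 1); rewrite ncevC mulmx1.
  by apply: submx_trans (stU i); rewrite submxMr// row_sub.
have /WP[p xp] : (x <= W)%MS by apply: submx_trans UW; exact: row_sub.
pose y := ncmul [:: (1, [:: i])] p.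
have xy : x *m ncev A y = x by rewrite ncevM ncev_gen mulmxA -xp.
have [r /(_ n A)[|ff _ /(_ x xy) xf]] :=
    nc_fitting y (monic_neq0 (char_poly_monic (ncev A y))).
  exact: nc_Cayley_Hamilton.
have := idem_trace ff; rewrite [in LHS]ncevM [in LHS]ncevM ncev_gen -mulmxA -ncevM trI.
move=> /esym/eqP; rewrite pnatr_eq0 mxrank_eq0 => /eqP f0.
by move: Uk; rewrite -xf f0 mulmx0 mul0mx eqxx.
Qed.

(** A common kernel vector gives a block triangular form with zero first rows. Induction makes the
    remaining diagonal block small, and a diagonal scaling then shrinks the off-diagonal block
    without changing the diagonal ones. *)
Lemma nil_small (I : finType) n (A : I -> 'M[R]_n) e : 0 < e ->
  (forall i w, \tr (wordmx A (i :: w)) = 0) ->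
  exists P Q, rectinv P Q /\ forall i, nrm (P *m A i *m Q : 'M_n) < e.
Proof.
move=> e0; have [k] := ubnP n; elim: k e e0 n A => // k IH e e0 [|n] A nk trA.
  exists 1%:M, 1%:M; split=> [|i]; first by split; rewrite mulmx1.
  by rewrite /nrm big_ord0.
have [v v0 vA] := nil_common_kernel (ltn0Sn n) trA.
have stv : stablefam A <<v>>%MS by move=> i; rewrite (eqmxMr _ (genmxE v)) vA sub0mx.
have [P [Q [a [b [d [PQ QP AE aE]]]]]] := stable_split stv.
have a0 i : a i = 0.
  apply: (row_free_inj (row_base_free <<v>>%MS)); rewrite mul0mx aE.
  have : (row_base <<v>>%MS *m A i <= v *m A i)%MS by rewrite submxMr// eq_row_base genmxE.
  by rewrite vA => /submxP[X ->]; rewrite mulmx0.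
have rv : \rank (<<v>>%MS : 'M[R]_n.+1) = 1%N by rewrite genmxE rank_rV v0.
have [||P' [Q' [[PQ' QP'] small]]] := IH _ (divr_gt0 e0 (ltr0Sn R 1)) _ d.
- by rewrite mxrank_compl rv subSS subn0.
- move=> i w; have := trA i w.
  rewrite -[wordmx A _]mulmx1 -QP mulmxA mxtrace_mulC mulmxA.
  rewrite (wordmx_intertwine (B := fun i => block_mx (a i) 0 (b i) (d i))); last first.
    by move=> j; rewrite -AE -!mulmxA QP mulmx1.
  rewrite -mulmxA PQ mulmx1; have [b' ->] := wordmx_tri a b d (i :: w).
  by rewrite mxtrace_block /= a0 mul0mx mxtrace0 add0r.
(* [B] dominates all off-diagonal blocks, so scaling by [c] leaves them at most [e / 2]; the
   induction hypothesis is applied with the other half of [e]. *)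
pose B := 1 + \sum_i nrm (P' *m b i); pose c := e / 2 / B.
have B1 : 1 <= B by rewrite lerDl sumr_ge0// => i _; exact: nrm_ge0.
have B0 : 0 < B by exact: lt_le_trans ltr01 B1.
have c0 : 0 < c by rewrite !divr_gt0.
pose D := block_mx 1%:M 0 0 (c *: P') : 'M_(\rank <<v>>%MS + \rank (<<v>>^C)%MS).
pose D' := block_mx 1%:M 0 0 (c^-1 *: Q') : 'M_(\rank <<v>>%MS + \rank (<<v>>^C)%MS).
have DD' : D *m D' = 1%:M.
  rewrite mulmx_block !(mulmx0, mul0mx, addr0, add0r) mulmx1 -scalemxAl -scalemxAr.
  by rewrite scalerA mulfV ?gt_eqF// scale1r PQ' -scalar_mx_block.
have D'D : D' *m D = 1%:M.
  rewrite mulmx_block !(mulmx0, mul0mx, addr0, add0r) mulmx1 -scalemxAl -scalemxAr.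
  by rewrite scalerA mulVf ?gt_eqF// scale1r QP' -scalar_mx_block.
have e1 := rect_inv_dim PQ QP.
have main i : nrm (D *m P *m A i *m (Q *m D')) < e.
  rewrite !mulmxA -(mulmxA D) -(mulmxA D) AE a0 !mulmx_block.
  rewrite !(mulmx0, mul0mx, addr0, add0r) mulmx1 -!scalemxAl -!scalemxAr scalerA.
  rewrite mulfV ?gt_eqF// scale1r nrm_block !nrm0 !add0r nrmZ gtr0_norm//.
  have : c * nrm (P' *m b i) <= e / 2.
    rewrite /c mulrAC -[leRHS]mulr1 -mulrA.
    apply: ler_wpM2l; first by rewrite divr_ge0// ltW.
    rewrite ler_pdivrMr// mul1r /B (bigD1 i)//= addrCA lerDl addr_ge0//.
    by apply: sumr_ge0 => j _; exact: nrm_ge0.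
  have := small i; lra.
(* The sum of the two ranks equals [n.+1] only propositionally; everything typed by it is
   generalised before the substitution. *)
move: D P D' Q PQ QP DD' D'D main {small AE} => /=.
move: (\rank _ + _)%N e1 => m em; subst m => D P D' Q PQ QP DD' D'D main.
exists (D *m P), (Q *m D'); split=> //; split.
  by rewrite mulmxA -(mulmxA D) PQ mulmx1.
by rewrite mulmxA -(mulmxA Q) D'D mulmx1.
Qed.
End NilTraces.

(** * Common degenerations of families with equal traces *)

Section SameTrace.
Variables (R : realType) (I : Type).
Implicit Types (p q e : seq (R * seq I)).

(** Minimal stable subspaces are split off one after another. Traces add over the blocks, so some
    simple block must see the nonzero trace of [e]; it is then moved to the front by
    [degen_swap]. *)
Lemma degen_simple n (A : I -> 'M[R]_n) e : \tr (ncev A e) != 0 ->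
  exists m r (s : I -> 'M[R]_m) (t : I -> 'M[R]_r),
  [/\ degen A (blockdiag s t), simplefam s & \tr (ncev s e) != 0].
Proof.
have [k] := ubnP n; elim: k n A => // k IH n A nk trA.
have n0 : (0 < n)%N.
  by move: trA; case: (n) A => // A; rewrite /mxtrace big_ord0 eqxx.
have [U [stU U0 minU]] := min_stable A n0.
have [a [d [Aad aE]]] := degen_stable stU.
have sa := min_stable_simple U0 minU aE.
have [tra|tra] := eqVneq (\tr (ncev a e)) 0; last by exists _, _, a, d.
have [||m [r [s [t [dst ss trs]]]]] := IH _ d.
- rewrite mxrank_compl -(ltn_add2l (\rank U)) subnKC ?rank_leq_col//.
  by apply: leq_trans nk _; rewrite -add1n leq_add2r lt0n mxrank_eq0.
- move: trA; rewrite (sametrace_ncev _ (degen_sametrace Aad)) ncev_diag.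
  by rewrite mxtrace_block tra add0r.
exists _, _, s, (blockdiag a t); split=> //.
apply: degen_trans (degen_trans Aad (degen_blockdiag a dst)) _.
exact: degen_swap.
Qed.

Lemma sametrace_dim n m (A : I -> 'M[R]_n) (B : I -> 'M[R]_m) : sametrace A B -> n = m.
Proof.
by move=> /(_ [::]) /=; rewrite !mxtrace1 => /eqP; rewrite eqr_nat => /eqP.
Qed.

(* Minimal rank makes [e] primitive modulo the radical. *)
Lemma min_idem n m (A : I -> 'M[R]_n) (B : I -> 'M[R]_m) : (0 < n)%N ->
  exists e, [/\ ncev A e *m ncev A e = ncev A e, ncev B e *m ncev B e = ncev B e,
    ncev A e != 0 &
    forall p, ncev A p *m ncev A p = ncev A p -> ncev B p *m ncev B p = ncev B p ->
      ncev A p != 0 -> (\rank (ncev A e) <= \rank (ncev A p))%N].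
Proof.
move=> n0.
pose P r := `[< exists p, [/\ ncev A p *m ncev A p = ncev A p,
  ncev B p *m ncev B p = ncev B p, ncev A p != 0 & \rank (ncev A p) = r] >].
have exP : exists r, P r.
  exists n; apply/asboolP; exists (ncC 1); rewrite !ncevC !mulmx1 mxrank1.
  by split=> //; rewrite -mxrank_eq0 mxrank1 -lt0n.
have [r /asboolP[e [eA eB e0 er]] minr] := ex_minnP exP.
exists e; split=> // p pA pB p0; rewrite er; apply: minr.
by apply/asboolP; exists p.
Qed.

(** The row space of [f] lies in that of [e], hence equals it by rank, so [e] is a left multiple of
    [f] and [e *m f = e]. The factorisation through [e] on the left gives [e *m f = f]. *)
Lemma idem_sub_eq n (e f x y : 'M[R]_n) :
  e *m e = e -> f *m f = f -> f = e *m x -> f = y *m e ->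
  (\rank e <= \rank f)%N -> f = e.
Proof.
move=> ee ff fex fye ref.
have fe : (f <= e)%MS by rewrite fye submxMl.
have /submxP[z ez] : (e <= f)%MS by rewrite -(geq_leqif (mxrank_leqif_sup fe)).
have : e *m f = f by rewrite fex mulmxA ee.
by rewrite ez -mulmxA ff.
Qed.

(** The annihilator condition makes the map from [v *m ncev s p] to [v' *m ncev t p] well defined.
    Its graph is the row space [U]; dividing the right half of [U] by the left one gives the matrix
    [Z] of the map, which intertwines the families, sends [v] to [v'] and is therefore bijective by
    simplicity on both sides. *)
Lemma Schur_iso n m (s : I -> 'M[R]_n) (t : I -> 'M[R]_m) (v : 'rV_n) (v' : 'rV_m) :
  simplefam s -> simplefam t -> v != 0 -> v' != 0 ->
  (forall p, v *m ncev s p = 0 -> v' *m ncev t p = 0) ->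
  exists P Q, rectinv P Q /\ forall i, P *m s i *m Q = t i.
Proof.
move=> ss st v0 v'0 vv'.
have [||U UP] := @linear_pred_mx R (n + m)
    (fun w => exists p, w = row_mx (v *m ncev s p) (v' *m ncev t p)).
- by exists [::]; rewrite /ncev !big_nil !mulmx0 row_mx0.
- move=> a x y [p ->] [q ->]; exists (ncmul (ncC a) p ++ q).
  by rewrite (ncevD s) (ncevD t) 2!ncevM 2!ncevC !mul_scalar_mx !mulmxDr -!scalemxAr scale_row_mx add_row_mx.
pose X := lsubmx U; pose Y := rsubmx U.
have XYP (c : 'rV_(n + m)) : exists p, c *m X = v *m ncev s p /\ c *m Y = v' *m ncev t p.
  have /UP[p] : (c *m U <= U)%MS by rewrite submxMl.
  rewrite -[U in LHS]hsubmxK mul_mx_row => /eq_row_mx[cX cY].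
  by exists p.
have inX p : exists c : 'rV_(n + m), c *m X = v *m ncev s p /\ c *m Y = v' *m ncev t p.
  have : (row_mx (v *m ncev s p) (v' *m ncev t p) <= U)%MS by apply/UP; exists p.
  move=> /submxP[c]; rewrite -[U in RHS]hsubmxK mul_mx_row => /eq_row_mx[cX cY].
  by exists c.
pose Z := pinvmx X *m Y.
have Zp p : v *m ncev s p *m Z = v' *m ncev t p.
  have [c [cX cY]] := inX p.
  have [q [qX qY]] := XYP (v *m ncev s p *m pinvmx X).
  rewrite /Z mulmxA qY; move: qX; rewrite mulmxKpV; last first.
    by rewrite -cX submxMl.
  move=> pq; have := vv' (q ++ ncmul (ncC (-1)) p).
  rewrite (ncevD s) (ncevD t) 2!ncevM 2!ncevC !mul_scalar_mx !scaleN1r !mulmxBr pq subrr.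
  by move=> /(_ erefl)/eqP; rewrite subr_eq0 => /eqP.
clearbody Z.
have v'E : v *m Z = v' by have := Zp (ncC 1); rewrite !ncevC !mulmx1.
have Zi i : s i *m Z = Z *m t i.
  apply/row_matrixP => k; rewrite !rowE !mulmxA.
  have [p kp] := simplefam_cyclic (delta_mx 0 k) ss v0.
  have := Zp (ncmul p [:: (1, [:: i])]).
  by rewrite !ncevM !ncev_gen !mulmxA -(Zp p) -kp.
have Zfree : row_free Z.
  rewrite -kermx_eq0; apply: contraT => kerZ.
  have /ss.2 /(_ kerZ) : stablefam s (kermx Z).
    by move=> i; apply/sub_kermxP; rewrite -mulmxA Zi mulmxA mulmx_ker mul0mx.
  move=> /row_fullP[W WK]; move: v'0; rewrite -v'E -[v]mulmx1 -WK.
  by rewrite -(mulmxA v) -(mulmxA W) mulmx_ker !mulmx0 eqxx.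
have Zfull : row_full Z.
  rewrite -sub1mx -(genmxE Z) sub1mx; apply: st.2 => [i|].
    by rewrite (eqmxMr _ (genmxE Z)) genmxE -Zi submxMl.
  apply: contraNneq v'0 => Z0; rewrite -v'E -submx0 -Z0 genmxE submxMl//.
exists (pinvmx Z), Z; split; first by split; [exact: mulVpmx|exact: mulmxVp].
by move=> i; rewrite -mulmxA Zi mulmxA mulVpmx// mul1mx.
Qed.

Definition ncsub p q := p ++ ncmul (ncC (-1)) q.

Lemma ncev_sub n (A : I -> 'M[R]_n) p q : ncev A (ncsub p q) = ncev A p - ncev A q.
Proof. by rewrite /ncsub ncevD ncevM ncevC mul_scalar_mx scaleN1r. Qed.

Lemma degen_fst_eq n m l (A : I -> 'M[R]_n) (s : I -> 'M[R]_m) (t : I -> 'M[R]_l) p q :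
  degen A (blockdiag s t) -> ncev A p = ncev A q -> ncev s p = ncev s q.
Proof.
move=> dA pq; have : ncev A (ncsub p q) = 0 by rewrite ncev_sub pq subrr.
move=> /(degen_ncev dA); rewrite ncev_diag -(block_mx0 R m l m l) => /eq_block_mx[+ _ _ _].
by rewrite ncev_sub => /eqP; rewrite subr_eq0 => /eqP.
Qed.

Lemma fixed_row n (f : 'M[R]_n) : f *m f = f -> f != 0 ->
  exists2 v : 'rV_n, v != 0 & v *m f = v.
Proof.
move=> ff f0; have [k fk] : exists k, row k f != 0.
  apply/existsP; apply: contra_neqT f0 => /existsPn h.
  by apply/row_matrixP => k; rewrite row0; apply/eqP; rewrite -[_ == _]negbK h.
by exists (row k f) => //; rewrite -row_mul ff.
Qed.

(** A simple block common to both families is split off; the traces of the rest agree by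
    subtraction, and induction applies. The two simple blocks are isomorphic because [e] is a
    minimal idempotent: a polynomial [a] killing [v] but not [v'] would produce an idempotent [f]
    between two factors [e], nonzero in [B] and hence, by traces, in [A]. Minimality forces [f] to
    equal [e] in [A], although [e] fixes [v] and [f] kills it. *)
Lemma sametrace_degen n m (A : I -> 'M[R]_n) (B : I -> 'M[R]_m) :
  sametrace A B -> exists k (D : I -> 'M[R]_k), degen A D /\ degen B D.
Proof.
have [N] := ubnP n; elim: N n m A B => // N IH n m A B nN AB.
have mn := sametrace_dim AB; subst m.
have [n0|] := posnP n.
  have -> : B = A.
    by apply/funext => i; move: (A i) (B i); rewrite n0 => a b; rewrite [a]thinmx0 [b]thinmx0.
  by exists n, A; split; exact: degen_refl.
move=> n0; have [e [eA eB e0 mine]] := min_idem A B n0.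
have trA0 p : ncev A p *m ncev A p = ncev A p -> ncev B p *m ncev B p = ncev B p ->
    (ncev A p == 0) = (ncev B p == 0).
  move=> /idem_trace pA /idem_trace pB; have := sametrace_ncev p AB.
  by rewrite pA pB => /eqP; rewrite eqr_nat -!mxrank_eq0 => /eqP ->.
have trne (C : I -> 'M[R]_n) : ncev C e *m ncev C e = ncev C e -> ncev C e != 0 -> \tr (ncev C e) != 0.
  by move=> /idem_trace ->; rewrite pnatr_eq0 mxrank_eq0.
have [m1 [r1 [s [t [dA ss trs]]]]] := degen_simple (trne A eA e0).
have [m2 [r2 [s' [t' [dB ss' trs']]]]] : exists m r (s : I -> 'M[R]_m) (t : I -> 'M[R]_r),
    [/\ degen B (blockdiag s t), simplefam s & \tr (ncev s e) != 0].
  by apply/degen_simple/trne => //; rewrite -trA0.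
have idem l l' (C : I -> 'M[R]_n) (x : I -> 'M[R]_l) (y : I -> 'M[R]_l') :
    degen C (blockdiag x y) -> ncev C e *m ncev C e = ncev C e -> \tr (ncev x e) != 0 ->
    exists2 v : 'rV_l, v != 0 & v *m ncev x e = v.
  move=> dC eC trx; apply: fixed_row; last by apply: contraNneq trx => ->; rewrite mxtrace0.
  by rewrite -ncevM; apply: (degen_fst_eq dC); rewrite ncevM.
have [v v0 ve] := idem _ _ _ _ _ dA eA trs.
have [v' v'0 v'e] := idem _ _ _ _ _ dB eB trs'.
have [a va|P [Q [PQ PsQ]]] := Schur_iso ss ss' v0 v'0.
  apply: contrapT => /eqP v'a.
  have [c v'c] := simplefam_cyclic v' ss' v'a.
  (* This fixes [v'], kills [v], and has [e] as its first and last factor. *)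
  pose x := ncmul e (ncmul a (ncmul c e)).
  (* A common annihilator of [x] in three families, so that one formal [r] gives the idempotent in
     all of them. *)
  pose h := char_poly (ncev A x) * char_poly (ncev B x) * char_poly (ncev s' x).
  have h0 : h != 0 by rewrite !mulf_neq0// monic_neq0// char_poly_monic.
  have [r fit] := nc_fitting x h0; pose f := ncmul x r.
  have [fA xrA _] : _ := fit _ A (nc_Cayley_Hamilton (dvdp_mulr _ (dvdp_mulr _ (dvdpp _)))).
  have [fB xrB _] : _ := fit _ B (nc_Cayley_Hamilton (dvdp_mulr _ (dvdp_mull _ (dvdpp _)))).
  have [_ _ /(_ v')fs'] : _ := fit _ s' (nc_Cayley_Hamilton (dvdp_mull _ (dvdpp _))).
  have v'f : v' *m ncev s' f = v'.
    by apply: fs'; rewrite /x !ncevM !mulmxA v'e -v'c.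
  have fB0 : ncev B f != 0.
    apply: contraNneq v'0 => fB0; rewrite -v'f (_ : ncev s' f = 0) ?mulmx0//.
    by have := @degen_fst_eq _ _ _ _ _ _ f [::] dB; rewrite fB0 /ncev !big_nil => ->.
  have fA0 : ncev A f != 0 by rewrite trA0.
  have fe : ncev A f = ncev A e.
    apply: (@idem_sub_eq _ _ _ (ncev A (ncmul (ncmul a (ncmul c e)) r)) (ncev A (ncmul r (ncmul e (ncmul a c))))) => //.
    - by rewrite -ncevM /f /x !ncevM !mulmxA.
    - by rewrite /f ncevM xrA /x !ncevM !mulmxA.
    - exact: mine.
  move/eqP: v0; apply; rewrite -ve -(degen_fst_eq dA fe).
  by rewrite /f /x !ncevM !mulmxA ve va !mul0mx.
have dB' : degen B (blockdiag s t').
  apply: degen_step dB _.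
  have [QP' PQ'] := PQ.
  pose S : 'M[R]_(m1 + r2, m2 + r2) := block_mx Q 0 0 1%:M.
  pose S' : 'M[R]_(m2 + r2, m1 + r2) := block_mx P 0 0 1%:M.
  apply: (@degen1_conj _ _ _ _ _ _ S S') => [|i].
    by split; rewrite /S /S' mulmx_block !(mulmx0, mul0mx, addr0, add0r) mulmx1
      ?PQ' ?QP' -scalar_mx_block.
  rewrite /S /S' /blockdiag !mulmx_block !(mulmx0, mul0mx, addr0, add0r) mulmx1 mul1mx.
  by rewrite -PsQ !mulmxA PQ' mul1mx -mulmxA PQ' mulmx1.
have tt' : sametrace t t'.
  move=> w; have := degen_sametrace dA w; have := degen_sametrace dB' w.
  rewrite !wordmx_diag !mxtrace_block => h1 h2; have := AB w; rewrite h1 h2.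
  exact: addrI.
have [|k [D [tD t'D]]] := IH _ _ t t' _ tt'.
  rewrite -(ltn_add2l m1) -(sametrace_dim (degen_sametrace dA)).
  by apply: leq_trans nN _; rewrite -add1n leq_add2r; exact: ss.1.
exists (m1 + k)%N, (blockdiag s D).
by split; [apply: degen_trans dA _|apply: degen_trans dB' _]; exact: degen_blockdiag.
Qed.
End SameTrace.

(** * Convex cones in good position *)

Section Ultralimits.
Variable R : realType.

Lemma ultra_fmap (S T : Type) (f : S -> T) (U : set_system S) :
  UltraFilter U -> UltraFilter (f @ U).
Proof.
move=> UU; split=> [|G GF UG]; first exact: fmap_proper_filter.
rewrite predeqE => A; split; last exact: UG.
move=> GA; have [//|nA] := in_ultra_setVsetC (f @^-1` A) UU.
have GnA : G (~` A) by apply: UG.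
by have /filter_ex[? []] : G (A `&` ~` A) by exact: filterI.
Qed.

Lemma ultra_not (T : Type) (U : set_system T) (P : T -> Prop) : UltraFilter U ->
  ~ (\forall t \near U, P t) -> \forall t \near U, ~ P t.
Proof. by move=> UU nP; have [] := in_ultra_setVsetC [set t | P t] UU. Qed.

Lemma ultra_cvg (T : Type) (U : set_system T) (f : T -> R) (B : R) : UltraFilter U ->
  (\forall t \near U, `|f t| <= B) -> exists l : R, f @ U --> l.
Proof.
move=> UU fB; have UfU := ultra_fmap f UU.
have := segment_compact (a := - B) (b := B); rewrite compact_ultra.
move=> /(_ _ UfU)[|l [_ fl]]; last by exists l.
by apply: filterS fB => t; rewrite /= in_itv /= ler_norml.
Qed.

Lemma ultra_mcvg (T : Type) (U : set_system T) m n (X : T -> 'M[R]_(m, n)) (B : R) :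
  UltraFilter U -> (\forall t \near U, nrm (X t) <= B) -> exists L, mcvg U X L.
Proof.
move=> UU XB.
have h i j : exists l : R, X ^~ i ^~ j @ U --> l.
  apply: (@ultra_cvg _ _ _ B) => //; apply: filterS XB => t.
  by apply: le_trans; exact: entry_le_nrm.
exists (\matrix_(i, j) projT1 (cid (h i j))) => i j.
by rewrite mxE; case: cid.
Qed.

(* The superlevel sets of f generate a filter, any ultrafilter above which
   converges to a maximiser. *)
Lemma ultra_max m n (E : set 'M[R]_(m, n)) (f : 'M[R]_(m, n) -> R) (B : R) :
  E !=set0 -> (forall X, E X -> nrm X <= B) ->
  (forall U L, UltraFilter U -> U E -> mcvg U id L -> E L /\ f @ U --> f L) ->
  exists2 L, E L & forall X, E X -> f X <= f L.
Proof.
move=> [X0 EX0] EB Elim.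
pose sup Y := [set X | E X /\ f Y <= f X].
have FP : ProperFilter (filter_from E sup).
  apply: filter_from_proper; last by move=> X EX; exists X; split.
  apply: filter_from_filter; first by exists X0.
  move=> X Y EX EY; have [fXY|/ltW fYX] := leP (f X) (f Y).
    by exists Y => // Z [EZ fYZ]; split; split=> //; exact: le_trans fYZ.
  by exists X => // Z [EZ fXZ]; split; split=> //; exact: le_trans fXZ.
have [U [UU FU]] := ultraFilterLemma FP.
have UE : U E by apply: FU; exists X0 => // X [].
have [L UL] : exists L, mcvg U id L.
  by apply: (@ultra_mcvg _ _ _ _ _ B) => //; apply: filterS UE => X; exact: EB.
have [EL fL] := Elim _ _ UU UE UL; exists L => // X EX.
have UX : \forall Y \near U, f X <= f Y by apply: FU; exists X => // Y [].
have PU : ProperFilter U by exact: ultra_proper.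
by apply: (cvgr_to_ge fL); exact: UX.
Qed.

End Ultralimits.

Section Cones.
Variable R : realType.

(** A proper cone in the sense of convex geometry: closed, convex, pointed and with nonempty
    interior. *)
Definition pcone n (C : set 'cV[R]_n) :=
  [/\ forall x, (forall e, 0 < e -> exists2 y, C y & nrm (x - y) < e) -> C x,
      forall x y, C x -> C y -> C (x + y),
      forall a x, 0 <= a -> C x -> C (a *: x),
      forall x, C x -> C (- x) -> x = 0 &
      exists v, exists2 e, 0 < e & forall w, nrm (w - v) < e -> C w].

Lemma pcone_lim n (C : set 'cV[R]_n) (T : Type) (U : set_system T) (X : T -> 'cV[R]_n) L :
  ProperFilter U -> pcone C -> mcvg U X L -> (\forall t \near U, C (X t)) -> C L.
Proof.
move=> PU [clC _ _ _ _] XL CX; apply: clC => e e0.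
have /filter_ex[t [Ct te]] : \forall t \near U, C (X t) /\ nrm (X t - L) < e.
  by apply: filterI => //; exact: (mcvgP _ _).1.
by exists (X t) => //; rewrite nrmBC.
Qed.

Lemma pcone0 n (C : set 'cV[R]_n) : pcone C -> C 0.
Proof. by move=> [_ _ Z _ [v [e e0 /(_ v)]]]; rewrite subrr nrm0 => /(_ e0)/(Z 0); rewrite scale0r; apply. Qed.

Lemma pcone_sum n (C : set 'cV[R]_n) (J : Type) (r : seq J) (P : pred J) (x : J -> 'cV[R]_n) :
  pcone C -> (forall j, P j -> C (x j)) -> C (\sum_(j <- r | P j) x j).
Proof.
move=> pC Cx; elim/big_rec: _ => [|j y Pj Cy]; first exact: pcone0.
by case: pC => _ D _ _ _; apply: D => //; exact: Cx.
Qed.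

(** Otherwise unit vectors [x] of the cone and vectors [y] with [x + y] tending to zero would
    produce in the limit a nonzero vector of [C] whose opposite is also in [C]. This bounds the
    columns of a matrix in terms of their sum. *)
Lemma pcone_bound n (C : set 'cV[R]_n) : pcone C ->
  exists K, forall x y, C x -> C y -> nrm x <= K * nrm (x + y).
Proof.
move=> pC; have [_ _ CZ ptC _] := pC; apply: contrapT => /forallNP h.
have h' k : exists xy : 'cV[R]_n * 'cV[R]_n, [/\ C xy.1, C xy.2, nrm xy.1 = 1 & nrm (xy.1 + xy.2) < k.+1%:R^-1].
  have /existsNP[x /existsNP[y]] := h k.+1%:R.
  move=> /not_implyP[Cx] /not_implyP[Cy] /negP; rewrite -ltNge => xy.
  have x0 : 0 < nrm x by apply: le_lt_trans xy; rewrite mulr_ge0// nrm_ge0.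
  exists ((nrm x)^-1 *: x, (nrm x)^-1 *: y); split=> /=.
  - by apply: CZ => //; rewrite invr_ge0 ltW.
  - by apply: CZ => //; rewrite invr_ge0 ltW.
  - by rewrite nrmZ gtr0_norm ?invr_gt0// mulVf ?gt_eqF.
  - rewrite -scalerDr nrmZ gtr0_norm ?invr_gt0// ltr_pdivrMl// mulrC ltr_pdivlMl//.
have [xy xyP] := choice h'.
have [U [UU ooU]] := ultraFilterLemma (eventually_filter).
have [x ux] : exists x, mcvg U (fun k => (xy k).1) x.
  apply: (@ultra_mcvg _ _ _ _ _ _ 1) => //; apply: nearW => k.
  by have [_ _ ->] := xyP k.
have uxy : mcvg U (fun k => (xy k).1 + (xy k).2) 0.
  apply/mcvgP => e e0; apply: ooU.
  have /cvgrPdist_lt/(_ _ e0) := @cvg_harmonic R; apply: filterS => k.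
  rewrite sub0r normrN ger0_norm ?invr_ge0// subr0 => ke.
  by have [_ _ _ /lt_trans] := xyP k; apply.
have uy : mcvg U (fun k => (xy k).2) (- x).
  rewrite -[- x]add0r; apply: mcvg_near (mcvgB uxy ux).
  by apply: nearW => k; rewrite addrC addKr.
have PU : ProperFilter U by exact: ultra_proper.
have Cx : C x by apply: pcone_lim ux _ => //; apply: nearW => k; have [] := xyP k.
have Cy : C (- x) by apply: pcone_lim uy _ => //; apply: nearW => k; have [] := xyP k.
have UF : Filter U by exact: filter_filter.
have := @cvg_nrm _ _ U UF _ _ _ _ ux; rewrite (ptC _ Cx Cy) nrm0.
rewrite (_ : (fun t => _) = fun=> 1); last by apply/funext => k; have [_ _ ->] := xyP k.
move=> h1; have /eqP : (1 : R) = 0 by exact: (cvg_unique (@Rhausdorff R) (cvg_cst (1 : R)) h1).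
by rewrite oner_eq0.
Qed.

(** Both sides equal 1 at [t = 0], so this compares their slopes there. Derivatives are replaced by
    the Bernoulli-type bound [bern], which turns the [N]-th power into a linear factor on the other
    side. *)
Lemma limit_slope (N : nat) (a b k : R) :
  (forall t, 0 < t <= 1 -> (1 + t * k) ^+ 2 <= (1 + 2 * t * a + t ^+ 2 * b) ^+ N) ->
  k <= N%:R * a.
Proof.
move=> h; rewrite leNgt; apply/negP => kNa.
have bern (z : R) : 0 <= 1 + z -> (1 + z) ^+ N * (1 - N%:R * z) <= 1.
  move=> z1; elim: (N) => [|M IH]; first by rewrite expr0 mul0r subr0 mulr1.
  apply: le_trans IH; rewrite exprS mulrAC mulrC; apply: ler_wpM2l; first exact: exprn_ge0.
  rewrite mulrSr; have := sqr_ge0 z; have := ler0n R M; nra.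
pose A := 2 * `|a| + `|b|; pose n : R := N%:R.
have A0 : 0 <= A by rewrite addr_ge0// mulr_ge0.
have n0 : 0 <= n by exact: ler0n.
pose M := n * `|b| + 2 * `|k| * n * A.
have M0 : 0 <= M by rewrite addr_ge0// !mulr_ge0.
pose d := k - n * a; have d0 : 0 < d by rewrite subr_gt0.
(* The first bound gives [t <= 1] and keeps [1 + z] and [1 - n * z] nonnegative; the second keeps
   the second order terms, collected in [M], below the assumed gap [d]. *)
pose t := Num.min (1 / (1 + A + n * A)) (d / (1 + M)).
have nA0 : 0 <= n * A by exact: mulr_ge0.
have t0 : 0 < t by rewrite lt_min !divr_gt0//; lra.
have tA : t * (1 + A + n * A) <= 1.
  by rewrite -ler_pdivlMr; [rewrite ge_min lexx|lra].
have tM : t * (1 + M) <= d by rewrite -ler_pdivlMr; [rewrite ge_min lexx orbT|lra].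
have tA0 : 0 <= t * A by rewrite mulr_ge0// ltW.
have tnA0 : 0 <= t * (n * A) by rewrite mulr_ge0// ltW.
have t1 : t <= 1 by lra.
pose z := 2 * t * a + t ^+ 2 * b.
have zA : `|z| <= t * A.
  rewrite /z /A; apply: le_trans (ler_normD _ _) _; rewrite !normrM (gtr0_norm t0).
  rewrite ger0_norm// mulrDr; apply: lerD; first lra.
  by rewrite -mulrA ler_pM2l// ler_piMl.
have /ler_normlP[zA1 zA2] := zA.
have z1 : 0 <= 1 + z by lra.
have nz1 : 0 <= 1 - n * z.
  have : n * z <= n * (t * A) by rewrite ler_wpM2l//; lra.
  rewrite [n * (t * A)]mulrCA; lra.
have := h t; rewrite t0 t1 -addrA -/z => /(_ isT) hz.
have : (1 + t * k) ^+ 2 * (1 - n * z) <= 1.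
  by apply: le_trans (bern z z1); apply: ler_wpM2r.
have sq : 1 + 2 * t * k <= (1 + t * k) ^+ 2 by have := sqr_ge0 (t * k); nra.
have := ler_wpM2r nz1 sq => h1 h2; have {h1 h2} h3 := le_trans h1 h2.
have kz : t * k * (n * z) <= t * (`|k| * n * (t * A)).
  rewrite -!mulrA; apply: ler_wpM2l; first exact: ltW.
  apply: le_trans (ler_norm _) _; rewrite !normrM (ger0_norm n0).
  by rewrite ler_wpM2l// ler_wpM2l.
have nb : n * (t ^+ 2 * b) <= t * (n * (t * `|b|)).
  rewrite expr2 [leRHS]mulrCA -[t * t * b]mulrA !(mulrCA n); apply: ler_wpM2l; first exact: ltW.
  by apply: ler_wpM2l; [exact: ltW|apply: ler_wpM2l => //; exact: ler_norm].
have : t * (2 * d) <= t * (t * M).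
  rewrite /M /d; move: kz nb h3; rewrite /z; lra.
rewrite ler_pM2l//; have : 0 <= t * M by rewrite mulr_ge0// ltW. lra.
Qed.

End Cones.

Section Position.
Variables (R : realType) (n : nat).
Local Notation N := n.+1.
Implicit Types (C : set 'cV[R]_N) (X Y A : 'M[R]_N) (x y v : 'cV[R]_N).

Definition one_cv : 'cV[R]_N := const_mx 1.
Definition dotv x y : R := \sum_i x i 0 * y i 0.
Definition entrysum x : R := \sum_i x i 0.

Lemma dotvDr x y z : dotv x (y + z) = dotv x y + dotv x z.
Proof. by rewrite -big_split; apply: eq_bigr => i _; rewrite mxE mulrDr. Qed.

Lemma dotvZr x a y : dotv x (a *: y) = a * dotv x y.
Proof. by rewrite mulr_sumr; apply: eq_bigr => i _; rewrite mxE mulrCA. Qed.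

Lemma dotvC x y : dotv x y = dotv y x.
Proof. by apply: eq_bigr => i _; rewrite mulrC. Qed.

Lemma dotv_ge0 x : 0 <= dotv x x.
Proof. by apply: sumr_ge0 => i _; rewrite -expr2 sqr_ge0. Qed.

Lemma dotv_eq0 x : dotv x x = 0 -> x = 0.
Proof.
move=> x0; apply/colP => i; rewrite mxE; apply/eqP; rewrite -sqrf_eq0 expr2 -/(_ == _).
by move: x0 => /eqP; rewrite psumr_eq0 => [/allP/(_ i (mem_index_enum i))|j _] //; rewrite -expr2 sqr_ge0.
Qed.

Lemma dotv_entry x i : dotv x x <= 1 -> `|x i 0| <= 1.
Proof.
move=> x1; rewrite -(ler_pXn2r (n := 2))// ?nnegrE// expr1n real_normK ?num_real//.
apply: le_trans x1; rewrite /dotv (bigD1 i)//= -expr2 lerDl.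
by apply: sumr_ge0 => j _; rewrite -expr2 sqr_ge0.
Qed.

Lemma sum_cols X : X *m one_cv = \sum_j col j X.
Proof.
apply/colP => i; rewrite mxE summxE; apply: eq_bigr => j _.
by rewrite !mxE mulr1.
Qed.

Lemma mulmx_cols X x : X *m x = \sum_j x j 0 *: col j X.
Proof.
apply/colP => i; rewrite mxE summxE; apply: eq_bigr => j _.
by rewrite !mxE mulrC.
Qed.

(** After factoring out [X], the remaining matrix differs from the identity only in column [j], so
    its cofactors along that column are those of the identity. *)
Lemma det_rank1_update X x j : \det (X + X *m x *m delta_mx 0 j) = \det X * (1 + x j 0).
Proof.
rewrite -mulmxA -[X in X + _]mulmx1 -mulmxDr det_mulmx; congr (_ * _).
set M := 1%:M + _.
have cM i : cofactor M i j = cofactor (1%:M : 'M[R]_N) i j.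
  congr (_ * \det _); apply/matrixP => k l; rewrite !mxE big_ord1 !mxE eqxx /=.
  by rewrite [lift j l == j]eq_sym (negbTE (neq_lift j l)) mulr0 addr0.
rewrite (expand_det_col _ j); under eq_bigr do rewrite cM mulrC.
have := mul_adj_mx (1%:M : 'M[R]_N); rewrite mulmx1 det1 => adj1.
transitivity ((\adj 1%:M *m M) j j).
  by rewrite mxE; apply: eq_bigr => i _; rewrite [in RHS]mxE.
by rewrite adj1 mul1mx !mxE eqxx big_ord1 !mxE !eqxx mulr1.
Qed.

(* [X + t *: 1] with all columns of [X] equal to an interior point [v] is
   singular for at most one [t]. *)
Lemma pcone_basis C : pcone C -> exists X, \det X != 0 /\ forall j, C (col j X).
Proof.
move=> [_ _ _ _ [v [e e0 ve]]].
pose X (t : R) : 'M[R]_N := t%:M + v *m const_mx 1.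
have CX t : 0 < t -> t < e -> forall j, C (col j (X t)).
  move=> t0 te j; apply: ve; rewrite (_ : _ - v = t *: delta_mx j 0).
    rewrite nrmZ gtr0_norm// (_ : nrm _ = 1) ?mulr1//.
    rewrite /nrm (bigD1 j)//= big_ord1 mxE !eqxx normr1 big1 ?addr0// => i ij.
    by rewrite big_ord1 mxE (negbTE ij) normr0.
  apply/colP => i; rewrite !mxE big_ord1 !mxE mulr1 addrK eqxx andbT.
  by rewrite -[LHS]mulr_natr.
have dX t : 0 < t -> \det (X t) = 0 -> t = - entrysum v.
  move=> t0 /eqP/det0P[w w0]; rewrite /X mulmxDr mul_mx_scalar mulmxA.
  move=> /eqP; rewrite addr_eq0 => /eqP wE.
  pose a := (w *m v) 0 0.
  have wj j : t * w 0 j = - a.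
    by have := congr1 (fun M : 'rV_N => M 0 j) wE; rewrite mxE [RHS]mxE [X in - X]mxE big_ord1 [const_mx _ _ _]mxE mulr1.
  have a0 : a != 0.
    apply: contraNneq w0 => a0; apply/eqP/rowP => j; rewrite mxE.
    by have := wj j; rewrite a0 oppr0 => /eqP; rewrite mulf_eq0 gt_eqF//= => /eqP.
  have : t * a = - a * entrysum v.
    rewrite /a mxE [in LHS]mulr_sumr mulr_sumr; apply: eq_bigr => j _.
    by rewrite mulrA wj /a mxE.
  by rewrite mulNr mulrC -mulrN => /(mulfI a0).
have [d0|d0] := eqVneq (\det (X (e / 2))) 0; last first.
  by exists (X (e / 2)); split=> //; apply: CX; lra.
exists (X (e / 3)); split; last by apply: CX; lra.
apply/eqP => d1; have := dX _ _ d0; have := dX _ _ d1; lra.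
Qed.

(* Maximise [det X] over matrices [X] with columns in
   [C] whose sum lies in the Euclidean unit ball. At a maximum with column sum
   [s], moving column [j] towards [y] shows that the [j]-th coordinate of [y] in
   the basis [X] is at most [N * <s, y>], while scaling the columns gives
   [<s, col j X> = 1 / N]. *)
Lemma pcone_position C : pcone C -> exists X,
  [/\ \det X != 0, forall j, C (col j X),
    forall c, C (X *m c) -> 0 <= entrysum c /\ forall j, c j 0 <= entrysum c &
    forall A, entrysum (invmx X *m (A *m (X *m one_cv))) <= N%:R * nrm A].
Proof.
move=> pC; have [_ CD CZ ptC _] := pC.
have [K KP] := pcone_bound pC.
pose E := [set X | (forall j, C (col j X)) /\ dotv (X *m one_cv) (X *m one_cv) <= 1].
have EB X : E X -> nrm X <= \sum_(j < N) (Num.max 0 K * N%:R).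
  move=> [CX sX]; rewrite /nrm exchange_big; apply: ler_sum => j _ /=.
  have -> : \sum_i `|X i j| = nrm (col j X).
    by apply: eq_bigr => i _; rewrite big_ord1 mxE.
  have Crest : C (\sum_(k | k != j) col k X) by exact: pcone_sum.
  have sumE : col j X + \sum_(k | k != j) col k X = X *m one_cv.
    by rewrite sum_cols [RHS](bigD1 j).
  have := KP _ _ (CX j) Crest; rewrite sumE => /le_trans; apply.
  have sN : nrm (X *m one_cv) <= N%:R.
    rewrite /nrm -[X in _ <= X%:R]card_ord -sumr_const; apply: ler_sum => i _.
    by rewrite big_ord1 dotv_entry.
  apply: (@le_trans _ _ (Num.max 0 K * nrm (X *m one_cv))).
    by apply: ler_wpM2r; [exact: nrm_ge0|rewrite le_max lexx orbT].
  by apply: ler_wpM2l; rewrite // le_max lexx.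
have cvg_col (T : Type) (U : set_system T) (F : Filter U) (Y : T -> 'M[R]_N) L j :
    mcvg U Y L -> mcvg U (fun t => col j (Y t)) (col j L).
  by move=> YL i k; rewrite mxE; under eq_cvg do rewrite mxE; exact: YL.
have Escale Y r : (forall j, C (col j Y)) -> 0 < r ->
    dotv (Y *m one_cv) (Y *m one_cv) <= r ^+ 2 -> E (r^-1 *: Y).
  move=> CY r0 Yr; split=> [j|].
    have -> : col j (r^-1 *: Y) = r^-1 *: col j Y by apply/colP => i; rewrite !mxE.
    by apply: CZ => //; rewrite invr_ge0 ltW.
  rewrite -scalemxAl dotvZr dotvC dotvZr mulrA -expr2 exprVn mulrC.
  by rewrite ler_pdivrMr ?mul1r// exprn_gt0.
have [X0 [dX0 CX0]] := pcone_basis pC.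
have E0 : E !=set0.
  pose r := 1 + dotv (X0 *m one_cv) (X0 *m one_cv).
  exists (r^-1 *: X0); apply: Escale => //.
    by have := dotv_ge0 (X0 *m one_cv); rewrite /r; lra.
  by have := dotv_ge0 (X0 *m one_cv); rewrite /r; nra.
(* The square makes the objective independent of the order of the columns. *)
have [|X [CX sX] maxX] := @ultra_max _ _ _ E (fun X => \det X ^+ 2) _ E0 EB.
  move=> U L UU UE UL; have PU : ProperFilter U by exact: ultra_proper.
  have detL := mcvg_det UL; split; last by rewrite expr2; under eq_cvg do rewrite expr2; apply: cvgM; exact: detL.
  split=> [j|].
    apply: pcone_lim (cvg_col _ _ _ _ _ j UL) _ => //.
    by apply: filterS UE => Y [].
  have sL : mcvg U (fun Y : 'M[R]_N => Y *m one_cv) (L *m one_cv).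
    by apply: mcvgM => //; exact: mcvg_cst.
  have dL : (fun Y : 'M[R]_N => dotv (Y *m one_cv) (Y *m one_cv)) @ U --> dotv (L *m one_cv) (L *m one_cv).
    by apply: cvg_bigsum => i _; apply: cvgM; exact: sL.
  by apply: (cvgr_to_le dL); apply: filterS UE => Y [].
(* Maximality in homogeneous form: both sides have degree [2 * N] in [Y], so the constraint on the
   column sum disappears and perturbed columns need no renormalisation. *)
have maxY Y : (forall j, C (col j Y)) ->
    \det Y ^+ 2 <= \det X ^+ 2 * dotv (Y *m one_cv) (Y *m one_cv) ^+ N.
  move=> CY; set q := dotv _ _; have q0 : 0 <= q by exact: dotv_ge0.
  have [q00|qn0] := eqVneq q 0.
    have dY : \det Y = 0.
      apply/eqP; apply: contraT => dY; have := dotv_eq0 q00.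
      move=> /(congr1 (mulmx (invmx Y))); rewrite mulKmx ?unitmxE ?unitfE// mulmx0.
      by move=> /colP/(_ 0)/eqP; rewrite !mxE oner_eq0.
    by rewrite dY expr0n /= mulr_ge0 ?sqr_ge0 ?exprn_ge0.
  have qgt0 : 0 < q by rewrite lt_def qn0.
  have sq : Num.sqrt q ^+ 2 = q by rewrite sqr_sqrtr.
  have := maxX _ (@Escale Y (Num.sqrt q) CY _ _); rewrite sqrtr_gt0 sq => /(_ qgt0 (lexx _)).
  rewrite detZ exprMn exprVn -exprVn -exprM mulnC exprM exprVn sq exprVn.
  by rewrite mulrC ler_pdivrMr ?exprn_gt0.
have dX : \det X != 0.
  apply: contraNneq dX0 => dX; have := maxY X0 CX0.
  by rewrite dX expr0n /= mul0r => h; rewrite -sqrf_eq0 eq_le h sqr_ge0.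
have uX : X \in unitmx by rewrite unitmxE unitfE.
set s := X *m one_cv in sX *.
have s1 : dotv s s = 1.
  apply/eqP; rewrite eq_le sX leNgt; apply/negP => slt.
  have := maxY X CX; rewrite -/s -[leLHS]mulr1 ler_pM2l ?exprn_even_gt0//.
  by apply/negP; rewrite -ltNge exprn_ilt1// dotv_ge0.
have key j c : C (X *m c) -> c j 0 - 1 <= N%:R * (dotv s (X *m c) - dotv s (col j X)).
  move=> Cc; set y := X *m c.
  rewrite -[dotv s y - _](_ : dotv s (y - col j X) = _); last first.
    by rewrite dotvDr -scaleN1r dotvZr mulN1r.
  apply: (@limit_slope _ _ _ (dotv (y - col j X) (y - col j X))) => t /andP[t0 t1].
  pose Y := X + X *m (t *: (c - delta_mx j 0)) *m delta_mx 0 j.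
  have yE : X *m (t *: (c - delta_mx j 0)) = t *: (y - col j X).
    by rewrite -scalemxAr mulmxBr -colE.
  have CY k : C (col k Y).
    rewrite /Y yE; have -> : col k (X + t *: (y - col j X) *m delta_mx 0 j) =
        if k == j then (1 - t) *: col j X + t *: y else col k X.
      apply/colP => i; case: eqVneq => [->|kj]; rewrite !mxE big_ord1 !mxE eqxx /=.
        by rewrite ?eqxx /= ?mulr1; ring.
      by rewrite (negbTE kj) mulr0 addr0.
    case: eqP => _ //; apply: CD; apply: CZ => //; first lra.
    exact: ltW.
  have := maxY Y CY; rewrite det_rank1_update exprMn.
  rewrite ler_pM2l ?exprn_even_gt0//.
  rewrite (_ : (t *: (c - delta_mx j 0) : 'cV[R]_N) j 0 = t * (c j 0 - 1)); last first.
    by rewrite !mxE !eqxx.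
  move=> /le_trans; apply; rewrite le_eqVlt; apply/orP; left; apply/eqP; congr (_ ^+ _).
  have -> : Y *m one_cv = s + t *: (y - col j X).
    rewrite /Y yE mulmxDl -/s -mulmxA; congr (_ + _).
    rewrite -[RHS]mulmx1; congr (_ *m _); apply/matrixP => a b; rewrite !ord1 !mxE (bigD1 j)//=.
    by rewrite !mxE !eqxx mulr1 big1 ?addr0// => k kj; rewrite !mxE (negbTE kj) mul0r.
  move: (y - col j X) => z.
  rewrite dotvDr !(dotvC (s + _)) !dotvDr !dotvZr !(dotvC (_ *: _)) !dotvZr s1.
  by ring.
have colE' j : X *m delta_mx j 0 = col j X by rewrite -colE.
have phix j : N%:R * dotv s (col j X) = 1.
  apply/eqP; rewrite eq_le; apply/andP; split.
    have := key j 0; rewrite mulmx0 => /(_ (pcone0 pC)).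
    by rewrite mxE -(scale0r s) dotvZr; lra.
  have := key j (2 *: delta_mx j 0); rewrite -scalemxAr colE' => /(_ (CZ _ _ _ (CX j))).
  by rewrite dotvZr !mxE !eqxx /= mulr1 => /(_ (ler0n _ _)); lra.
have phi c : N%:R * dotv s (X *m c) = entrysum c.
  rewrite mulmx_cols /dotv; under eq_bigr do rewrite summxE mulr_sumr.
  rewrite exchange_big mulr_sumr /=; apply: eq_bigr => j _.
  transitivity (c j 0 * (N%:R * dotv s (col j X))); last by rewrite phix mulr1.
  rewrite [RHS]mulrCA; congr (N%:R * _); rewrite /dotv mulr_sumr.
  by apply: eq_bigr => i _; rewrite !mxE mulrCA.
have cle c : C (X *m c) -> forall j, c j 0 <= entrysum c.
  move=> Cc j; have := key j c Cc; rewrite mulrBr phi phix; lra.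
exists X; split=> // [c Cc|A].
  split; last exact: cle.
  (* A negative coordinate sum makes every coordinate negative by [cle], so [- (X *m c)] is a
     nonnegative combination of columns; pointedness then gives [c = 0]. *)
  rewrite leNgt; apply/negP => c0.
  have Cn : C (- (X *m c)).
    rewrite mulmx_cols -sumrN; apply: pcone_sum => // j _; rewrite -scaleNr.
    by apply: CZ => //; have := cle c Cc j; lra.
  have := ptC _ Cc Cn => /(congr1 (mulmx (invmx X))); rewrite mulKmx// mulmx0 => cz.
  by move: c0; rewrite /entrysum cz big1 ?ltxx// => i _; rewrite mxE.
rewrite -phi mulKVmx// ler_pM2l ?ltr0n// /dotv /nrm.
apply: ler_sum => i _; rewrite [(A *m s) i 0]mxE mulr_sumr; apply: ler_sum => j _.
apply: le_trans (ler_norm _) _; rewrite !normrM mulrCA -[leRHS]mulr1; apply: ler_wpM2l => //.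
by apply: mulr_ile1 => //; exact: dotv_entry.
Qed.

End Position.

(** * Uniform discreteness *)

Section GroupFacts.
Variable G : groupType.
Local Open Scope group_scope.

Lemma generated_ind (s : seq G) (P : G -> Prop) :
  smallest (@is_subgroup G) [set` s] = setT ->
  P 1 -> (forall x y, P x -> P y -> P (x * y)) -> (forall x, P x -> P x^-1) ->
  (forall x, x \in s -> P x) -> forall g, P g.
Proof.
move=> gens P1 PM PV Ps g.
have : [set: G] g by [].
rewrite -gens => /(_ [set x | P x]); apply; split.
  split; first by rewrite in_setE.
  by move=> x y; rewrite !in_setE => Px Py; apply/PM/PV.
by move=> x; exact: Ps.
Qed.

(** [H] is the centre of the centraliser of the conjugacy class of [z]. It contains [z], is abelian
    and normal, and has a first-order description, unlike the subgroup generated by the class. *)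
Lemma no_commuting_class (z : G) : no_normal_abelian_subgroup G ->
  (forall g h, commute (z ^ g) (z ^ h)) -> z = 1.
Proof.
move=> hG cz; pose cent y := forall g, commute y (z ^ g).
pose H := [set h | cent h /\ forall y, cent y -> commute h y].
have centM x y : cent x -> cent y -> cent (x * y).
  by move=> cx cy g; apply/commute_sym/commuteM; apply/commute_sym.
have centV x : cent x -> cent x^-1 by move=> cx g; apply/commute_sym/commuteV/commute_sym.
have centJ x g : cent x -> cent (x ^ g).
  move=> cx h; have : (x * z ^ (h * g^-1)) ^ g = (z ^ (h * g^-1) * x) ^ g by rewrite cx.
  by rewrite (conjMg x) (conjMg _ x) -conjgM mulgVK.
have Hz : H z by split=> [g|y /(_ 1)]; [rewrite -{1}[z]conjg1|rewrite conjg1 => /commute_sym].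
suff HE : H = [set 1] by move: Hz; rewrite HE.
apply: hG.
- split; first by rewrite in_setE; split=> [g|y _]; exact/commute_sym/commute1.
  move=> x y; rewrite !in_setE => -[cx dx] [cy dy].
  split=> [|w cw]; first exact/centM/centV.
  apply/commute_sym/commuteM; first exact/commute_sym/dx.
  by apply/commuteV/commute_sym/dy.
- move=> g h [ch dh]; split=> [|y cy]; first exact: centJ.
  have : (h * y ^ g^-1) ^ g = (y ^ g^-1 * h) ^ g by rewrite (dh _ (centJ y g^-1 cy)).
  by rewrite (conjMg h) (conjMg _ h) -conjgM mulVg conjg1.
- by move=> x y [cx dx] [cy dy]; exact: dx.
Qed.
End GroupFacts.

Section ShortConjugates.
Variables (R : realType) (N : nat) (G : groupType).
Implicit Types (A : G -> 'M[R]_N) (u : seq G).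

Definition hommx A := A 1%g = 1%:M /\ forall g h, A (g * h)%g = A g *m A h.

Definition faithfulmx A := forall g, A g = 1%:M -> g = 1%g.

Definition wprod u : G := foldr (fun x y => (x * y)%g) 1%g u.

Lemma wprod_cat u v : wprod (u ++ v) = (wprod u * wprod v)%g.
Proof. by elim: u => [|x u IH] /=; rewrite ?mul1g// IH mulgA. Qed.

Lemma wprod_inv u : wprod (rev [seq x^-1%g | x <- u]) = (wprod u)^-1%g.
Proof.
elim: u => [|x u IH] /=; first by rewrite invg1.
by rewrite rev_cons -cats1 wprod_cat IH /= mulg1 invgM.
Qed.

Variables (s : seq G).
Hypothesis gens : smallest (@is_subgroup G) [set` s] = setT.
Hypothesis hG : no_normal_abelian_subgroup G.
Hypothesis sV : forall x, x \in s -> x^-1%g \in s.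

Lemma generated_words g : exists2 u, all [in s] u & g = wprod u.
Proof.
move: g; apply: (generated_ind gens).
- by exists [::].
- move=> _ _ [u us ->] [v vs ->]; exists (u ++ v); first by rewrite all_cat us.
  by rewrite wprod_cat.
- move=> _ [u us ->]; exists (rev [seq x^-1%g | x <- u]); last by rewrite wprod_inv.
  by rewrite all_rev all_map; apply: sub_all us => x; exact: sV.
- by move=> x xs; exists [:: x]; rewrite /= ?xs ?mulg1.
Qed.

Variable A : G -> 'M[R]_N.
Hypothesis homA : hommx A.
Hypothesis faithA : faithfulmx A.

Let A1 : A 1%g = 1%:M := homA.1.
Let AM g h : A (g * h)%g = A g *m A h := homA.2 g h.

Lemma hommxVr g : A g *m A g^-1%g = 1%:M. Proof. by rewrite -AM mulgV. Qed.
Lemma hommxVl g : A g^-1%g *m A g = 1%:M. Proof. by rewrite -AM mulVg. Qed.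

Lemma faithfulmx_inj g h : A g = A h -> g = h.
Proof.
move=> gh; have /faithA : A (g * h^-1)%g = 1%:M by rewrite AM gh hommxVr.
by move=> /(congr1 (fun x => x * h)%g); rewrite mulgVK mul1g.
Qed.

(* Conjugates of [z] by words of length at most [N * N] already span the space
   of all conjugates, so it suffices that these commute. *)
Lemma short_conjugates_commute (z : G) :
  (forall u v, all [in s] u -> all [in s] v -> (size u <= N * N)%N -> (size v <= N * N)%N ->
     commute (wprod u * z / wprod u)%g (wprod v * z / wprod v)%g) -> z = 1%g.
Proof.
move=> cz; pose c u := A (wprod u * z / wprod u)%g.
pose good k u := all [in s] u && (size u <= k)%N.
pose L k (M : 'rV[R]_(N * N)) := exists2 l : seq (R * seq G),
  all (fun p => good k p.2) l & M = \sum_(p <- l) p.1 *: mxvec (c p.2).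
have lin k : exists U : 'M_(N * N), forall M, L k M <-> (M <= U)%MS.
  apply: linear_pred_mx; first by exists [::]; rewrite ?big_nil.
  move=> a M1 M2 [l1 g1 ->] [l2 g2 ->].
  exists ([seq (a * p.1, p.2) | p <- l1] ++ l2); first by rewrite all_cat all_map g1.
  rewrite big_cat big_map scaler_sumr; congr (_ + _).
  by apply: eq_bigr => p _; rewrite scalerA.
have [U UP] := choice lin.
have UU k : (U k <= U k.+1)%MS.
  apply/row_subP => i; have /UP[l gl E] := row_sub i (U k).
  apply/UP; exists l => //; apply: sub_all gl => p /andP[pl pk].
  by rewrite /good pl leqW.
(* If the chain increased at each of these steps, a rank would exceed the dimension [N * N] of the
   space of matrices. *)
have [k kN Uk] : exists2 k, (k <= N * N)%N & (U k.+1 <= U k)%MS.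
  apply: contrapT => no.
  have rk k : (k <= (N * N).+1)%N -> (k <= \rank (U k))%N.
    elim: k => // k IH kN; apply: leq_ltn_trans (IH (ltnW kN)) _.
    rewrite ltn_neqAle mxrankS// andbT; apply/negP => /eqP rE; apply: no; exists k => //.
    by rewrite -(geq_leqif (mxrank_leqif_sup (UU k))) rE.
  by have := leq_trans (rk _ (leqnn _)) (rank_leq_col _); rewrite ltnn.
have cons_c x u : c (x :: u) = A x *m c u *m A x^-1%g.
  by rewrite /c -!AM /= invgM !mulgA.
have inU u : all [in s] u -> (mxvec (c u) <= U k)%MS.
  elim: u => [_|x u IH /= /andP[xs us]].
    by apply/UP; exists [:: (1, [::])] => //; rewrite big_seq1 scale1r.
  have /UP[l gl E] := IH us; apply: submx_trans Uk.
  apply/UP; exists [seq (p.1, x :: p.2) | p <- l].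
    rewrite all_map; apply: sub_all gl => p /andP[pl pk]; rewrite /= /good /= xs pl.
    exact: pk.
  rewrite cons_c; have -> : c u = \sum_(p <- l) p.1 *: c p.2.
    by apply: (can_inj mxvecK); rewrite E linear_sum; apply: eq_bigr => p _; rewrite linearZ.
  rewrite big_map mulmx_sumr mulmx_suml linear_sum; apply: eq_bigr => p _ /=.
  by rewrite cons_c -scalemxAr -scalemxAl linearZ.
have cE u : all [in s] u -> exists2 l : seq (R * seq G),
    all (fun p => good (N * N)%N p.2) l & c u = \sum_(p <- l) p.1 *: c p.2.
  move=> /inU/UP[l gl E]; exists l.
    by apply: sub_all gl => p /andP[pl pk]; rewrite /good pl; exact: leq_trans pk kN.
  by apply: (can_inj mxvecK); rewrite E linear_sum; apply: eq_bigr => p _; rewrite linearZ.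
have cC u v : all [in s] u -> all [in s] v -> c u *m c v = c v *m c u.
  move=> /cE[l1 g1 ->] /cE[l2 g2 ->].
  rewrite mulmx_suml mulmx_sumr; apply: eq_big_seq => p pl.
  rewrite mulmx_suml mulmx_sumr; apply: eq_big_seq => q ql.
  have /andP[qs qN] := allP g2 _ ql; have /andP[ps pN] := allP g1 _ pl.
  rewrite -!scalemxAl -!scalemxAr !scalerA mulrC; congr (_ *: _).
  by rewrite /c -!AM cz.
apply: no_commuting_class hG _ => g h.
have [u us gu] := generated_words g^-1; have [v vs hv] := generated_words h^-1.
apply: faithfulmx_inj; rewrite !AM.
have := cC u v us vs; rewrite /c -gu -hv !invgK.
by rewrite !AM !mulmxA.
Qed.

End ShortConjugates.

Lemma nrm_inv (R : realType) N (X Y : 'M[R]_N) :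
  X *m Y = 1%:M -> nrm (X - 1%:M) <= 1 / 2 -> nrm Y <= 2 * N%:R.
Proof.
move=> XY X1; have h : nrm Y <= N%:R + 1 / 2 * nrm Y.
  have {1}-> : Y = 1%:M - (X - 1%:M) *m Y by rewrite mulmxBl XY mul1mx opprB addrC subrK.
  apply: le_trans (nrmB _ _) _; rewrite nrm_scalar normr1 mulr1 lerD2l.
  by apply: le_trans (nrmM _ _) _; apply: ler_wpM2r => //; exact: nrm_ge0.
lra.
Qed.

Section UniformDiscreteness.
Variables (R : realType) (N : nat) (G : groupType) (s : seq G).
Hypothesis gens : smallest (@is_subgroup G) [set` s] = setT.
Hypothesis hG : no_normal_abelian_subgroup G.
Hypothesis sV : forall x, x \in s -> x^-1%g \in s.

Definition discretemx (A : G -> 'M[R]_N) (d : R) :=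
  forall g, g != 1%g -> d <= nrm (A g - 1%:M).

Lemma nrm_wprod (A : G -> 'M[R]_N) (b : R) u : hommx A -> 1 <= b ->
  (forall x, x \in s -> nrm (A x) <= b) -> all [in s] u ->
  nrm (A (wprod u)) <= N.+1%:R * b ^+ size u.
Proof.
move=> [A1 AM] b1 Ab; have b0 := le_trans ler01 b1; elim: u => [_|x u IH /= /andP[xs us]].
  by rewrite A1 nrm_scalar normr1 expr0 !mulr1 ler_nat.
rewrite AM exprS mulrCA; apply: le_trans (nrmM _ _) _.
by apply: ler_pM; rewrite ?nrm_ge0 ?Ab ?IH.
Qed.

(** The commutator minus 1 is the bracket of [A x - 1] and [A z - 1] times two inverses. Each
    inverse has norm at most [2 * N.+1], so the total factor is 8 times the bound on [A x - 1] times
    the square of [N.+1]; the constant 16 makes it one half. Using [N.+1] keeps the denominator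
    nonzero for [N = 0]. *)
Lemma nrm_commutator (A : G -> 'M[R]_N) x z : hommx A ->
  nrm (A x - 1%:M) <= 1 / (16 * N.+1%:R ^+ 2) -> nrm (A z - 1%:M) <= 1 / 2 ->
  nrm (A (x * z * x^-1 * z^-1)%g - 1%:M) <= 1 / 2 * nrm (A z - 1%:M).
Proof.
move=> hA; set e := 1 / _ => xe z2; have [A1 AM] := hA.
have M1 : 1 <= N.+1%:R :> R by rewrite ler1n.
have e0 : 0 <= e by rewrite divr_ge0 ?mulr_ge0 ?exprn_ge0.
have eE : 16 * e * N.+1%:R ^+ 2 = 1.
  by rewrite /e mul1r mulrAC mulfV// lt0r_neq0// mulr_gt0// exprn_gt0//; lra.
have e2 : e <= 1 / 2 by nra.
have NM : N%:R <= N.+1%:R :> R by rewrite ler_nat.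
have xi := nrm_inv (hommxVr hA x) (le_trans xe e2).
have zi := nrm_inv (hommxVr hA z) z2.
have -> : A (x * z * x^-1 * z^-1)%g - 1%:M =
    ((A x - 1%:M) *m (A z - 1%:M) - (A z - 1%:M) *m (A x - 1%:M)) *m A x^-1%g *m A z^-1%g.
  have -> : (A x - 1%:M) *m (A z - 1%:M) - (A z - 1%:M) *m (A x - 1%:M) =
      A x *m A z - A z *m A x.
    rewrite !mulmxBl !mulmxBr !mulmx1 !mul1mx.
    by apply/matrixP => i j; rewrite !mxE; ring.
  by rewrite !mulmxBl !AM -(mulmxA (A z)) (hommxVr hA) mulmx1 (hommxVr hA).
have D2 : nrm ((A x - 1%:M) *m (A z - 1%:M) - (A z - 1%:M) *m (A x - 1%:M)) <=
    2 * e * nrm (A z - 1%:M).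
  apply: le_trans (nrmB _ _) _.
  have h1 := nrmM (A x - 1%:M) (A z - 1%:M).
  have h2 := nrmM (A z - 1%:M) (A x - 1%:M).
  have := ler_wpM2r (nrm_ge0 (A z - 1%:M)) xe; lra.
apply: le_trans (nrmM _ _) _.
apply: (@le_trans _ _ (2 * e * nrm (A z - 1%:M) * (2 * N.+1%:R) * (2 * N.+1%:R))).
  apply: ler_pM; rewrite ?nrm_ge0//; last lra.
  apply: le_trans (nrmM _ _) _; apply: ler_pM; rewrite ?nrm_ge0//; lra.
rewrite [leLHS](_ : _ = 16 * e * N.+1%:R ^+ 2 * (1 / 2 * nrm (A z - 1%:M))); last by field.
by rewrite eE mul1r.
Qed.

(** The constant depends on [A] only through [b]. The individual [d'] serves merely to make the
    infimum of the displacements positive, and does not enter [d]. *)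
Lemma uniform_discrete (b : R) : exists2 d, 0 < d & forall A : G -> 'M[R]_N,
  hommx A -> faithfulmx A -> (exists2 d', 0 < d' & discretemx A d') ->
  (forall x, x \in s -> nrm (A x) <= b) -> discretemx A d.
Proof.
pose B := Num.max 1 b; have B1 : 1 <= B by rewrite le_max lexx.
have B0 : 0 <= B by exact: le_trans B1.
pose M : R := N.+1%:R; have M1 : 1 <= M by rewrite ler1n.
(* [W] bounds words of length [K + K]: comparing conjugates by two words of length at most [K]
   involves the quotient of the words. *)
pose K := (N * N)%N; pose W := M * B ^+ (K + K).
have W1 : 1 <= W by rewrite mulr_ege1// exprn_ege1.
pose e := 1 / (16 * M ^+ 2).
have e0 : 0 < e by rewrite divr_gt0// mulr_gt0// exprn_gt0//; lra.
have e2 : e <= 1 / 2.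
  have M2 : 1 <= M ^+ 2 by exact: exprn_ege1.
  rewrite /e ler_pdivrMr; lra.
have WW : 1 <= W * W by exact: mulr_ege1.
(* Conjugation by such a word multiplies [A z - 1] by at most [W * W], so an element within [d] of
   the identity stays within [e] of it, the range of [nrm_commutator]. *)
pose d := e / (W * W).
have d0 : 0 < d by rewrite divr_gt0//; lra.
have de : d <= e by rewrite /d ler_pdivrMr ?ler_peMr//; lra.
exists d => // A hA faithA [d' d'0 disc'] Ab g0 g01; rewrite leNgt; apply/negP => g0d.
pose S := [set nrm (A g - 1%:M) | g in [set g : G | g != 1%g]].
have S0 : S !=set0 by exists (nrm (A g0 - 1%:M)), g0.
have lbS : has_lbound S by exists d' => _ [g g1 <-]; exact: disc'.
have m0 : 0 < inf S.
  by apply: lt_le_trans d'0 _; apply: lb_le_inf => // _ [g g1 <-]; exact: disc'.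
have minf g : g != 1%g -> inf S <= nrm (A g - 1%:M) by move=> g1; apply: ge_inf => //; exists g.
(* The infimum need not be attained; the loss of a factor 2 is exactly compensated by the factor 1/2
   for commutators. *)
have [_ [z z1 <-]] : exists2 y, S y & y < Num.min (2 * inf S) d.
  apply: inf_lt => //; rewrite lt_min; apply/andP; split; first lra.
  exact: le_lt_trans (minf _ g01) g0d.
rewrite lt_min => /andP[zm zd].
have comm x : nrm (A x - 1%:M) < e -> commute x z.
  move=> xe; have cle := nrm_commutator hA (ltW xe) (le_trans (ltW zd) (le_trans de e2)).
  have /eqP : (x * z * x^-1 * z^-1 == 1)%g.
    by apply: contraT => /minf; lra.
  move=> /(congr1 (fun y => y * z * x)%g); rewrite !mulgVK mul1g.
  by [].
suff : z = 1%g by move/eqP; rewrite (negbTE z1).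
apply: (short_conjugates_commute gens hG sV hA faithA) => u v us vs uK vK.
set x := wprod u; set y := wprod v.
pose w := rev [seq t^-1%g | t <- v] ++ u.
have ws : all [in s] w.
  rewrite all_cat us andbT all_rev all_map; apply: sub_all vs => t; exact: sV.
have wK : (size w <= K + K)%N by rewrite size_cat size_rev size_map leq_add.
have wE : wprod w = (y^-1 * x)%g by rewrite wprod_cat wprod_inv.
have bound t : all [in s] t -> (size t <= K + K)%N -> nrm (A (wprod t)) <= W.
  move=> ts tK; have Ab' r : r \in s -> nrm (A r) <= B.
    by move=> /Ab/le_trans; apply; rewrite le_max lexx orbT.
  apply: le_trans (nrm_wprod hA B1 Ab' ts) _.
  by rewrite /W ler_pM2l ?ltr0n//; exact: ler_weXn2l.
have c : commute (wprod w * z * (wprod w)^-1)%g z.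
  apply: comm; have -> : A (wprod w * z * (wprod w)^-1)%g - 1%:M =
      A (wprod w) *m (A z - 1%:M) *m A (wprod w)^-1%g.
    by rewrite mulmxBr mulmxBl mulmx1 (hommxVr hA) !hA.2.
  have iw : nrm (A (wprod w)^-1%g) <= W.
    rewrite -wprod_inv; apply: bound; last by rewrite size_rev size_map.
    by rewrite all_rev all_map; apply: sub_all ws => t; exact: sV.
  have h1 := nrmM (A (wprod w) *m (A z - 1%:M)) (A (wprod w)^-1%g).
  apply: le_lt_trans h1 _.
  apply: (@le_lt_trans _ _ (W * nrm (A z - 1%:M) * W)).
    apply: ler_pM; rewrite ?nrm_ge0//; apply: le_trans (nrmM _ _) _.
    by apply: ler_wpM2r; [exact: nrm_ge0|exact: bound].
  move: zd; rewrite /d ltr_pdivlMr; lra.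
(* Conjugating by [y] turns the commutation of [z] with its conjugate by [w] into that of the
   conjugates by [x] and [y]. *)
have xE : (x * z / x = y * (wprod w * z / wprod w) / y)%g.
  by rewrite wE invgM invgK !mulgA mulgV mul1g mulgK.
rewrite xE /commute !mulgA !mulgVK; congr (_ / y)%g.
by have := congr1 (fun t => y * t)%g c; rewrite !mulgA.
Qed.
End UniformDiscreteness.

(** * Unimodular lifts and the character variety *)

Section MatrixTopology.
Variable R : realType.

Lemma mx_nbhsP m n (M : 'M[R]_(m, n)) (B : set 'M[R]_(m, n)) :
  nbhs M B <-> exists2 e, 0 < e & forall M', nrm (M' - M) < e -> B M'.
Proof.
split=> [/nbhs_ballP[e /= e0 eB]|[e e0 eB]].
  exists e => // M' M'e; apply: eB; split=> // i j.
  rewrite -ball_normE /=; apply: le_lt_trans M'e; rewrite distrC.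
  by have := entry_le_nrm (M' - M) i j; rewrite !mxE.
pose e' := e / (m * n).+1%:R; have e'0 : 0 < e' by rewrite divr_gt0.
apply/nbhs_ballP; exists e' => //= M' [_ MM']; apply: eB.
have : nrm (M' - M) <= \sum_(i < m) \sum_(j < n) e'.
  apply: ler_sum => i _; apply: ler_sum => j _; rewrite !mxE ltW// distrC.
  by have := MM' i j; rewrite -ball_normE.
rewrite !sumr_const !card_ord -mulrnA -mulr_natr => /le_lt_trans; apply.
by rewrite /e' mulrAC ltr_pdivrMr// ltr_pM2l// ltr_nat mulnC.
Qed.

Lemma sub_nbhsP m n (A : set 'M[R]_(m, n)) (M : set_type A) (B : set (set_type A)) :
  nbhs M B <-> exists2 e, 0 < e & forall M' : set_type A, nrm (val M' - val M) < e -> B M'.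
Proof.
split=> [|[e e0 eB]].
  move=> [W [[O oO <-] OM] WB].
  have /mx_nbhsP[e e0 eO] : nbhs (val M) O by apply: open_nbhs_nbhs.
  by exists e => // M' M'e; apply: WB; exact: eO.
have : nbhs (val M) [set M' | nrm (M' - val M) < e] by apply/mx_nbhsP; exists e.
move=> h; have cont : continuous (set_val : set_type A -> 'M[R]_(m, n)).
  exact: initial_continuous.
have : nbhs M (set_val @^-1` [set M' | nrm (M' - val M) < e]) by exact: (cont M _ h).
by apply: filterS => M' /eB.
Qed.
End MatrixTopology.

Section HomTopology.
Variables (R : realType) (n : nat).
Local Notation N := n.+1.

Lemma proj_pt_continuous : continuous (@proj_pt R n).
Proof. exact: pi_continuous. Qed.

Lemma projgl_continuous : continuous (@projgl R n).
Proof. exact: pi_continuous. Qed.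

Lemma pgl_cvg (T : Type) (U : set_system T) {UF : Filter U} (X : T -> gl R n) L :
  mcvg U (fun t => val (X t)) (val L) -> (fun t => projgl (X t)) @ U --> projgl L.
Proof.
move=> /mcvgP XL; apply: (@cvg_comp _ _ _ X (@projgl R n) U (nbhs L)); last first.
  exact: projgl_continuous.
by move=> B /sub_nbhsP[e e0 eB]; apply: filterS (XL e e0) => t /eB.
Qed.

Lemma homspace_cvgP (G : groupType) (T : Type) (U : set_system T) {UF : Filter U}
    (f : T -> homspace R n G) (l : homspace R n G) :
  f @ U --> l <-> forall g, (fun t => (val (f t) : G -> _) g) @ U --> (val l : G -> _) g.
Proof.
split=> [fl g|h].
  apply: (@cvg_comp _ _ _ f (fun r : homspace R n G => (val r : G -> _) g) U (nbhs l)) => //.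
  apply: (@continuous_comp _ _ _ (fun r : homspace R n G => (val r : {ptws G -> pgl R n})) (fun r : {ptws G -> pgl R n} => r g)).
    exact: initial_continuous.
  exact: proj_continuous.
have vl : (fun t => val (f t) : {ptws G -> pgl R n}) @ U --> (val l : {ptws G -> pgl R n}).
  apply/cvg_sup => g B; rewrite (@nbhsE (initial_topology _)).
  move=> [_ [[O oO <-] Ol] OB]; apply: (@filterS _ _ _ _ _ OB).
  by apply: h; exact: open_nbhs_nbhs.
move=> B [W [[O oO <-] Ol] WB]; apply: (@filterS _ _ _ _ _ WB).
by apply: vl; exact: open_nbhs_nbhs.
Qed.

End HomTopology.

Section UnimodularLifts.
Variables (R : realType) (n : nat).
Local Notation N := n.+1.
Implicit Types (a b : pgl R n) (X Y A : 'M[R]_N).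

(** The absolute value is needed because in even size the sign of the determinant is an invariant of
    the projective class. Over the reals such a lift is unique up to sign. *)
Definition lift1 a X := `|\det X| = 1 /\ exists h : X \in unitmx, projgl (mkgl h) = a.

Lemma unit_det1 X : `|\det X| = 1 -> X \in unitmx.
Proof. by move=> d1; rewrite unitmxE unitfE -normr_gt0 d1. Qed.

Lemma lift1_scale (A : gl R n) : exists2 c : R, 0 < c & `|\det (c *: val A)| = 1.
Proof.
have d0 : 0 < `|\det (val A)| by rewrite normr_gt0 -unitfE -unitmxE gl_unit.
exists (`|\det (val A)|^-1 `^ N%:R^-1); first by rewrite powR_gt0// invr_gt0.
rewrite detZ normrM ger0_norm ?exprn_ge0 ?powR_ge0// -powR_mulrn ?powR_ge0//.
by rewrite -powRrM mulVf ?pnatr_eq0// powRr1 ?invr_ge0// mulVf ?gt_eqF.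
Qed.

Lemma lift1_ex a : exists X, lift1 a X.
Proof.
have [c c0 dc] := lift1_scale (repr a); exists (c *: val (repr a)); split=> //.
exists (unit_det1 dc); rewrite -[RHS]projgl_repr; apply/projglP.
by exists c => //; exact: lt0r_neq0.
Qed.

Lemma expr_norm1 (c : R) : `|c| ^+ N = 1 -> `|c| = 1.
Proof. by move=> /eqP; rewrite pexpr_eq1// => /eqP. Qed.

Lemma lift1_pm a X Y : lift1 a X -> lift1 a Y -> Y = X \/ Y = - X.
Proof.
move=> [dX [hX <-]] [dY [hY /projglP[c c0 /= YX]]].
have : `|c| = 1 by apply: expr_norm1; move: dY; rewrite YX detZ normrM dX mulr1 normrX.
move/eqP; rewrite eqr_norml => /andP[/orP[]/eqP cE _]; rewrite YX cE.
  by left; rewrite scale1r.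
by right; rewrite scaleN1r.
Qed.

Lemma lift1N a X : lift1 a X -> lift1 a (- X).
Proof.
move=> [dX [hX aX]]; have dN : `|\det (- X)| = 1.
  by rewrite -scaleN1r detZ normrM dX mulr1 normrX normrN1 expr1n.
split=> //; exists (unit_det1 dN); rewrite -aX; apply/projglP; exists (-1).
  by rewrite oppr_eq0 oner_eq0.
by rewrite /= scaleN1r.
Qed.

Lemma lift1M a b X Y : lift1 a X -> lift1 b Y -> lift1 (a * b)%g (X *m Y).
Proof.
move=> [dX [hX <-]] [dY [hY <-]]; have dXY : `|\det (X *m Y)| = 1.
  by rewrite det_mulmx normrM dX dY mulr1.
split=> //; exists (unit_det1 dXY); rewrite -[(_ * _)%g]/(pglM _ _) pglM_proj.
by congr projgl; apply: val_inj.
Qed.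

Lemma lift1_1 : lift1 1%g 1%:M.
Proof.
have d1 : `|\det (1%:M : 'M[R]_N)| = 1 by rewrite det1 normr1.
split=> //; exists (unit_det1 d1); rewrite -[RHS]/(projgl (gl1 R n)).
by congr projgl; apply: val_inj.
Qed.

Lemma lift1_fun a b X : lift1 a X -> lift1 b X -> a = b.
Proof. by move=> [_ [h <-]] [_ [h' <-]]; congr projgl; apply: val_inj. Qed.

Lemma lift1_mx1 a : lift1 a 1%:M -> a = 1%g.
Proof. by move=> /lift1_fun; apply; exact: lift1_1. Qed.

(** Convergence in the quotient says nothing about representatives. The matrices having some nonzero
    multiple in a ball around [A] form an open set saturated under scaling, which is thus the
    preimage of an open set of PGL. *)
Lemma pgl_near (T : Type) (U : set_system T) {UF : Filter U} (a : T -> pgl R n) (A : gl R n) :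
  a @ U --> projgl A -> forall e, 0 < e -> \forall t \near U, forall X, lift1 (a t) X ->
  exists2 c : R, c != 0 & nrm (c *: X - val A) < e.
Proof.
move=> aA e e0.
pose S := [set B : gl R n | exists2 c : R, c != 0 & nrm (c *: val B - val A) < e].
pose S' := [set b | exists2 B, S B & projgl B = b].
have satS : @projgl R n @^-1` S' = S.
  rewrite predeqE => B; split=> [[B' [c c0 cB']]|SB]; last by exists B.
  move=> /projglP[d d0 B'B]; exists (c * d); first by rewrite mulf_neq0.
  by rewrite -scalerA -B'B.
have oS' : open S'.
  rewrite -[open S']/(open (@projgl R n @^-1` S')) satS openE => B [c c0 cB].
  apply/sub_nbhsP; exists ((e - nrm (c *: val B - val A)) / `|c|).
    by rewrite divr_gt0 ?subr_gt0 ?normr_gt0.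
  move=> B' B'B; exists c => //; apply: le_lt_trans (nrm_triangle _ (c *: val B) _) _.
  by move: B'B; rewrite -scalerBr nrmZ ltr_pdivlMr ?normr_gt0// mulrC ltrBrDr.
have nS' : nbhs (projgl A) S'.
  apply: open_nbhs_nbhs; split=> //; exists A => //; exists 1; first exact: oner_neq0.
  by rewrite scale1r subrr nrm0.
have : \forall t \near U, S' (a t) by exact: aA.
apply: filterS => t [B [c c0 cB] BaX] X [dX [hX XaX]].
have /projglP[d d0 BX] : projgl B = projgl (mkgl hX) by rewrite BaX XaX.
by exists (c * d); [rewrite mulf_neq0|rewrite -scalerA -BX].
Qed.

(** An ultrafilter resolves the sign ambiguity by itself. The scalars moving [X t] near a fixed lift
    [A0] are bounded below by the determinants, so [X] is bounded and converges to some [X0] of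
    determinant of absolute value 1. *)
Lemma lift1_limit (T : Type) (U : set_system T) (a : T -> pgl R n) a0 (X : T -> 'M[R]_N) :
  UltraFilter U -> a @ U --> a0 -> (\forall t \near U, lift1 (a t) (X t)) ->
  exists2 X0, lift1 a0 X0 & mcvg U X X0.
Proof.
move=> UU aa0 aX; have [A0 aA0] := lift1_ex a0; have [dA0 [hA0 A0E]] := aA0.
have PU : ProperFilter U by exact: ultra_proper.
have near e : 0 < e -> \forall t \near U, lift1 (a t) (X t) /\
    exists2 c : R, c != 0 & nrm (c *: X t - A0) < e.
  move=> e0; rewrite -A0E in aa0; have h := pgl_near aa0 e0.
  near=> t; have aXt : lift1 (a t) (X t) by near: t.
  split=> //; move: (X t) aXt; near: t. exact: h.
have [e e0 eP] : exists2 e, 0 < e & forall M, nrm (M - A0) < e -> 1 / 2 < `|\det M|.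
  have cA0 : mcvg (nbhs A0) id A0.
    by apply/mcvgP => e e0; apply/mx_nbhsP; exists e.
  have h : (fun M : 'M[R]_N => `|\det M|) @ nbhs A0 --> (1 : R).
    by rewrite -dA0; apply: cvg_norm; exact: mcvg_det cA0.
  have h2 : 0 < (1 / 2 : R) by lra.
  move/cvgrPdist_lt: h => /(_ _ h2)/mx_nbhsP[e e0 eP]; exists e => // M /eP.
  by rewrite ltr_distlC => /andP[]; lra.
have XB : \forall t \near U, nrm (X t) <= 2 * (nrm A0 + e).
  apply: filterS (near e e0) => t [[dX _] [c c0 cX]].
  have := eP _ cX; rewrite detZ normrM dX mulr1 normrX => cN.
  have c2 : 1 / 2 <= `|c|.
    rewrite leNgt; apply/negP => c2; have := normr_ge0 c => c0'.
    have : `|c| ^+ N <= `|c| by rewrite exprS ler_piMr// exprn_ile1//; lra.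
    lra.
  have : nrm (c *: X t) <= nrm A0 + e.
    rewrite -[c *: X t](subrK A0) addrC; apply: le_trans (nrmD _ _) _.
    by rewrite lerD2l ltW.
  by rewrite nrmZ; have := nrm_ge0 (X t); nra.
have [X0 XX0] := ultra_mcvg UU XB.
exists X0 => //.
have dX0 : `|\det X0| = 1.
  have h : (fun t => `|\det (X t)|) @ U --> `|\det X0|.
    by apply: cvg_norm; exact: mcvg_det.
  have h1 : (fun t => `|\det (X t)|) @ U --> (1 : R).
    apply: (@cvg_trans _ ((fun=> 1 : R) @ U)); last exact: cvg_cst.
    apply: near_eq_cvg.
    by apply: filterS aX => t [].
  exact: (cvg_unique (@Rhausdorff R) h h1).
(* Proportionality of [X0] and [A0] is expressed by relations free of the scalars [c], about whose
   convergence nothing is known. *)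
have cross i j k l : X0 i j * A0 k l = X0 k l * A0 i j.
  pose b := 2 * (nrm A0 + e).
  have b0 : 0 < b by have := nrm_ge0 A0; rewrite /b; lra.
  apply/eqP; rewrite -subr_eq0 -normr_le0; apply/ler_addgt0Pl => d d0; rewrite addr0.
  have lim : (fun t => `|X t i j * A0 k l - X t k l * A0 i j|) @ U -->
      `|X0 i j * A0 k l - X0 k l * A0 i j|.
    apply: cvg_norm; apply: cvgB; (apply: cvgM; last exact: cvg_cst); exact: XX0.
  apply: (cvgr_to_le lim).
  have d20 : 0 < d / (2 * b) by rewrite divr_gt0// mulr_gt0.
  near=> t; have Xb : nrm (X t) <= b by near: t.
  have [_ [c c0 cX]] : lift1 (a t) (X t) /\ exists2 c : R, c != 0 & nrm (c *: X t - A0) < d / (2 * b).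
    by near: t; exact: near.
  set M := c *: X t - A0 in cX.
  have -> : X t i j * A0 k l - X t k l * A0 i j = X t k l * M i j - X t i j * M k l.
    by rewrite !mxE; ring.
  apply: le_trans (ler_normB _ _) _; rewrite !normrM.
  have h1 := entry_le_nrm (X t) k l; have h2 := entry_le_nrm (X t) i j.
  have m1 := entry_le_nrm M i j; have m2 := entry_le_nrm M k l.
  have : `|X t k l| * `|M i j| <= b * (d / (2 * b)).
    by apply: ler_pM => //; [exact: le_trans Xb|exact: le_trans m1 (ltW cX)].
  have : `|X t i j| * `|M k l| <= b * (d / (2 * b)).
    by apply: ler_pM => //; [exact: le_trans Xb|exact: le_trans m2 (ltW cX)].
  have -> : b * (d / (2 * b)) = d / 2 by field; exact: lt0r_neq0.
  lra.
have [k [l X0kl]] : exists k l, X0 k l != 0.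
  apply: contrapT => /forallNP h; have X00 : X0 = 0.
    by apply/matrixP => i j; have /forallNP/(_ j)/negP := h i; rewrite negbK mxE => /eqP.
  by move: dX0; rewrite X00 det0 normr0 => /esym/eqP; rewrite oner_eq0.
split=> //; exists (unit_det1 dX0); rewrite -A0E; apply/esym/projglP => /=.
exists (A0 k l / X0 k l); last first.
  apply/matrixP => i j; rewrite !mxE mulrAC [A0 k l * _]mulrC cross mulrAC mulfV//.
  by rewrite mul1r.
rewrite mulf_neq0 ?invr_eq0//; apply/eqP => A0kl.
have A00 : A0 = 0.
  apply/matrixP => i j; have := cross i j k l; rewrite A0kl mulr0 => /esym/eqP.
  by rewrite mulf_eq0 (negbTE X0kl) /= mxE => /eqP.
by move: dA0; rewrite A00 det0 normr0 => /esym/eqP; rewrite oner_eq0.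
Unshelve. all: end_near. Qed.

End UnimodularLifts.

(** * Equality of traces up to signs as an invariant of [chi] *)

Section SameLift.
Variables (R : realType) (n : nat) (G : groupType).
Local Notation N := n.+1.
Local Notation hom := (homspace R n G).
Implicit Types (rho sigma : hom) (X Y : G -> 'M[R]_N).

Definition homval rho (g : G) : pgl R n := (val rho : G -> pgl R n) g.

Lemma homvalM rho g h : homval rho (g * h)%g = (homval rho g * homval rho h)%g.
Proof. by have := set_mem (valP rho); apply. Qed.

Lemma homval1 rho : homval rho 1%g = 1%g.
Proof.
by apply: (mulgI (homval rho 1%g)); rewrite mulg1 -homvalM mulg1.
Qed.

Definition homlift rho X := forall g, lift1 (homval rho g) (X g).

(** Words in the lifts are used, not only single group elements, because a lift is multiplicative
    only up to sign. *)
Definition samelift rho sigma :=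
  exists X Y, [/\ homlift rho X, homlift sigma Y & sametrace X Y].

Lemma homlift_ex rho : exists X, homlift rho X.
Proof. by have [X hX] := choice (fun g => lift1_ex (homval rho g)); exists X. Qed.

Lemma wordmx_scale (I : Type) m (e : I -> R) (X : I -> 'M[R]_m) w :
  wordmx (fun i => e i *: X i) w = (\prod_(i <- w) e i) *: wordmx X w.
Proof.
elim: w => [|i w IH] /=; first by rewrite big_nil scale1r.
by rewrite IH -scalemxAl -scalemxAr scalerA big_cons.
Qed.

Lemma samelift_refl rho : samelift rho rho.
Proof. by have [X hX] := homlift_ex rho; exists X, X. Qed.

Lemma samelift_sym rho sigma : samelift rho sigma -> samelift sigma rho.
Proof. by move=> [X [Y [hX hY XY]]]; exists Y, X; split=> // w. Qed.

Lemma homlift_sign rho X X' : homlift rho X -> homlift rho X' ->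
  exists2 e : G -> R, (forall g, e g = 1 \/ e g = -1) & X' = fun g => e g *: X g.
Proof.
move=> hX hX'.
have h g : exists e : R, (e = 1 \/ e = -1) /\ X' g = e *: X g.
  have [->|->] := lift1_pm (hX g) (hX' g).
    by exists 1; split; [left|rewrite scale1r].
  by exists (-1); split; [right|rewrite scaleN1r].
have [e eP] := choice h; exists e; first by move=> g; have [] := eP g.
by apply/funext => g; have [] := eP g.
Qed.

Lemma homlift_scale rho X (e : G -> R) : homlift rho X -> (forall g, e g = 1 \/ e g = -1) ->
  homlift rho (fun g => e g *: X g).
Proof.
move=> hX eP g; have [->|->] := eP g; first by rewrite scale1r.
by rewrite scaleN1r; exact: lift1N.
Qed.

(** The two lifts of [sigma] differ by signs, and these can be transferred to the lift of [rho]. *)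
Lemma samelift_trans rho sigma tau :
  samelift rho sigma -> samelift sigma tau -> samelift rho tau.
Proof.
move=> [X [Y [hX hY XY]]] [Y' [Z [hY' hZ YZ]]].
have [e eP Y'E] := homlift_sign hY hY'.
exists (fun g => e g *: X g), Z; split=> //; first exact: homlift_scale.
move=> w; rewrite -(YZ w) Y'E !wordmx_scale !mxtraceZ.
by rewrite (XY w).
Qed.

Lemma samelift_limit (T : Type) (U : set_system T) (f : T -> hom) rho
    (Y : T -> G -> 'M[R]_N) Y0 :
  UltraFilter U -> f @ U --> rho -> (forall g, mcvg U (Y ^~ g) (Y0 g)) ->
  (\forall t \near U, exists2 X, homlift (f t) X & sametrace X (Y t)) ->
  exists2 X, homlift rho X & sametrace X Y0.
Proof.
move=> UU frho YY0 XY; have PU : ProperFilter U by exact: ultra_proper.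
(* The implication lets [choice] select a lift for every [t], with a default value where none
   exists. *)
pose P t (X : G -> 'M[R]_N) := (exists2 X, homlift (f t) X & sametrace X (Y t)) ->
  homlift (f t) X /\ sametrace X (Y t).
have exP t : exists X, P t X.
  have [[X hX XYt]|no] := pselect (exists2 X, homlift (f t) X & sametrace X (Y t)).
    by exists X.
  by exists (fun=> 0) => /no.
have [X XP] := choice exP.
have hX : \forall t \near U, homlift (f t) (X t) /\ sametrace (X t) (Y t).
  by apply: filterS XY => t /XP.
have hlim g : exists M : 'M[R]_N, lift1 (homval rho g) M /\ mcvg U (X ^~ g) M.
  have fg : (fun t => homval (f t) g) @ U --> homval rho g.
    by move/homspace_cvgP: frho; apply.
  have [|X0 h1 h2] := lift1_limit (X := X ^~ g) UU fg; last by exists X0.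
  by apply: filterS hX => t [].
have [X0 X0P] := choice hlim; exists X0 => [g|w]; first by have [] := X0P g.
have lim1 : (fun t => \tr (wordmx (X t) w)) @ U --> \tr (wordmx X0 w).
  by apply: mcvg_trace; apply: mcvg_wordmx => g; have [] := X0P g.
have lim2 : (fun t => \tr (wordmx (Y t) w)) @ U --> \tr (wordmx Y0 w).
  by apply: mcvg_trace; apply: mcvg_wordmx.
have lim3 : (fun t => \tr (wordmx (X t) w)) @ U --> \tr (wordmx Y0 w).
  apply: (@cvg_trans _ ((fun t => \tr (wordmx (Y t) w)) @ U)); last exact: lim2.
  by apply: near_eq_cvg; apply: filterS hX => t [].
exact: (cvg_unique (@Rhausdorff R) lim1 lim3).
Qed.

Lemma conj_homlift rho X (S : gl R n) : homlift rho X ->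
  exists2 sigma, conj_orbit rho sigma & homlift sigma (fun g => val S *m X g *m invmx (val S)).
Proof.
move=> hX; pose a : pgl R n := projgl (glV S).
pose f : {ptws G -> pgl R n} := fun g => (homval rho g ^ a)%g.
have fM : [set f : {ptws G -> pgl R n} | {morph f : x y / (x * y)%g}] f.
  by move=> x y; rewrite /f homvalM conjMg.
pose sigma : hom := exist _ f (mem_set fM).
exists sigma; first by exists a.
move=> g; have [dX [hXg Xg]] := hX g.
have uS := gl_unit S.
have d1 : `|\det (val S *m X g *m invmx (val S))| = 1.
  rewrite !det_mulmx mulrAC -det_mulmx mulmxV// det1 mul1r//.
split=> //; exists (unit_det1 d1); rewrite -[RHS]/(homval rho g ^ a)%g conjgE -Xg.
rewrite -[(_^-1)%g]/(pglV _) /a pglV_proj.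
rewrite -[(_ * (_ * _))%g]/(pglM _ (pglM _ _)) !pglM_proj; congr projgl.
by apply: val_inj; rewrite /= invmxK mulmxA.
Qed.

Lemma conj_orbit_samelift rho sigma X : conj_orbit rho sigma -> homlift rho X ->
  exists2 Y, homlift sigma Y & sametrace Y X.
Proof.
move=> [a aP] hX; have [tau tauP hY] := conj_homlift (glV (repr a)) hX.
have uA := gl_unit (repr a).
exists (fun g => val (glV (repr a)) *m X g *m invmx (val (glV (repr a)))).
  move=> g; have [dX [hXg Xg]] := hX g; have [d1 _] := hY g.
  split=> //; exists (unit_det1 d1); rewrite [RHS]aP -/(homval rho g) -Xg conjgE.
  rewrite -[a in RHS]projgl_repr -[(_^-1)%g]/(pglV _) pglV_proj.
  rewrite -[(_ * (_ * _))%g]/(pglM _ (pglM _ _)) !pglM_proj; congr projgl.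
  by apply: val_inj; rewrite /= invmxK mulmxA.
move=> w; set P := val _.
have uP : P \in unitmx by rewrite unitmx_inv.
rewrite -[in LHS](mulmx1 (wordmx _ w)) -(mulmxV uP) mulmxA -(@wordmx_intertwine _ _ _ _ X).
  by rewrite mxtrace_mulC mulmxA mulVmx// mul1mx.
  by move=> g; rewrite mulmxKV.
Qed.

(** Traces of words are invariant under conjugation and pass to ultralimits, so they do not separate
    an orbit from its closure. *)
Lemma closure_samelift rho eta : closure (conj_orbit rho) eta -> samelift eta rho.
Proof.
move=> cl; have [X hX] := homlift_ex rho.
have PF : ProperFilter (within (conj_orbit rho) (nbhs eta)).
  by apply: within_nbhs_proper.
have [U [UU FU]] := ultraFilterLemma PF.
have [|||Y hY YX] := @samelift_limit _ U id eta (fun=> X) X UU.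
- by move=> B nB; apply: FU; apply: filterS nB => x Bx _.
- by move=> g; exact: mcvg_cst.
- by apply: FU; apply: nearW => sigma /conj_orbit_samelift /(_ hX).
- by exists Y, X.
Qed.

Lemma chi_samelift rho sigma : chi rho = chi sigma -> samelift rho sigma.
Proof.
move=> /chiP; elim=> {rho sigma} [rho sigma [eta [h1 h2]]|rho|rho sigma _|rho sigma tau _ h1 _].
- exact: samelift_trans (samelift_sym (closure_samelift h1)) (closure_samelift h2).
- exact: samelift_refl.
- exact: samelift_sym.
- exact: samelift_trans.
Qed.

End SameLift.

(** * Equal traces give equal points of the character variety *)

Section SameLiftChi.
Variables (R : realType) (n : nat) (G : groupType).
Local Notation N := n.+1.
Local Notation hom := (homspace R n G).
Implicit Types (rho sigma : hom).

Lemma hom_of_lift (Z : G -> 'M[R]_N) : (forall g, `|\det (Z g)| = 1) ->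
  (forall g h, Z (g * h)%g = Z g *m Z h \/ Z (g * h)%g = - (Z g *m Z h)) ->
  exists rho : hom, homlift rho Z.
Proof.
move=> dZ ZM; pose f : {ptws G -> pgl R n} := fun g => projgl (mkgl (unit_det1 (dZ g))).
have lf g : lift1 (f g) (Z g) by split=> //; exists (unit_det1 (dZ g)).
have fM : [set f : {ptws G -> pgl R n} | {morph f : x y / (x * y)%g}] f.
  move=> g h; have := lift1M (lf g) (lf h); have := lf (g * h)%g.
  case: (ZM g h) => ->; first exact: lift1_fun.
  by move=> /lift1N; rewrite opprK; exact: lift1_fun.
by exists (exist _ f (mem_set fM)) => g; exact: lf.
Qed.

Lemma homliftM rho (X : G -> 'M[R]_N) g h : homlift rho X ->
  X (g * h)%g = X g *m X h \/ X (g * h)%g = - (X g *m X h).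
Proof.
move=> hX; have := hX (g * h)%g; rewrite homvalM; apply: lift1_pm.
exact: lift1M.
Qed.

Lemma conj_mulmx (a b c : 'M[R]_N) : a \in unitmx ->
  a *m (b *m c) *m invmx a = a *m b *m invmx a *m (a *m c *m invmx a).
Proof. by move=> ua; rewrite !mulmxA mulmxKV. Qed.

(** Each link of the chain is a limit of conjugates. The limit still has determinants of absolute
    value 1 and is multiplicative up to sign, so it lifts a homomorphism in the closure of the
    orbit. The matrices [P] and [Q] bring the varying size [m] back to [N]. *)
Lemma degen_chi rho (X : G -> 'M[R]_N) m (D : G -> 'M[R]_m) :
  homlift rho X -> degen X D -> exists sigma (P : 'M_(N, m)) Q,
  [/\ chi rho = chi sigma, rectinv P Q & homlift sigma (fun g => P *m D g *m Q)].
Proof.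
move=> hX; elim=> [|m1 B m2 B' _ [sigma [P [Q [chis [PQ QP] hB]]]] [S [S' [SS' lim]]]].
  exists rho, 1%:M, 1%:M; split=> //; first by split; rewrite mulmx1.
  by move=> g; rewrite mul1mx mulmx1; exact: hX.
(* Any index would do: it only identifies the new size with [N], so that [T k] below is a square
   conjugator. *)
have [SS0 S'S0] := SS' 0%N.
pose P' := P *m S' 0%N; pose Q' := S 0%N *m Q.
have PQ' : rectinv P' Q'.
  split; rewrite /P' /Q' mulmxA.
    by rewrite -(mulmxA P) S'S0 mulmx1 PQ.
  by rewrite -(mulmxA (S 0%N)) QP mulmx1 SS0.
clearbody P' Q'.
pose T k := P' *m S k *m Q; pose T' k := P *m S' k *m Q'.
have TT' k : T k *m T' k = 1%:M.
  have [h1 h2] := SS' k; rewrite /T /T' !mulmxA -(mulmxA _ Q P) QP mulmx1.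
  by rewrite -(mulmxA P') h1 mulmx1 PQ'.1.
have uT k : T k \in unitmx by have /mulmx1_unit[] := TT' k.
have T'E k : invmx (T k) = T' k.
  by rewrite -[LHS]mulmx1 -(TT' k) mulKmx.
pose Y g := P *m B g *m Q; pose Z g := P' *m B' g *m Q'.
have YZ g : mcvg \oo (fun k => T k *m Y g *m invmx (T k)) (Z g).
  rewrite (_ : (fun k => _) = fun k => P' *m (S k *m B g *m S' k) *m Q'); last first.
    apply/funext => k; rewrite T'E /T /Y /T' !mulmxA -(mulmxA _ Q P) QP mulmx1.
    by rewrite -(mulmxA _ Q P) QP mulmx1.
  by apply: mcvgM; [apply: mcvgM => //|]; exact: mcvg_cst.
have dZ g : `|\det (Z g)| = 1.
  have h : (fun k => `|\det (T k *m Y g *m invmx (T k))|) @ \oo --> `|\det (Z g)|.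
    by apply: cvg_norm; exact: mcvg_det.
  have h1 : (fun k => `|\det (T k *m Y g *m invmx (T k))|) @ \oo --> (1 : R).
    rewrite (_ : (fun k => _) = fun=> 1); first exact: cvg_cst.
    apply/funext => k; rewrite !det_mulmx mulrAC -det_mulmx mulmxV// det1 mul1r.
    by have [] := hB g.
  exact: (cvg_unique (@Rhausdorff R) h h1).
have ZM g h : Z (g * h)%g = Z g *m Z h \/ Z (g * h)%g = - (Z g *m Z h).
  have lim2 : mcvg \oo (fun k => T k *m (Y g *m Y h) *m invmx (T k)) (Z g *m Z h).
    rewrite (_ : (fun k => _) = fun k => (T k *m Y g *m invmx (T k)) *m (T k *m Y h *m invmx (T k))).
      exact: mcvgM.
    by apply/funext => k; exact: conj_mulmx.
  have lim1 := YZ (g * h)%g.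
  case: (homliftM g h hB) => E; [left|right].
    by apply: mcvg_unique lim1 _; rewrite /Y E.
  apply: mcvg_unique lim1 _; rewrite (_ : (fun k => _) = fun k => (-1) *: (T k *m (Y g *m Y h) *m invmx (T k))).
    by rewrite -(scaleN1r (Z g *m Z h)); apply: mcvgZ => //; exact: cvg_cst.
  by apply/funext => k; rewrite /Y E scaleN1r mulmxN mulNmx.
have [tau htau] := hom_of_lift dZ ZM.
exists tau, P', Q'; split=> //; rewrite chis; apply/chiP/rst_step.
have ex k : exists f : hom, conj_orbit sigma f /\ homlift f (fun g => T k *m Y g *m invmx (T k)).
  by have [f f1 f2] := conj_homlift (mkgl (uT k)) hB; exists f.
have [f fP] := choice ex.
exists tau; split; last first.
  by apply: subset_closure; exists 1%g => g; rewrite conjg1.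
apply: (@closed_cvg _ _ \oo _ f (closure (conj_orbit sigma))) => //.
- exact: closed_closure.
- by apply: nearW => k; apply: subset_closure; have [] := fP k.
apply/homspace_cvgP => g.
pose fg k : gl R n := mkgl (unit_det1 ((fP k).2 g).1).
have -> : (fun k => (val (f k) : G -> _) g) = (fun k => projgl (fg k)).
  apply/funext => k; have [_ /(_ g)[d1 [h]]] := fP k; rewrite -/(homval _ g) => <-.
  by congr projgl; apply: val_inj.
have [d1 [h]] := htau g; rewrite -/(homval _ g) => <-.
by apply: pgl_cvg; exact: YZ.
Qed.

Lemma samelift_chi rho sigma : samelift rho sigma -> chi rho = chi sigma.
Proof.
move=> [X [Y [hX hY /sametrace_degen[m [D [XD YD]]]]]].
have [rho' [P [Q [-> [PQ QP] hP]]]] := degen_chi hX XD.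
have [sigma' [P' [Q' [-> [PQ' QP'] hP']]]] := degen_chi hY YD.
have uT : P' *m Q \in unitmx.
  by have /mulmx1_unit[] : (P' *m Q) *m (P *m Q') = 1%:M; rewrite // mulmxA -(mulmxA P') QP mulmx1.
have invT : invmx (P' *m Q) = P *m Q'.
  rewrite -[LHS]mulmx1 (_ : 1%:M = (P' *m Q) *m (P *m Q')) ?mulKmx//.
  by rewrite mulmxA -(mulmxA P') QP mulmx1 PQ'.
have [tau orb htau] := conj_homlift (mkgl uT) hP.
(* Both have the same unimodular lift, namely the common degeneration [D] brought to size [N] by
   [P'] and [Q']. *)
have -> : sigma' = tau.
  apply: val_inj; apply/funext => g; apply: lift1_fun (hP' g) _.
  have := htau g; rewrite /= invT; congr lift1.
  by rewrite !mulmxA -(mulmxA P' Q P) QP mulmx1 -(mulmxA _ Q P) QP mulmx1.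
apply/chiP/rst_step; exists tau; split; first exact: subset_closure.
by apply: subset_closure; exists 1%g => g; rewrite conjg1.
Qed.

End SameLiftChi.

(** * The cone over a properly convex set *)

Section ConeLift.
Variables (R : realType) (n : nat).
Local Notation N := n.+1.
Implicit Types (Omega : set (projspace R n)) (x y z w : 'cV[R]_N).

Definition mknz x (x0 : x != 0) : nzvec R n := exist _ x (mem_set x0).

Lemma nz_neq0 (u : nzvec R n) : val u != 0.
Proof. exact: set_mem (valP u). Qed.

Definition liftset Omega : set 'cV[R]_N :=
  [set x | exists2 u : nzvec R n, val u = x & Omega (proj_pt u)].

Lemma liftset_nz Omega (u : nzvec R n) : liftset Omega (val u) <-> Omega (proj_pt u).
Proof. by split=> [[v /val_inj ->]|]; last exists u. Qed.

Lemma liftset0 Omega x : liftset Omega x -> x != 0.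
Proof. by move=> [u <- _]; exact: nz_neq0. Qed.

Lemma liftsetZ Omega x c : c != 0 -> liftset Omega x -> liftset Omega (c *: x).
Proof.
move=> c0 [u <- Ou]; have cu0 : c *: val u != 0.
  by rewrite scaler_eq0 negb_or c0 nz_neq0.
exists (mknz cu0) => //; rewrite (_ : proj_pt _ = proj_pt u)//.
by apply/projP; exists c.
Qed.

Lemma liftset_open Omega x : open Omega -> liftset Omega x ->
  exists2 e, 0 < e & forall w, nrm (w - x) < e -> liftset Omega w.
Proof.
move=> oO [u <- Ou].
have : nbhs u (@proj_pt R n @^-1` Omega).
  by apply: proj_pt_continuous; exact: open_nbhs_nbhs.
move=> /sub_nbhsP[e e0 eO].
have x0 : 0 < nrm (val u).
  rewrite lt_def nrm_ge0 andbT; apply: contraTneq (nz_neq0 u) => u0.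
  by rewrite negbK (nrm_eq0 (X := val u)) ?u0.
exists (Num.min e (nrm (val u))); first by rewrite lt_min e0.
move=> w; rewrite lt_min => /andP[we wx].
have w0 : w != 0 by apply: contraTneq wx => ->; rewrite sub0r nrmN ltxx.
by exists (mknz w0) => //; exact: eO.
Qed.

(** As [liftset] never contains zero, membership here also says that the segment avoids the origin;
    [wsegm] allows it to pass through. *)
Definition segm (X : set 'cV[R]_N) x y := forall s t, 0 <= s -> 0 <= t -> 0 < s + t ->
  X (s *: x + t *: y).

Definition wsegm (X : set 'cV[R]_N) x y := forall s t, 0 <= s -> 0 <= t ->
  s *: x + t *: y != 0 -> X (s *: x + t *: y).

(** Convexity supplies endpoints [u] and [v] unrelated to [x] and [y]. Up to signs both points are
    nonnegative combinations of [u] and [v], and the product of the two signs decides the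
    alternative. *)
Lemma liftset_segm Omega x y : proj_convex Omega -> liftset Omega x -> liftset Omega y ->
  wsegm (liftset Omega) x y \/ wsegm (liftset Omega) x (- y).
Proof.
move=> cO [p <- Op] [q <- Oq]; have [u [v [up uq uvO]]] := cO _ _ Op Oq.
have coord (r : nzvec R n) : proj_segment u v (proj_pt r) -> exists e s t,
    [/\ e = 1 \/ e = -1, 0 <= s, 0 <= t & e *: val r = s *: val u + t *: val v].
  move=> [w [s [t [s0 t0 wE]]] /projP[c c0 wr]].
  exists (Num.sg c), (`|c|^-1 * s), (`|c|^-1 * t); split.
  - by case: sgrP c0 => //; [left|right].
  - by rewrite mulr_ge0// invr_ge0.
  - by rewrite mulr_ge0// invr_ge0.
  - rewrite -!scalerA -scalerDr -wE wr scalerA; congr (_ *: _).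
    by rewrite [X in _ * X]numEsg mulrCA mulVf ?normr_eq0// mulr1.
have [e [s [t [eP s0 t0 pE]]]] := coord p up.
have [e' [s' [t' [eP' s'0 t'0 qE]]]] := coord q uq.
have main a b : 0 <= a -> 0 <= b -> a *: (e *: val p) + b *: (e' *: val q) != 0 ->
    liftset Omega (a *: (e *: val p) + b *: (e' *: val q)).
  move=> a0 b0 nz; exists (mknz nz) => //; apply: uvO.
  exists (mknz nz) => //; exists (a * s + b * s'), (a * t + b * t').
  split; rewrite ?addr_ge0 ?mulr_ge0//= pE qE !scalerDr !scalerA !scalerDl.
  by rewrite addrACA.
have ee : e * e = 1 by case: eP => ->; rewrite ?mulr1// mulrNN mulr1.
have e0 : e != 0 by apply: contra_eq_neq ee => ->; rewrite mul0r eq_sym oner_neq0.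
have gen a b : 0 <= a -> 0 <= b -> a *: val p + b *: ((e * e') *: val q) != 0 ->
    liftset Omega (a *: val p + b *: ((e * e') *: val q)).
  move=> a0 b0; have -> : a *: val p + b *: ((e * e') *: val q) =
      e *: (a *: (e *: val p) + b *: (e' *: val q)).
    rewrite scalerDr !scalerA (_ : e * a * e = a); last by rewrite mulrAC ee mul1r.
    by congr (_ + _ *: _); ring.
  rewrite scaler_eq0 negb_or => /andP[_ nz].
  by apply: liftsetZ => //; exact: main.
have : e * e' = 1 \/ e * e' = -1.
  by case: eP => ->; case: eP' => ->; rewrite ?mulrNN ?mulr1 ?mul1r; [left|right|right|left].
case=> eE; rewrite eE in gen; [left|right] => a b a0 b0 nz.
  by have := gen _ _ a0 b0; rewrite scale1r; apply.
by have := gen _ _ a0 b0; rewrite scaleN1r; apply.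
Qed.

Lemma liftset_no_line Omega x y :
  (forall u v, proj_pt u != proj_pt v -> ~ (proj_line u v `<=` closure Omega)) ->
  x != 0 -> y != 0 -> (forall c, y != c *: x) ->
  ~ (forall s t, s *: x + t *: y != 0 -> exists2 u : nzvec R n, val u = s *: x + t *: y & closure Omega (proj_pt u)).
Proof.
move=> noline x0 y0 yx h; apply: (noline (mknz y0) (mknz x0)).
  apply/eqP => /projP[c c0 /= E]; by have /eqP := yx c.
move=> _ [w [s [t /= wE]] <-]; have := h t s.
by rewrite addrC -wE => /(_ (nz_neq0 w))[u /val_inj ->].
Qed.

(* [liftset Omega] has two connected components, swapped by negation; this is
   the one containing [x0]. *)
Definition halfcone Omega x0 : set 'cV[R]_N :=
  [set w | liftset Omega w /\ segm (liftset Omega) x0 w].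

Section Half.
Variables (Omega : set (projspace R n)) (x0 : 'cV[R]_N).
Hypothesis pcO : properly_convex Omega.
Hypothesis Ox0 : liftset Omega x0.
Local Notation X := (liftset Omega).
Local Notation C := (halfcone Omega x0).

Let oO : open Omega. Proof. by have [] := pcO. Qed.
Let cO : proj_convex Omega. Proof. by have [] := pcO. Qed.

(** If both segments lie over [Omega], so does every nonzero combination of [x] and [y]; were these
    independent, [Omega] would contain a projective line. *)
Lemma liftset_line x y : X x -> X y -> wsegm X x y -> wsegm X x (- y) ->
  exists2 c, c != 0 & y = c *: x.
Proof.
move=> Xx Xy xy xny; have x00 := liftset0 Xx; have y0 := liftset0 Xy.
apply: contrapT => no; have [_ _ _ noline] := pcO.
have yx c : y != c *: x.
  apply/eqP => E; apply: no; exists c => //; apply: contraNneq y0 => c0.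
  by rewrite E c0 scale0r.
apply: (liftset_no_line noline x00 y0 yx) => s t nz.
suff [u uE Ou] : X (s *: x + t *: y).
  by exists u => //; exact: subset_closure.
have pos s' t' : 0 <= s' -> s' *: x + t' *: y != 0 -> X (s' *: x + t' *: y).
  move=> s0 nz'; have [t0|t0] := leP 0 t'; first exact: xy.
  have := xny s' (- t') s0; rewrite scalerN scaleNr opprK; apply=> //; lra.
have [s0|s0] := leP 0 s; first exact: pos.
have -> : s *: x + t *: y = (-1) *: ((- s) *: x + (- t) *: y).
  by rewrite scaleN1r !scaleNr opprD !opprK.
apply: liftsetZ; first by rewrite oppr_eq0 oner_eq0.
apply: pos; first lra.
by rewrite !scaleNr -opprD oppr_eq0.
Qed.

(* The two ways in which a segment from [x0] to [w] or [- w] can pass through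
   the origin are excluded or harmless since then [w] is a multiple of [x0]. *)
Lemma halfcone_total w : X w -> C w \/ C (- w).
Proof.
move=> Xw; have Xnw : X (- w) by rewrite -scaleN1r; apply: liftsetZ => //; rewrite oppr_eq0 oner_eq0.
have x00 := liftset0 Ox0; have w0 := liftset0 Xw.
have [[c wE]|dep] := pselect (exists c, w = c *: x0).
  have sg d : 0 < d -> C (d *: x0).
    move=> d0; split; first by apply: liftsetZ => //; exact: lt0r_neq0.
    move=> s t s0 t0 st; rewrite scalerA -scalerDl; apply: liftsetZ => //.
    by apply: lt0r_neq0; nra.
  have [c0|c0|c0] := ltgtP c 0.
  - by right; rewrite wE -scaleNr; apply: sg; lra.
  - by left; rewrite wE; exact: sg.
  - by move: w0; rewrite wE c0 scale0r eqxx.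
have key s t : s *: x0 + t *: w = 0 -> t = 0.
  move=> E; apply/eqP; apply: contraPT dep => t0 dep; apply: dep; exists (- (s / t)).
  apply: (scalerI t0); rewrite scalerA mulrN mulrCA mulfV// mulr1 scaleNr.
  by apply/eqP; rewrite -addr_eq0 addrC E.
have up y : (forall s t, s *: x0 + t *: y = 0 -> t = 0) -> X y -> wsegm X x0 y -> C y.
  move=> keyy Xy h; split=> // s t s0 t0 st; apply: h => //; apply/eqP => E.
  have t00 := keyy _ _ E; move: E st; rewrite t00 scale0r !addr0 => /eqP.
  by rewrite scaler_eq0 (negbTE x00) orbF => /eqP ->; rewrite ltxx.
have [h|h] := liftset_segm cO Ox0 Xw; [left|right]; apply: up => // s t.
by rewrite scalerN -scaleNr => /key /eqP; rewrite oppr_eq0 => /eqP.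
Qed.

Lemma halfcone_excl w : C w -> ~ C (- w).
Proof.
move=> [Xw Cw] [Xnw Cnw]; have x00 := liftset0 Ox0; have w0 := liftset0 Xw.
have ws y : segm X x0 y -> wsegm X x0 y.
  move=> h s t s0 t0 nz; apply: h => //; rewrite lt_def addr_ge0// andbT.
  apply: contraNneq nz => /eqP; rewrite paddr_eq0// => /andP[/eqP -> /eqP ->].
  by rewrite !scale0r addr0.
have [c c0 wE] := liftset_line Ox0 Xw (ws _ Cw) (ws _ Cnw).
have [c1|c1] := ltP 0 c.
  have /liftset0 : X (c *: x0 + 1 *: - w) by apply: Cnw; lra.
  by rewrite scale1r wE subrr eqxx.
have /liftset0 : X ((- c) *: x0 + 1 *: w) by apply: Cw; lra.
by rewrite scale1r wE scaleNr addNr eqxx.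
Qed.

Lemma halfconeZ w a : 0 < a -> C w -> C (a *: w).
Proof.
move=> a0 [Xw Cw]; split; first by apply: liftsetZ => //; exact: lt0r_neq0.
move=> s t s0 t0 st; rewrite scalerA; apply: Cw => //; first by rewrite mulr_ge0// ltW.
by nra.
Qed.

Lemma halfcone_x0 : C x0.
Proof.
split=> // s t s0 t0 st; rewrite -scalerDl; apply: liftsetZ => //.
exact: lt0r_neq0.
Qed.

(** A compact segment inside an open set survives small perturbations of its end. Compactness is
    used through an ultrafilter on bad perturbations and bad parameters, whose limit would be a
    point of the segment outside the open set. *)
Lemma halfcone_open w : C w -> exists2 e, 0 < e & forall w', nrm (w' - w) < e -> C w'.
Proof.
move=> [Xw Cw]; apply: contrapT => no.
have [e0 e00 Xe0] := liftset_open oO Xw.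
have bad k : exists p : 'cV[R]_N * R, [/\ nrm (p.1 - w) < k.+1%:R^-1, 0 <= p.2 <= 1 &
    X p.1 -> ~ X ((1 - p.2) *: x0 + p.2 *: p.1)].
  apply: contrapT => nok; apply: no; exists (Num.min e0 k.+1%:R^-1).
    by rewrite lt_min e00 invr_gt0 ltr0n.
  move=> w'; rewrite lt_min => /andP[/Xe0 Xw' w'k]; split=> // s t s0 t0 st.
  apply: contrapT => nX; apply: nok; exists (w', t / (s + t)); split=> //=.
    by rewrite divr_ge0 ?addr_ge0//= ler_pdivrMr// mul1r lerDr.
  move=> _ /(liftsetZ (lt0r_neq0 st)); rewrite scalerDr !scalerA mulrBr mulr1 mulrCA mulfV ?lt0r_neq0//.
  by rewrite mulr1 addrK.
have [p pP] := choice bad.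
have [U [UU ooU]] := ultraFilterLemma (eventually_filter).
have PU : ProperFilter U by exact: ultra_proper.
have pw : mcvg U (fun k => (p k).1) w.
  apply/mcvgP => e e1; apply: ooU.
  have /cvgrPdist_lt/(_ _ e1) := @cvg_harmonic R; apply: filterS => k.
  rewrite sub0r normrN ger0_norm ?invr_ge0// => ke.
  by have [/lt_trans h _ _] := pP k; apply: h.
have [t pt] : exists t : R, (fun k => (p k).2) @ U --> t.
  apply: (@ultra_cvg _ _ _ _ 1) => //; apply: nearW => k.
  by have [_ /andP[h1 h2] _] := pP k; rewrite ger0_norm.
have t01 : 0 <= t <= 1.
  apply/andP; split.
    by apply: (cvgr_to_ge pt); apply: nearW => k; have [_ /andP[]] := pP k.
  by apply: (cvgr_to_le pt); apply: nearW => k; have [_ /andP[]] := pP k.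
have lim : mcvg U (fun k => (1 - (p k).2) *: x0 + (p k).2 *: (p k).1) ((1 - t) *: x0 + t *: w).
  apply: mcvgD; last exact: mcvgZ.
  by apply: mcvgZ; [apply: cvgB => //; exact: cvg_cst|exact: mcvg_cst].
have Xt : X ((1 - t) *: x0 + t *: w) by case/andP: t01 => t0 t1; apply: Cw; lra.
have [e1 e10 Xe1] := liftset_open oO Xt.
have UF : Filter U by exact: filter_filter.
move/mcvgP: lim => /(_ e1 e10) h1; move/mcvgP: pw => /(_ e0 e00) h2.
have /filter_ex[k [k1 k2]] : \forall k \near U,
    nrm ((1 - (p k).2) *: x0 + (p k).2 *: (p k).1 - ((1 - t) *: x0 + t *: w)) < e1 /\ nrm ((p k).1 - w) < e0.
  exact: filterI.
by have [_ _ /(_ (Xe0 _ k2))] := pP k; apply; exact: Xe1.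
Qed.

End Half.
End ConeLift.

Section HalfConeConvex.
Variables (R : realType) (n : nat).
Local Notation N := n.+1.
Implicit Types (x y z w : 'cV[R]_N).

Variables (Omega : set (projspace R n)) (x0 : 'cV[R]_N).
Hypothesis pcO : properly_convex Omega.
Hypothesis Ox0 : liftset Omega x0.
Local Notation X := (liftset Omega).
Local Notation C := (halfcone Omega x0).

(** The parameters landing in [C] and those landing in [- C] are disjoint open sets covering the
    interval, which is connected. *)
Lemma halfcone_path y z : C y -> (forall t, 0 <= t <= 1 -> X ((1 - t) *: y + t *: z)) -> C z.
Proof.
move=> Cy Xt; pose p (t : R) := (1 - t) *: y + t *: z.
have pd t t' : nrm (p t' - p t) = `|t' - t| * nrm (z - y).
  rewrite -nrmZ; congr nrm; apply/matrixP => i j; rewrite /p !mxE; ring.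
have openp (e : R) : open [set t | C (e *: p t)].
  rewrite openE => t Ct; have [d d0 dC] := halfcone_open pcO Ct.
  have m0 : 0 < 1 + `|e| * nrm (z - y) by have := nrm_ge0 (z - y); have := normr_ge0 e; nra.
  apply/nbhs_ballP; exists (d / (1 + `|e| * nrm (z - y))); first exact: divr_gt0.
  move=> t'; rewrite -ball_normE /= distrC => tt'; apply: dC.
  rewrite -scalerBr nrmZ pd mulrCA; move: tt'; rewrite ltr_pdivlMr//.
  by have := normr_ge0 (t' - t); lra.
pose B := `[0, 1]%classic `&` [set t | C (1 *: p t)].
have BE : B = `[0, 1]%classic.
  apply: (@segment_connected R 0 1 B).
  - exists 0; split; first by rewrite /= in_itv /= lexx ler01.
    by rewrite /= scale1r /p subr0 scale1r scale0r addr0.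
  - by exists [set t | C (1 *: p t)].
  - exists (~` [set t | C (-1 *: p t)]); first exact: open_closedC.
    rewrite predeqE => t; split=> -[t01 Ct]; split=> //=.
      rewrite scaleN1r; move: Ct; rewrite /= scale1r; exact: halfcone_excl.
    have Xp : X (p t) by apply: Xt; move: t01; rewrite /= in_itv.
    have [|Cn] := halfcone_total pcO Ox0 Xp; first by rewrite scale1r.
    by case: Ct; rewrite /= scaleN1r.
have : B 1 by rewrite BE /= in_itv /= ler01 lexx.
by move=> [_]; rewrite /= scale1r /p subrr scale0r add0r scale1r.
Qed.

(** Of the two segments offered by [liftset_segm], the one from [y] to [- z] would carry [- z] into
    the half cone by [halfcone_path]. On the other one, every point is reached from [y] along a
    subsegment. Proportional vectors are treated apart, since there a segment may meet the
    origin. *)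
Lemma halfcone_convex y z : C y -> C z -> forall t, 0 <= t <= 1 -> C ((1 - t) *: y + t *: z).
Proof.
move=> Cy Cz; have [Xy _] := Cy; have [Xz _] := Cz.
have y0 := liftset0 Xy; have z0 := liftset0 Xz.
have [[c zE]|dep] := pselect (exists c, z = c *: y).
  have c0 : 0 < c.
    rewrite ltNge; apply/negP => c0; have {c0} [c0|c0] : c < 0 \/ c = 0.
      by move: c0; rewrite le_eqVlt => /orP[/eqP ->|->]; [right|left].
      apply: (halfcone_excl pcO Ox0 Cz); rewrite zE -scaleNr.
      by apply: halfconeZ => //; lra.
    by move: z0; rewrite zE c0 scale0r eqxx.
  move=> t /andP[t0 t1]; rewrite zE scalerA -scalerDl; apply: halfconeZ => //.
  have [->|tn] := eqVneq t 0; first by lra.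
  have : 0 < t by rewrite lt_def tn.
  nra.
have key s t : s *: y + t *: z = 0 -> t = 0.
  move=> E; apply/eqP; apply: contraPT dep => t0 dep; apply: dep; exists (- (s / t)).
  apply: (scalerI t0); rewrite scalerA mulrN mulrCA mulfV// mulr1 scaleNr.
  by apply/eqP; rewrite -addr_eq0 addrC E.
have nz (e : R) t : e != 0 -> (1 - t) *: y + (t * e) *: z != 0.
  move=> e0; apply/eqP => E; have := key _ _ E => /eqP; rewrite mulf_eq0 (negbTE e0) orbF.
  by move=> /eqP t0; move: E; rewrite t0 mul0r scale0r addr0 subr0 scale1r => /eqP; apply/negP.
have n1 : -1 != 0 :> R by rewrite oppr_eq0 oner_eq0.
have [_ _ cO _] := pcO.
have [h|h] := liftset_segm cO Xy Xz; last first.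
  exfalso; apply: (halfcone_excl pcO Ox0 Cz); apply: (halfcone_path Cy) => t /andP[t0 t1].
  apply: h => //; first lra.
  by have := nz (-1) t n1; rewrite mulrN1 scaleNr scalerN.
move=> t /andP[t0 t1]; apply: (halfcone_path Cy) => s /andP[s0 s1].
have -> : (1 - s) *: y + s *: ((1 - t) *: y + t *: z) = (1 - s * t) *: y + (s * t) *: z.
  by apply/matrixP => i j; rewrite !mxE; ring.
apply: h; [nra|nra|].
by have := nz 1 (s * t) (oner_neq0 R); rewrite mulr1.
Qed.

Lemma halfconeD y z : C y -> C z -> C (y + z).
Proof.
move=> Cy Cz; have := halfcone_convex Cy Cz; move=> /(_ (1 / 2)) h.
have -> : y + z = 2 *: ((1 - 1 / 2) *: y + (1 / 2) *: z).
  by apply/matrixP => i j; rewrite !mxE; field.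
by apply: halfconeZ => //; apply: h; lra.
Qed.

Definition closecone : set 'cV[R]_N :=
  [set x | forall e, 0 < e -> exists2 y, C y & nrm (x - y) < e].

Lemma subset_closecone y : C y -> closecone y.
Proof. by move=> Cy e e0; exists y; rewrite ?subrr ?nrm0. Qed.

Lemma closeconeZ a x : 0 <= a -> closecone x -> closecone (a *: x).
Proof.
move=> a0 Cx e e0; have [->|an] := eqVneq a 0.
  have := halfcone_x0 Ox0 => Cx0.
  have m0 : 0 < 1 + nrm x0 by have := nrm_ge0 x0; lra.
  exists ((e / (1 + nrm x0)) *: x0); first by apply: halfconeZ => //; exact: divr_gt0.
  rewrite scale0r sub0r nrmN nrmZ ger0_norm ?divr_ge0 ?ltW//.
  by rewrite mulrAC ltr_pdivrMr// ltr_pM2l//; lra.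
have ap : 0 < a by rewrite lt_def an.
have [y Cy xy] := Cx (e / a) (divr_gt0 e0 ap).
exists (a *: y); first exact: halfconeZ.
by rewrite -scalerBr nrmZ ger0_norm// mulrC -ltr_pdivlMr.
Qed.

Lemma halfcone_add_close y w : C y -> closecone w -> C (y + w).
Proof.
move=> Cy Cw; have [e e0 eC] := halfcone_open pcO Cy; have [z Cz wz] := Cw e e0.
have -> : y + w = (y + (w - z)) + z by rewrite -addrA subrK.
by apply: halfconeD => //; apply: eC; rewrite addrC addKr.
Qed.

Lemma closecone_closure (u : nzvec R n) : closecone (val u) -> closure Omega (proj_pt u).
Proof.
move=> Cu B nB; have : nbhs u (@proj_pt R n @^-1` B) by exact: proj_pt_continuous.
move=> /sub_nbhsP[e e0 eB]; have [y [[v vy Ov] _] uy] := Cu e e0.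
exists (proj_pt v); split=> //; apply: eB; rewrite nrmBC.
by rewrite vy.
Qed.

Lemma closecone_pcone : pcone closecone.
Proof.
have C0 := halfcone_x0 Ox0; have x00 := liftset0 Ox0.
split.
- move=> x h e e0; have e20 : 0 < e / 2 by lra.
  have [y Cy xy] := h _ e20; have [z Cz yz] := Cy _ e20.
  by exists z => //; apply: le_lt_trans (nrm_triangle _ y _) _; lra.
- move=> x y Cx Cy e e0; have e20 : 0 < e / 2 by lra.
  have [x' Cx' xx'] := Cx _ e20; have [y' Cy' yy'] := Cy _ e20.
  exists (x' + y'); first exact: halfconeD.
  by rewrite opprD addrACA; apply: le_lt_trans (nrmD _ _) _; lra.
- by move=> a x; exact: closeconeZ.
(* Adding closure points to the open cone stays in it, so the affine line through [x0] in direction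
   [w] lies in [C]; this puts a projective line into the closure of [Omega]. *)
- move=> w Cw Cnw; apply: contrapT => /eqP w0.
  have all t : C (x0 + t *: w).
    have [t0|t0] := leP 0 t; apply: halfcone_add_close => //; first exact: closeconeZ.
    by rewrite -[t]opprK scaleNr -scalerN; apply: closeconeZ => //; lra.
  have dep c : w != c *: x0.
    apply/eqP => wE; have c0 : c != 0 by apply: contraNneq w0 => c0; rewrite wE c0 scale0r.
    have [/liftset0 + _] := all (- c^-1).
    by rewrite wE scalerA mulNr mulVf// scaleN1r subrr eqxx.
  have [_ _ _ noline] := pcO.
  apply: (liftset_no_line noline x00 w0 dep) => s t nz.
  exists (mknz nz) => //; have [s0|s0] := eqVneq s 0.
    apply: closecone_closure; rewrite /= s0 scale0r add0r.
    have [t0|t0] := leP 0 t; first exact: closeconeZ.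
    by rewrite -[t]opprK scaleNr -scalerN; apply: closeconeZ => //; lra.
  apply: subset_closure; apply/liftset_nz => /=.
  have -> : s *: x0 + t *: w = s *: (x0 + (t / s) *: w).
    by rewrite scalerDr scalerA mulrCA mulfV// mulr1.
  by apply: liftsetZ => //; have [] := all (t / s).
- exists x0; have [e e0 eC] := halfcone_open pcO C0; exists e => // w we.
  by apply: subset_closecone; exact: eC.
Qed.

End HalfConeConvex.

(** * The linear representation of a holonomy *)

Section HolonomyCone.
Variables (R : realType) (n : nat) (G : groupType).
Local Notation N := n.+1.
Implicit Types (x y z w : 'cV[R]_N).

Definition preserves (A : G -> 'M[R]_N) (C : set 'cV[R]_N) := forall g c, C c -> C (A g *m c).

Lemma lift1_act Omega (a : pgl R n) (X : 'M[R]_N) x : lift1 a X ->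
  pgl_act a @` Omega = Omega -> liftset Omega x -> liftset Omega (X *m x).
Proof.
move=> [_ [h <-]] inv [u <- Ou]; exists (gl_act (mkgl h) u) => //.
by rewrite -pgl_act_proj -inv; exists (proj_pt u).
Qed.

(** The sign of each lift is chosen so that [x0] stays in the half cone [C]. As [C] and [- C] are
    disjoint, this removes the sign ambiguity in products and gives a genuine linear
    representation. *)
Lemma holonomy_conerep (rho : homspace R n G) : holonomies rho ->
  (exists A C, [/\ hommx A, homlift rho A, pcone C, preserves A C &
     faithfulmx A /\ exists2 d, 0 < d & discretemx A d]) /\
  forall (g : G) m, (g ^+ m.+1)%g = 1%g -> g = 1%g.
Proof.
move=> [injr discr [Omega [pcO invO freeO]]].
have [[p Op] oO cO _] := pcO.
pose x0 : 'cV[R]_N := val (repr p).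
have Ox0 : liftset Omega x0 by apply/liftset_nz; rewrite proj_repr.
pose C := halfcone Omega x0.
have Cx0 : C x0 := halfcone_x0 Ox0.
have inv g X x : lift1 (homval rho g) X -> liftset Omega x -> liftset Omega (X *m x).
  by move=> lX; apply: lift1_act lX (invO g).
have exA g : exists X : 'M[R]_N, lift1 (homval rho g) X /\ C (X *m x0).
  have [X lX] := lift1_ex (homval rho g).
  have [CX|CX] := halfcone_total pcO Ox0 (inv g X x0 lX Ox0); first by exists X.
  by exists (- X); split; [exact: lift1N|rewrite mulNmx].
have [A AP] := choice exA.
have lA : homlift rho A by move=> g; have [] := AP g.
have AC g y : C y -> C (A g *m y).
  move=> Cy; have [_ CA] := AP g; apply: (halfcone_path pcO Ox0 CA) => t t01.
  rewrite !scalemxAr -mulmxDr; apply: inv (lA g) _.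
  by have [] := halfcone_convex pcO Ox0 Cx0 Cy t01.
have AM g h : A (g * h)%g = A g *m A h.
  have [//|E] := homliftM g h lA.
  have [_ CA] := AP (g * h)%g; exfalso; apply: (halfcone_excl pcO Ox0 CA).
  by rewrite E mulNmx opprK -mulmxA; exact/AC/AC.
have A1 : A 1%g = 1%:M.
  have u1 : A 1%g \in unitmx by apply: unit_det1; have [] := lA 1%g.
  by rewrite -[LHS](mulKmx u1) -AM mulg1 mulVmx.
have hA : hommx A by [].
have inj1 g : homval rho g = 1%g -> g = 1%g.
  by move=> g1; apply: injr; rewrite -/(homval rho g) g1 -(homval1 rho).
split; last first.
  (* The orbit sum of a torsion element is a fixed vector in the cone, contradicting freeness unless
     the element is trivial. *)
  move=> g m gm; pose v := \sum_(j < m.+1) A (g ^+ j)%g *m x0.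
  have Cv : C v.
    rewrite /v; elim: (m) => [|k IH]; first by rewrite big_ord1; exact: AC.
    by rewrite big_ord_recr /=; apply: halfconeD IH _ => //; exact: AC.
  have Av : A g *m v = v.
    rewrite /v mulmx_sumr; under eq_bigr do rewrite mulmxA -AM -expgS.
    by rewrite big_ord_recr big_ord_recl /= gm expg0 addrC.
  have [Xv _] := Cv; have [dA [h Ah]] := lA g.
  apply/inj1/(freeO g (proj_pt (mknz (liftset0 Xv)))).
    by apply/liftset_nz.
  rewrite -/(homval rho g) -Ah pgl_act_proj; congr proj_pt.
  by apply: val_inj; rewrite /= Av.
exists A, (closecone Omega x0); split=> //.
- exact: closecone_pcone.
- move=> g c Cc e e0; have m0 : 0 < 1 + nrm (A g) by have := nrm_ge0 (A g); lra.
  have [y Cy cy] := Cc _ (divr_gt0 e0 m0); exists (A g *m y); first exact: AC.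
  rewrite -mulmxBr; apply: le_lt_trans (nrmM _ _) _.
  move: cy; rewrite ltr_pdivlMr// => cy; apply: le_lt_trans cy.
  by rewrite mulrC ler_wpM2l ?nrm_ge0//; lra.
split.
  by move=> g Ag; apply: inj1; apply: lift1_mx1; rewrite -Ag.
have [_ [V V1 VE]] := discr _ (imageT (val rho : G -> pgl R n) 1%g).
have : nbhs (gl1 R n) (@projgl R n @^-1` V).
  apply: projgl_continuous; rewrite -[projgl _]/(1%g : pgl R n) -(homval1 rho).
  exact: V1.
move=> /sub_nbhsP[e e0 eV]; exists e => // g g1; rewrite leNgt; apply/negP => ge.
have [_ [h Ah]] := lA g; have Vg : V (homval rho g).
  by rewrite -Ah; apply: eV.
have : [set (val rho : G -> pgl R n) 1%g] (homval rho g).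
  by rewrite -VE; split=> //; exists g.
move=> /= E; move: g1; rewrite (injr g 1%g) ?eqxx//.
Qed.

End HolonomyCone.

(** * Limits of invariant cones *)

Section FatCones.
Variables (R : realType) (n : nat).
Local Notation N := n.+1.
Implicit Types (C : set 'cV[R]_N) (x y w : 'cV[R]_N).

(** The shape produced by [pcone_position], by conditions that survive limits: the basis vectors
    force an interior, the two inequalities force pointedness, so a limit cone cannot degenerate. *)
Definition fatcone C :=
  [/\ forall x y, C x -> C y -> C (x + y),
      forall a x, 0 <= a -> C x -> C (a *: x),
      forall j, C (delta_mx j 0) &
      forall x, C x -> 0 <= entrysum x /\ forall j, x j 0 <= entrysum x].

Lemma entrysumD x y : entrysum (x + y) = entrysum x + entrysum y.
Proof. by rewrite -big_split; apply: eq_bigr => i _; rewrite mxE. Qed.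

Lemma entrysumZ a x : entrysum (a *: x) = a * entrysum x.
Proof. by rewrite mulr_sumr; apply: eq_bigr => i _; rewrite mxE. Qed.

Lemma entrysumN x : entrysum (- x) = - entrysum x.
Proof. by rewrite -scaleN1r entrysumZ mulN1r. Qed.

Lemma entrysum_delta (j : 'I_N) : entrysum (delta_mx j 0 : 'cV[R]_N) = 1.
Proof.
rewrite /entrysum (bigD1 j)//= mxE !eqxx big1 ?addr0// => i ij.
by rewrite mxE (negbTE ij).
Qed.

Lemma entrysum_nrm x : `|entrysum x| <= nrm x.
Proof.
apply: le_trans (ler_norm_sum _ _ _) _; apply: ler_sum => i _.
by rewrite big_ord1.
Qed.

Lemma fatcone_nrm C x : fatcone C -> C x -> nrm x <= N%:R * (N%:R * entrysum x).
Proof.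
move=> [_ _ _ fC] Cx; have [s0 sj] := fC x Cx.
have -> : N%:R * (N%:R * entrysum x) = \sum_(i < N) (N%:R * entrysum x).
  by rewrite sumr_const card_ord mulr_natl.
rewrite /nrm; apply: ler_sum => i _; rewrite big_ord1 ler_norml; apply/andP; split; last first.
  by apply: le_trans (sj i) _; rewrite ler_peMl// ler1n.
have : entrysum x - x i 0 <= \sum_(j < N | j != i) entrysum x.
  have -> : entrysum x - x i 0 = \sum_(j < N | j != i) x j 0.
    by rewrite /entrysum (bigD1 i)//= addrAC subrr add0r.
  by apply: ler_sum => j _; exact: sj.
have : \sum_(j < N | j != i) entrysum x <= \sum_(j < N) entrysum x.
  by rewrite [leRHS](bigD1 i)//= lerDr.
rewrite [X in _ <= X -> _]sumr_const card_ord -mulr_natl; lra.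
Qed.

Lemma fatcone_entrysum0 C x : fatcone C -> C x -> entrysum x <= 0 -> x = 0.
Proof.
move=> fC Cx s0; apply: nrm_eq0; apply: le_trans (fatcone_nrm fC Cx) _.
by rewrite mulr_ge0_le0// mulr_ge0_le0.
Qed.

Lemma fatcone_pos C x : fatcone C -> (forall j, 0 <= x j 0) -> C x.
Proof.
move=> [CD CZ Cd _] x0.
have -> : x = \sum_j x j 0 *: delta_mx j 0.
  apply/colP => i; rewrite summxE (bigD1 i)//= !mxE !eqxx mulr1 big1 ?addr0// => j ji.
  by rewrite !mxE eq_sym (negbTE ji) mulr0.
have C0 : C 0 by rewrite -(scale0r (delta_mx ord0 0)); apply: CZ.
by elim/big_ind: _ => // i _; apply: CZ.
Qed.

(** The columns of [A] lie in [C], where the norm is controlled by the linear functional [entrysum],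
    and a linear functional adds up exactly over the columns. *)
Lemma fatcone_mx C (A : 'M[R]_N) : fatcone C -> (forall c, C c -> C (A *m c)) ->
  nrm A <= N%:R * (N%:R * entrysum (A *m one_cv R n)).
Proof.
move=> fC AC; have [_ _ Cd _] := fC.
have -> : nrm A = \sum_j nrm (col j A).
  by rewrite /nrm exchange_big; apply: eq_bigr => j _; apply: eq_bigr => i _; rewrite big_ord1 mxE.
have -> : entrysum (A *m one_cv R n) = \sum_j entrysum (col j A).
  rewrite sum_cols /entrysum exchange_big /=; apply: eq_bigr => i _.
  by rewrite summxE.
rewrite !mulr_sumr; apply: ler_sum => j _; apply: fatcone_nrm fC _.
by rewrite colE; apply: AC.
Qed.

End FatCones.

Section LimitCone.
Variables (R : realType) (n : nat) (T : Type) (U : set_system T).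
Local Notation N := n.+1.
Implicit Types (x y w : 'cV[R]_N).
Variable C : T -> set 'cV[R]_N.
Hypothesis UU : UltraFilter U.
Hypothesis fatC : \forall t \near U, fatcone (C t).

(** The lower limit of the cones in the sense of Kuratowski, along the ultrafilter. *)
Definition limcone : set 'cV[R]_N :=
  [set x | forall e, 0 < e -> \forall t \near U, exists2 y, C t y & nrm (x - y) < e].

Lemma limcone_fat : fatcone limcone.
Proof.
have UF : Filter U by exact: filter_filter.
split.
- move=> x y Lx Ly e e0; have e20 : 0 < e / 2 by lra.
  have h1 := Lx _ e20; have h2 := Ly _ e20.
  near=> t; have [CD _ _ _] : fatcone (C t) by near: t.
  have [x' Cx' xx'] : exists2 x', C t x' & nrm (x - x') < e / 2 by near: t.
  have [y' Cy' yy'] : exists2 y', C t y' & nrm (y - y') < e / 2 by near: t.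
  exists (x' + y'); first exact: CD.
  by rewrite opprD addrACA; apply: le_lt_trans (nrmD _ _) _; lra.
- move=> a x a0 Lx e e0; have a1 : 0 < 1 + a by lra.
  have h := Lx _ (divr_gt0 e0 a1).
  near=> t; have [_ CZ _ _] : fatcone (C t) by near: t.
  have [y Cy xy] : exists2 y, C t y & nrm (x - y) < e / (1 + a) by near: t.
  exists (a *: y); first exact: CZ.
  rewrite -scalerBr nrmZ ger0_norm//; move: xy; rewrite ltr_pdivlMr// => /(le_lt_trans _); apply.
  by have := nrm_ge0 (x - y); lra.
- move=> j e e0; apply: filterS fatC => t [_ _ Cd _].
  by exists (delta_mx j 0); rewrite ?subrr ?nrm0.
- move=> x Lx; split.
    apply/ler_addgt0Pl => e e0; have h := Lx e e0.
    have /filter_ex[t [[_ _ _ /[swap] -[y /[swap]]]]] : \forall t \near U,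
        fatcone (C t) /\ exists2 y, C t y & nrm (x - y) < e by exact: filterI.
    move=> xy Cy /(_ _ Cy)[y0 _].
    have := entrysum_nrm (x - y); rewrite entrysumD entrysumN ler_norml => /andP[].
    lra.
  move=> j; apply/ler_addgt0Pl => e e0; have e20 : 0 < e / 2 by lra.
  have h := Lx _ e20.
  have /filter_ex[t [[_ _ _ /[swap] -[y /[swap]]]]] : \forall t \near U,
      fatcone (C t) /\ exists2 y, C t y & nrm (x - y) < e / 2 by exact: filterI.
  move=> xy Cy /(_ _ Cy)[_ /(_ j) yj].
  have := entrysum_nrm (x - y); rewrite entrysumD entrysumN ler_norml => /andP[h1 _].
  have := le_trans (ler_norm _) (entry_le_nrm (x - y) j 0); rewrite !mxE.
  lra.
Unshelve. all: end_near. Qed.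

Lemma limcone_closed x : ~ limcone x -> exists2 e, 0 < e & forall w, nrm (w - x) < e -> ~ limcone w.
Proof.
have UF : Filter U by exact: filter_filter.
move=> nL; apply: contrapT => no; apply: nL => e e0; have e20 : 0 < e / 2 by lra.
have [w [wx Lw]] : exists w, nrm (w - x) < e / 2 /\ limcone w.
  apply: contrapT => now; apply: no; exists (e / 2) => // w wx Lw.
  by apply: now; exists w.
apply: filterS (Lw _ e20) => t [y Cy wy]; exists y => //.
by apply: le_lt_trans (nrm_triangle _ w _) _; rewrite nrmBC; lra.
Qed.

Lemma limcone_preserved (A : T -> 'M[R]_N) L : (\forall t \near U, forall c, C t c -> C t (A t *m c)) ->
  mcvg U A L -> forall c, limcone c -> limcone (L *m c).
Proof.
move=> AC AL c Lc e e0; have UF : Filter U by exact: filter_filter.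
pose B := 2 + nrm L + nrm c; have B2 : 2 <= B by have := nrm_ge0 L; have := nrm_ge0 c; rewrite /B; lra.
have d0 : 0 < Num.min 1 (e / (2 * B)) by rewrite lt_min ltr01 divr_gt0//; lra.
have h1 := Lc _ d0; move/mcvgP: AL => /(_ _ d0) h2.
near=> t; have ACt : forall c, C t c -> C t (A t *m c) by near: t.
have : nrm (A t - L) < Num.min 1 (e / (2 * B)) by near: t.
have [y Cy] : exists2 y, C t y & nrm (c - y) < Num.min 1 (e / (2 * B)) by near: t.
rewrite !lt_min => /andP[cy1 cy2] /andP[AL1 AL2].
exists (A t *m y); first exact: ACt.
have -> : L *m c - A t *m y = A t *m (c - y) - (A t - L) *m c.
  by rewrite mulmxBr mulmxBl opprB [RHS]addrC addrA subrK.
apply: le_lt_trans (nrmB _ _) _.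
have nA : nrm (A t) <= B.
  rewrite -[A t](subrK L); apply: le_trans (nrmD _ _) _; have := nrm_ge0 c; rewrite /B; lra.
have p1 : nrm (A t *m (c - y)) <= B * nrm (c - y).
  by apply: le_trans (nrmM _ _) _; apply: ler_wpM2r => //; exact: nrm_ge0.
have p2 : nrm ((A t - L) *m c) <= nrm (A t - L) * B.
  apply: le_trans (nrmM _ _) _; apply: ler_wpM2l; first exact: nrm_ge0.
  by have := nrm_ge0 L; rewrite /B; lra.
have B0 : 0 < 2 * B by lra.
rewrite ltr_pdivlMr// in cy2; rewrite ltr_pdivlMr// in AL2; lra.
Unshelve. all: end_near. Qed.

End LimitCone.

(** * The properly convex set of a fat cone *)

Section ConeInterior.
Variables (R : realType) (n : nat).
Local Notation N := n.+1.
Implicit Types (x y w : 'cV[R]_N).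
Variable C : set 'cV[R]_N.
Hypothesis fC : fatcone C.
Hypothesis clC : forall x, ~ C x -> exists2 e, 0 < e & forall w, nrm (w - x) < e -> ~ C w.

Let CD : forall x y, C x -> C y -> C (x + y). Proof. by case: fC. Qed.
Let CZ : forall a x, 0 <= a -> C x -> C (a *: x). Proof. by case: fC. Qed.

Definition coneint : set 'cV[R]_N :=
  [set x | exists2 e, 0 < e & forall w, nrm (w - x) < e -> C w].

Definition projint : set (projspace R n) :=
  [set p | exists2 u : nzvec R n, proj_pt u = p & coneint (val u)].

Lemma coneint_sub x : coneint x -> C x.
Proof. by move=> [e e0]; apply; rewrite subrr nrm0. Qed.

Lemma coneintZ a x : 0 < a -> coneint x -> coneint (a *: x).
Proof.
move=> a0 [e e0 eC]; exists (a * e); first exact: mulr_gt0.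
move=> w wx; have -> : w = a *: (a^-1 *: w) by rewrite scalerA mulfV ?scale1r// lt0r_neq0.
apply: CZ; first exact: ltW.
apply: eC; have -> : a^-1 *: w - x = a^-1 *: (w - a *: x).
  by rewrite scalerBr scalerA mulVf ?scale1r// lt0r_neq0.
by rewrite nrmZ gtr0_norm ?invr_gt0// ltr_pdivrMl.
Qed.

Lemma coneintD x y : coneint x -> C y -> coneint (x + y).
Proof.
move=> [e e0 eC] Cy; exists e => // w wx; rewrite -[w](subrK y); apply: CD => //.
by apply: eC; rewrite addrAC -addrA -opprD.
Qed.

Lemma coneint_open x : coneint x ->
  exists2 e, 0 < e & forall w, nrm (w - x) < e -> coneint w.
Proof.
move=> [e e0 eC]; exists (e / 2); first lra.
move=> w wx; exists (e / 2); first lra.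
move=> z zw; apply: eC; apply: le_lt_trans (nrm_triangle _ w _) _; lra.
Qed.

Lemma coneint_one : coneint (one_cv R n).
Proof.
exists 1 => // w w1; apply: (fatcone_pos fC) => j.
have := le_lt_trans (entry_le_nrm _ j 0) w1; rewrite !mxE ltr_norml => /andP[].
lra.
Qed.

Lemma entrysum_gt0 x : C x -> x != 0 -> 0 < entrysum x.
Proof.
move=> Cx; rewrite ltNge; apply: contraNN => s0; apply/eqP.
exact: fatcone_entrysum0 fC Cx s0.
Qed.

Lemma pointedC x : C x -> C (- x) -> x = 0.
Proof.
move=> Cx Cnx; apply: (fatcone_entrysum0 fC Cx).
by have [_ _ _ /(_ _ Cnx)[]] := fC; rewrite entrysumN oppr_ge0.
Qed.

(** The vectors outside both [C] and [- C] form an open set invariant under scaling; it descends to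
    an open set disjoint from [projint]. *)
Lemma projint_closure (u : nzvec R n) : closure projint (proj_pt u) -> C (val u) \/ C (- val u).
Proof.
move=> clu; apply: contrapT => /not_orP[nC nCn].
have [e e0 eC] := clC nC; have [e' e'0 e'C] := clC nCn.
pose B := [set p | forall v : nzvec R n, proj_pt v = p -> ~ C (val v) /\ ~ C (- val v)].
have scale (v w : nzvec R n) (c : R) : c != 0 -> val v = c *: val w :> 'cV[R]_N -> ~ C (val w) -> ~ C (- val w) ->
    ~ C (val v) /\ ~ C (- val v).
  move=> c0 vw nw nw'; have vw' : val w = c^-1 *: val v by rewrite vw scalerA mulVf ?scale1r.
  have [cp|cn] := ltP 0 c.
    split=> Cv; [apply: nw|apply: nw']; rewrite vw' -?scalerN; apply: CZ => //; rewrite invr_ge0; exact: ltW.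
  have cn' : 0 <= - c^-1 by rewrite oppr_ge0 invr_le0.
  split=> Cv; [apply: nw'|apply: nw].
    by rewrite vw' -scaleNr; exact: CZ.
  by rewrite vw' -[c^-1]opprK scaleNr -scalerN; exact: CZ.
have BE : @proj_pt R n @^-1` B = [set v | ~ C (val v) /\ ~ C (- val v)].
  rewrite predeqE => v; split=> [/(_ v erefl)//|[nv nv'] w /projP[c c0 wv]].
  exact: scale c0 wv nv nv'.
have oB : open B.
  rewrite -[open B]/(open (@proj_pt R n @^-1` B)) BE openE => v [nv nv'].
  have [d d0 dC] := clC nv; have [d' d'0 d'C] := clC nv'.
  apply/sub_nbhsP; exists (Num.min d d'); first by rewrite lt_min d0.
  move=> w; rewrite lt_min => /andP[wd wd']; split; first exact: dC.
  by apply: d'C; rewrite -opprD nrmN.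
have Bu : nbhs (proj_pt u) B.
  apply: open_nbhs_nbhs; split=> //; rewrite -[B _]/((@proj_pt R n @^-1` B) u) BE.
  by [].
have [p [[v vp Iv] /(_ v vp)[nv _]]] := clu _ Bu.
by apply: nv; exact: coneint_sub.
Qed.

(** Every plane contains a nonzero vector with zero [entrysum], whereas no nonzero vector of [C] or
    [- C] has this property; hence the closure contains no projective line. *)
Lemma projint_properly_convex : properly_convex projint.
Proof.
have one0 : one_cv R n != 0 by apply/eqP => /colP/(_ 0)/eqP; rewrite !mxE oner_eq0.
split.
- by exists (proj_pt (mknz one0)), (mknz one0) => //; exact: coneint_one.
- rewrite -[open projint]/(open (@proj_pt R n @^-1` projint)) openE => v [u /projP[c c0 uv] Iu].
  have [e e0 eI] := coneint_open Iu; apply/sub_nbhsP.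
  exists (e / `|c|); first by rewrite divr_gt0 ?normr_gt0.
  move=> w wv; have cw : c *: val w != 0 by rewrite scaler_eq0 negb_or c0 nz_neq0.
  exists (mknz cw); first by apply/projP; exists c.
  apply: eI; rewrite /= uv -scalerBr nrmZ; move: wv.
  by rewrite ltr_pdivlMr ?normr_gt0// mulrC.
- move=> p q [u up Iu] [v vq Iv]; exists u, v; split.
  + by exists u => //; exists 1, 0; rewrite scale1r scale0r addr0.
  + by exists v => //; exists 0, 1; rewrite scale1r scale0r add0r.
  + move=> _ [w [s [t [s0 t0 wE]]] <-]; exists w => //; rewrite wE.
    have [s00|sn] := eqVneq s 0; last first.
      apply: coneintD; first by apply: coneintZ => //; rewrite lt_def sn.
      by apply: CZ => //; exact: coneint_sub.
    rewrite s00 scale0r add0r; apply: coneintZ => //; rewrite lt_def t0 andbT.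
    apply: contraNneq (nz_neq0 w) => t00.
    by rewrite wE s00 t00 !scale0r addr0.
- move=> u v uv line.
  (* These coefficients cancel the entry sum of the combination. If both vanish, [u] itself has zero
     entry sum and serves instead. *)
  pose s := entrysum (val v); pose t := - entrysum (val u).
  have main (s' t' : R) : (s' != 0) || (t' != 0) -> s' * entrysum (val u) + t' * entrysum (val v) = 0 -> False.
    move=> st0 sum0; have nz : s' *: val u + t' *: val v != 0.
      apply/eqP => E; move: uv => /eqP; apply; apply/projP.
      have sn : s' != 0.
        apply: contraTneq st0 => s0; rewrite s0 eqxx /= negbK.
        by move: E => /eqP; rewrite s0 scale0r add0r scaler_eq0 (negbTE (nz_neq0 v)) orbF.
      have tn : t' != 0.
        apply: contraNneq sn => t0; move: E => /eqP.
        by rewrite t0 scale0r addr0 scaler_eq0 (negbTE (nz_neq0 u)) orbF.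
      exists (- (t' / s')); first by rewrite oppr_eq0 mulf_neq0 ?invr_eq0.
      apply: (scalerI sn); rewrite scalerA mulrN mulrCA mulfV// mulr1 scaleNr.
      by apply/eqP; rewrite -addr_eq0 E.
    have : closure projint (proj_pt (mknz nz)).
      by apply: line; exists (mknz nz) => //; exists s', t'.
    move=> /projint_closure /= Cw.
    have sw : entrysum (s' *: val u + t' *: val v) = 0.
      by rewrite entrysumD !entrysumZ.
    case: Cw => Cw.
      by have := entrysum_gt0 Cw nz; rewrite sw ltxx.
    by have := entrysum_gt0 Cw; rewrite oppr_eq0 => /(_ nz); rewrite entrysumN sw oppr0 ltxx.
  have [st0|] := boolP ((s != 0) || (t != 0)).
    by apply: (main s t) => //; rewrite /s /t mulNr mulrC subrr.
  rewrite negb_or !negbK => /andP[_ t0]; apply: (main 1 0); first by rewrite oner_eq0.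
  by move: t0; rewrite /t oppr_eq0 => /eqP ->; rewrite mulr0 mul0r addr0.
Qed.

End ConeInterior.

(** * Interior fixed points and torsion *)

Section FixedPoints.
Variables (R : realType) (n : nat) (G : groupType).
Local Notation N := n.+1.
Variables (L : G -> 'M[R]_N) (C : set 'cV[R]_N) (d : R).
Hypothesis hL : hommx L.
Hypothesis detL : forall g, `|\det (L g)| = 1.
Hypothesis fC : fatcone C.
Hypothesis LC : preserves L C.
Hypothesis d0 : 0 < d.
Hypothesis discL : discretemx L d.

(** An interior point is an order unit for the order defined by [C]: a small [x] lies between [- u]
    and [u], so its image lies between [- c *: u] and [c *: u]. Order intervals of a fat cone are
    bounded in norm. *)
Lemma eigen_bound u : coneint C u -> exists2 K, 0 <= K & forall h c,
  L h *m u = c *: u -> nrm (L h) <= K * c.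
Proof.
move=> [e e0 eC]; have [CD CZ Cd fCs] := fC.
have Cu : C u by apply: eC; rewrite subrr nrm0.
have su := (fCs _ Cu).1.
pose M : R := N%:R * N%:R * entrysum u.
have M0 : 0 <= M by rewrite !mulr_ge0.
(* There are [N] columns, and [2 / e] undoes the scaling of the basis vectors by [e / 2]. The image
   of a scaled vector is a vector of norm at most [2 * M * c] minus [c *: u], of norm at most
   [M * c]. *)
exists (N%:R * (2 / e * (3 * M))).
  by rewrite !mulr_ge0// ltW// invr_gt0.
move=> h c hu.
have col_bound j : nrm (col j (L h)) <= 2 / e * (3 * M * c).
  pose x : 'cV[R]_N := (e / 2) *: delta_mx j 0.
  have nx : nrm x < e.
    rewrite nrmZ gtr0_norm ?divr_gt0// (_ : nrm (delta_mx j 0 : 'cV[R]_N) = 1); first by lra.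
    rewrite /nrm (bigD1 j)//= big_ord1 mxE !eqxx normr1 big1 ?addr0// => i ij.
    by rewrite big_ord1 mxE (negbTE ij) normr0.
  have Lx : L h *m x = (e / 2) *: col j (L h) by rewrite -scalemxAr -colE.
  have Cp : C (c *: u + L h *m x).
    by rewrite -hu -mulmxDr; apply: LC; apply: eC; rewrite addrC addKr.
  have Cm : C (c *: u - L h *m x).
    by rewrite -hu -mulmxBr; apply: LC; apply: eC; rewrite addrC addKr nrmN.
  have sp := (fCs _ Cp).1; have sm := (fCs _ Cm).1.
  have np := fatcone_nrm fC Cp; have Cc : C (c *: u) by rewrite -hu; exact: LC.
  have nu := fatcone_nrm fC Cc.
  move: sp sm np nu; rewrite !entrysumD entrysumN entrysumZ => sp sm np nu.
  have nLx : nrm (L h *m x) <= 3 * M * c.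
    have -> : L h *m x = (c *: u + L h *m x) - c *: u by rewrite addrC addKr.
    apply: le_trans (nrmB _ _) _.
    have N2 : 0 <= N%:R * N%:R :> R by rewrite mulr_ge0.
    have := ler_wpM2l N2 sm; rewrite mulr0 /M; lra.
  move: nLx; rewrite Lx nrmZ gtr0_norm ?divr_gt0// => h1.
  have -> : nrm (col j (L h)) = 2 / e * (e / 2 * nrm (col j (L h))).
    by field; exact: lt0r_neq0.
  by apply: ler_wpM2l => //; rewrite divr_ge0// ltW.
have -> : nrm (L h) = \sum_j nrm (col j (L h)).
  by rewrite /nrm exchange_big; apply: eq_bigr => j _; apply: eq_bigr => i _; rewrite big_ord1 mxE.
have -> : N%:R * (2 / e * (3 * M)) * c = \sum_(j < N) (2 / e * (3 * M * c)).
  by rewrite sumr_const card_ord -[RHS]mulr_natl -!mulrA.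
by apply: ler_sum => j _.
Qed.

Lemma eigen_pow g (u : 'cV[R]_N) c m : L g *m u = c *: u -> L (g ^+ m)%g *m u = c ^+ m *: u.
Proof.
have [L1 LM] := hL; move=> gu; elim: m => [|m IH]; first by rewrite expg0 L1 mul1mx scale1r.
by rewrite expgS LM -mulmxA IH -scalemxAr gu scalerA exprSr.
Qed.

(** If [c < 1], the powers of [L g] tend to zero by [eigen_bound], although their determinants keep
    absolute value 1. *)
Lemma eigen_ge1 u g c : coneint C u -> 0 < c -> L g *m u = c *: u -> 1 <= c.
Proof.
move=> Iu c0 gu; rewrite leNgt; apply/negP => c1; have [K K0 KP] := eigen_bound Iu.
have lim : mcvg \oo (fun m => L (g ^+ m)%g) 0.
  apply/mcvgP => e e0; have K1 : 0 < K + 1 by lra.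
  have : (fun m => c ^+ m) @ \oo --> (0 : R) by apply: cvg_expr; rewrite gtr0_norm.
  move=> /cvgrPdist_lt/(_ _ (divr_gt0 e0 K1)); apply: filterS => m.
  rewrite sub0r normrN gtr0_norm ?exprn_gt0// ltr_pdivlMr// subr0 => cm.
  apply: le_lt_trans (KP _ _ (eigen_pow m gu)) _.
  by have := exprn_ge0 m (ltW c0); lra.
have h : (fun m => `|\det (L (g ^+ m)%g)|) @ \oo --> `|\det (0 : 'M[R]_N)|.
  by apply: cvg_norm; exact: mcvg_det.
have h1 : (fun m => `|\det (L (g ^+ m)%g)|) @ \oo --> (1 : R).
  rewrite (_ : (fun m => _) = fun=> (1 : R)); first exact: cvg_cst.
  by apply/funext.
have /eqP : `|\det (0 : 'M[R]_N)| = 1 by exact: (cvg_unique (@Rhausdorff R) h h1).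
by rewrite det0 normr0 eq_sym oner_eq0.
Qed.

(** Pointedness makes [c] positive, and [eigen_ge1] for [g] and its inverse makes it 1. All powers
    of [L g] are then bounded by the same constant, so two of them are so close that discreteness
    identifies them. *)
Lemma eigen_torsion u g c : coneint C u -> u != 0 -> c != 0 -> L g *m u = c *: u ->
  exists m, (g ^+ m.+1)%g = 1%g.
Proof.
move=> Iu u0 c0 gu; have [L1 LM] := hL; have Cu := coneint_sub Iu.
have cp : 0 < c.
  rewrite lt_def c0 leNgt; apply/negP => cn; move/eqP: u0; apply.
  apply: (pointedC fC Cu); have [_ CZ _ _] := fC.
  have := LC g Cu; rewrite gu => /(CZ (- c^-1)).
  rewrite scalerA mulNr mulVf// scaleN1r; apply.
  by rewrite oppr_ge0 invr_le0 ltW.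
have gVu : L g^-1%g *m u = c^-1 *: u.
  by rewrite -[u in LHS](scalerK c0) -gu -scalemxAr mulmxA (hommxVl hL) mul1mx.
have c1 : c = 1.
  apply/eqP; rewrite eq_le (eigen_ge1 Iu cp gu) andbT.
  by have := eigen_ge1 Iu _ gVu; rewrite invr_gt0 => /(_ cp); rewrite invf_ge1.
have [K K0 KP] := eigen_bound Iu.
have bV m : nrm (L (g ^+ m)^-1%g) <= K.
  have := KP _ _ (eigen_pow m gVu); rewrite c1 invr1 expr1n mulr1.
  by rewrite expVgn.
have b m : nrm (L (g ^+ m)%g) <= K.
  by have := KP _ _ (eigen_pow m gu); rewrite c1 expr1n mulr1.
have [W [WW ooW]] := ultraFilterLemma (eventually_filter).
have [M WM] : exists M, mcvg W (fun m => L (g ^+ m)%g) M.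
  by apply: (@ultra_mcvg _ _ _ _ _ _ K) => //; apply: nearW.
have PW : ProperFilter W by exact: ultra_proper.
(* Two powers this close to [M] differ by less than [d / (K + 1)], and multiplying by an inverse
   power, of norm at most [K], stays below [d]. *)
have e0 : 0 < d / (2 * (K + 1)) by rewrite divr_gt0//; lra.
move/mcvgP: WM => /(_ _ e0) near.
have [m mM] := filter_ex near.
have /filter_ex[k [km kM]] : \forall k \near W, (m < k)%N /\ nrm (L (g ^+ k)%g - M) < d / (2 * (K + 1)).
  by apply: filterI => //; apply: ooW; exact: nbhs_infty_gt.
exists (k - m).-1; rewrite prednK ?subn_gt0//.
apply/eqP; apply: contraT => /discL; rewrite leNgt => /negP; case.
have -> : L (g ^+ (k - m))%g - 1%:M = L (g ^+ m)^-1%g *m (L (g ^+ k)%g - L (g ^+ m)%g).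
  rewrite mulmxBr (hommxVl hL) -LM; congr (L _ - _).
  by rewrite -{2}(subnKC (ltnW km)) expgnDr mulKg.
apply: le_lt_trans (nrmM _ _) _.
have K1 : 0 < K + 1 by lra.
have h : nrm (L (g ^+ k)%g - L (g ^+ m)%g) < d / (K + 1).
  apply: le_lt_trans (nrm_triangle _ M _) _; rewrite (nrmBC M).
  have -> : d / (K + 1) = d / (2 * (K + 1)) + d / (2 * (K + 1)) by field; exact: lt0r_neq0.
  lra.
rewrite ltr_pdivlMr// in h; have := bV m.
have := nrm_ge0 (L (g ^+ k)%g - L (g ^+ m)%g); have := nrm_ge0 (L (g ^+ m)^-1%g).
nra.
Qed.

End FixedPoints.

(** * From a limit representation to a holonomy *)

Section FatHolonomy.
Variables (R : realType) (n : nat) (G : groupType).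
Local Notation N := n.+1.
Variables (L : G -> 'M[R]_N) (C : set 'cV[R]_N) (d : R).
Hypothesis hL : hommx L.
Hypothesis detL : forall g, `|\det (L g)| = 1.
Hypothesis fC : fatcone C.
Hypothesis clC : forall x, ~ C x -> exists2 e, 0 < e & forall w, nrm (w - x) < e -> ~ C w.
Hypothesis LC : preserves L C.
Hypothesis d0 : 0 < d.
Hypothesis discL : discretemx L d.
Hypothesis tfG : forall (g : G) m, (g ^+ m.+1)%g = 1%g -> g = 1%g.

Lemma fat_coneint g x : coneint C x -> coneint C (L g *m x).
Proof.
move=> [e e0 eC]; have m0 : 0 < 1 + nrm (L g^-1%g) by have := nrm_ge0 (L g^-1%g); lra.
exists (e / (1 + nrm (L g^-1%g))); first exact: divr_gt0.
move=> w wx; rewrite -[w]mul1mx -(hommxVr hL g) -mulmxA; apply: LC; apply: eC.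
have -> : L g^-1%g *m w - x = L g^-1%g *m (w - L g *m x).
  by rewrite mulmxBr mulmxA (hommxVl hL) mul1mx.
apply: le_lt_trans (nrmM _ _) _; move: wx; rewrite ltr_pdivlMr//.
have := nrm_ge0 (w - L g *m x); have := nrm_ge0 (L g^-1%g); nra.
Qed.

(** A fat cone contains no opposite of a basis vector. This excludes the only way in which a
    faithful linear representation could lose injectivity in PGL. *)
Lemma fat_neg1 g : L g <> - 1%:M.
Proof.
move=> E; have [_ _ Cd fCs] := fC; have := LC g (Cd ord0).
by move=> /fCs[+ _]; rewrite E mulNmx mul1mx entrysumN entrysum_delta oppr_ge0 ler10.
Qed.

Lemma fat_faithful g : L g = 1%:M -> g = 1%g.
Proof.
move=> Lg; apply/eqP; apply: contraT => /discL; by rewrite Lg subrr nrm0 leNgt d0.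
Qed.

Lemma fat_lift_inj (tau : homspace R n G) g h : homlift tau L ->
  homval tau g = homval tau h -> g = h.
Proof.
move=> lL gh; suff /fat_faithful : L (g * h^-1)%g = 1%:M.
  by move=> /(congr1 (fun x => x * h)%g); rewrite mulgVK mul1g.
have := lL g; rewrite gh => lg; rewrite hL.2.
have [E|E] := lift1_pm (lL h) lg; first by rewrite E (hommxVr hL).
exfalso; apply: (@fat_neg1 (g * h^-1)%g).
by rewrite hL.2 E mulNmx (hommxVr hL).
Qed.

(** Were [tau g] an accumulation point, the lifts [L (h a)] of nearby points would converge to [L g]
    or its opposite, so [L (h a * g^-1)] would approach 1 or -1. The first contradicts discreteness,
    the second the preservation of the cone. *)
Lemma fat_isolated (tau : homspace R n G) : homlift tau L ->
  range (val tau : G -> pgl R n) `<=` isolated (range (val tau : G -> pgl R n)).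
Proof.
move=> lL _ [g _ <-]; rewrite -/(homval tau g).
split; first by rewrite in_setE; exists g.
apply: contrapT => no.
pose D := [set a | range (val tau : G -> pgl R n) a /\ a != homval tau g].
have clD : closure D (homval tau g).
  move=> V nV; apply: contrapT => DV; apply: no; exists V => //.
  rewrite predeqE => a; split=> [[Va ra]|->].
    by apply/eqP; apply: contrapT => /negP ag; apply: DV; exists a.
  by split; [exact: nbhs_singleton|exists g].
have PF : ProperFilter (within D (nbhs (homval tau g))) by exact: within_nbhs_proper.
have [W [WW FW]] := ultraFilterLemma PF.
have PW : ProperFilter W by exact: ultra_proper.
have WD : W D by apply: FW; apply: nearW.
have idW : id @ W --> homval tau g by move=> B nB; apply: FW; apply: filterS nB => a Ba _.
have exh a : exists h : G, D a -> homval tau h = a.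
  have [[[h _ ha] _]|nD] := pselect (D a); first by exists h.
  by exists 1%g => /nD.
have [h hP] := choice exh.
have [|M lM hM] := @lift1_limit _ _ _ W id _ (fun a => L (h a)) WW idW.
  by apply: filterS WD => a Da /=; rewrite -{1}(hP a Da); exact: lL.
have conv : mcvg W (fun a => L (h a * g^-1)%g) (M *m L g^-1%g).
  rewrite (_ : (fun a => _) = fun a => L (h a) *m L g^-1%g); last first.
    by apply/funext => a; rewrite hL.2.
  by apply: mcvgM => //; exact: mcvg_cst.
have [ME|ME] := lift1_pm (lL g) lM; move: conv; rewrite ME.
  rewrite (hommxVr hL) => /mcvgP/(_ _ d0) near1.
  have /filter_ex[a [Da a1]] : \forall a \near W, D a /\ nrm (L (h a * g^-1)%g - 1%:M) < d.
    exact: filterI.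
  move: a1; apply/negP; rewrite -leNgt; apply: discL.
  have [_ ag] := Da; apply: contraNneq ag => hg; rewrite -(hP a Da).
  by have := congr1 (fun x => x * g)%g hg; rewrite mulgVK mul1g => ->.
rewrite mulNmx (hommxVr hL) => /mcvgP/(_ _ ltr01) near1.
have /filter_ex[a a1] := near1; have [_ _ Cd fCs] := fC.
have [+ _] := fCs _ (LC (h a * g^-1)%g (Cd ord0)).
set x := _ *m _ => x0; have := entrysum_nrm (x + delta_mx ord0 0).
rewrite entrysumD entrysum_delta => h1.
have : nrm (x + delta_mx ord0 0) < 1.
  have -> : x + delta_mx ord0 0 = (L (h a * g^-1)%g - - 1%:M) *m delta_mx ord0 0.
    by rewrite opprK mulmxDl mul1mx.
  apply: le_lt_trans (nrmM _ _) _.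
  rewrite (_ : nrm (delta_mx ord0 0 : 'cV[R]_N) = 1) ?mulr1//.
  rewrite /nrm (bigD1 ord0)//= big_ord1 mxE !eqxx normr1 big1 ?addr0// => i ij.
  by rewrite big_ord1 mxE (negbTE ij) normr0.
have := ler_norm (entrysum x + 1); lra.
Qed.

Lemma fat_holonomies (tau : homspace R n G) : homlift tau L -> holonomies tau.
Proof.
move=> lL; split.
- by move=> g h; apply: fat_lift_inj.
- exact: fat_isolated.
have sub g p : projint C p -> projint C (pgl_act (homval tau g) p).
  move=> [u <- Iu]; have [_ [h <-]] := lL g; rewrite pgl_act_proj.
  by exists (gl_act (mkgl h) u) => //; exact: fat_coneint.
have act1 p : pgl_act (projgl (gl1 R n)) p = p.
  rewrite -{1}(proj_repr p) pgl_act_proj -[RHS]proj_repr.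
  by congr proj_pt; apply: val_inj; rewrite /= mul1mx.
have actM a b p : pgl_act (a * b)%g p = pgl_act a (pgl_act b p).
  rewrite -(proj_repr p) -(projgl_repr a) -(projgl_repr b) -[(_ * _)%g]/(pglM _ _).
  rewrite pglM_proj !pgl_act_proj; congr proj_pt; apply: val_inj.
  by rewrite /= mulmxA.
exists (projint C); split; first exact: projint_properly_convex.
  move=> g; rewrite -/(homval tau g) predeqE => p; split=> [[q Iq <-]|Ip]; first exact: sub.
  exists (pgl_act (homval tau g^-1%g) p); first exact: sub.
  by rewrite -actM -homvalM mulgV homval1; exact: act1.
move=> g _ [u <- Iu]; rewrite -/(homval tau g); have [_ [h Lh]] := lL g.
rewrite -Lh pgl_act_proj => /projP[c c0 /= Lu].
have [m gm] := eigen_torsion hL detL fC LC d0 discL Iu (nz_neq0 u) c0 Lu.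
by rewrite Lh (tfG gm) homval1.
Qed.

End FatHolonomy.

(** * Closedness *)

Section GoodPosition.
Variables (R : realType) (n : nat) (G : groupType) (s : seq G).
Local Notation N := n.+1.
Implicit Types (A : G -> 'M[R]_N) (C : set 'cV[R]_N) (S P : 'M[R]_N).

Definition conjmx S A g := S *m A g *m invmx S.

(** The summand 1 makes the size positive even for an empty list, so that it can be divided by and
    has a positive infimum over conjugates. *)
Definition gensize A : R := 1 + \sum_(i < size s) nrm (A (nth 1%g s i)).

Lemma gensize_ge1 A : 1 <= gensize A.
Proof. by rewrite lerDl sumr_ge0// => i _; exact: nrm_ge0. Qed.

Lemma conjmx_conj S P A : S \in unitmx -> P \in unitmx ->
  conjmx P (conjmx S A) = conjmx (P *m S) A.
Proof.
by move=> uS uP; apply/funext => g; rewrite /conjmx [invmx (P *m S)]invrM// !mulmxA.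
Qed.

Lemma conjmx_hom S A : S \in unitmx -> hommx A -> hommx (conjmx S A).
Proof.
move=> uS [A1 AM]; split=> [|g h]; first by rewrite /conjmx A1 mulmx1 mulmxV.
by rewrite /conjmx AM !mulmxA mulmxKV.
Qed.

Lemma conjmx_det S A g : S \in unitmx -> \det (conjmx S A g) = \det (A g).
Proof. by move=> uS; rewrite !det_mulmx mulrAC -det_mulmx mulmxV// det1 mul1r. Qed.

Lemma conjmx_faithful S A : S \in unitmx -> faithfulmx A -> faithfulmx (conjmx S A).
Proof.
move=> uS fA g Sg; apply: fA.
have -> : A g = invmx S *m conjmx S A g *m S by rewrite !mulmxA mulVmx// mul1mx mulmxKV.
by rewrite Sg mulmx1 mulVmx.
Qed.

Lemma conjmx_discrete S A d : S \in unitmx -> 0 < d -> discretemx A d ->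
  exists2 d', 0 < d' & discretemx (conjmx S A) d'.
Proof.
move=> uS d0 dA; pose K := nrm (invmx S) * nrm S.
have K0 : 0 <= K by rewrite mulr_ge0// nrm_ge0.
have K1 : 0 < 1 + K by lra.
exists (d / (1 + K)); first exact: divr_gt0.
move=> g g1; rewrite ler_pdivrMr//; apply: le_trans (dA g g1) _.
have -> : A g - 1%:M = invmx S *m (conjmx S A g - 1%:M) *m S.
  by rewrite mulmxBr mulmxBl mulmx1 mulVmx// !mulmxA mulVmx// mul1mx mulmxKV.
apply: le_trans (nrmM _ _) _.
have := nrmM (invmx S) (conjmx S A g - 1%:M) => h.
have := ler_wpM2r (nrm_ge0 S) h; have := nrm_ge0 (conjmx S A g - 1%:M); rewrite /K; lra.
Qed.

Lemma conjmx_word S A w : S \in unitmx -> \tr (wordmx (conjmx S A) w) = \tr (wordmx A w).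
Proof.
move=> uS; have -> : wordmx (conjmx S A) w = S *m wordmx A w *m invmx S.
  rewrite (wordmx_intertwine (B := conjmx S A)) ?mulmxK// => g.
  by rewrite /conjmx mulmxKV.
by rewrite mxtrace_mulC mulmxA mulVmx// mul1mx.
Qed.

Lemma pcone_preim C S : S \in unitmx -> pcone C -> pcone [set x | C (S *m x)].
Proof.
move=> uS [clC CD CZ ptC [v [e e0 eC]]].
have K1 : 0 < 1 + nrm S by have := nrm_ge0 S; lra.
split.
- move=> x h; apply: clC => d d0; have [y Cy xy] := h _ (divr_gt0 d0 K1).
  exists (S *m y) => //; rewrite -mulmxBr; apply: le_lt_trans (nrmM _ _) _.
  by move: xy; rewrite ltr_pdivlMr//; have := nrm_ge0 (x - y); lra.
- by move=> x y /= Cx Cy; rewrite mulmxDr; exact: CD.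
- by move=> a x /= a0 Cx; rewrite -scalemxAr; exact: CZ.
- move=> x /= Cx; rewrite mulmxN => Cnx; have := ptC _ Cx Cnx.
  by move=> /(congr1 (mulmx (invmx S))); rewrite mulKmx// mulmx0.
- exists (invmx S *m v), (e / (1 + nrm S)); first exact: divr_gt0.
  move=> w wv; apply: eC; rewrite -[v](mulKVmx uS) -mulmxBr.
  apply: le_lt_trans (nrmM _ _) _.
  by move: wv; rewrite ltr_pdivlMr//; have := nrm_ge0 (w - invmx S *m v); lra.
Qed.

(** Two of the three factors [N] come from [fatcone_mx], the third from the last bound of
    [pcone_position]. *)
Lemma fat_position A C : pcone C -> preserves A C -> exists S C',
  [/\ S \in unitmx, fatcone C', preserves (conjmx S A) C' &
      gensize (conjmx S A) <= N%:R ^+ 3 * gensize A].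
Proof.
move=> pC AC; have [_ CD CZ _ _] := pC.
have [X [dX CX Xfat Xsum]] := pcone_position pC.
have uX : X \in unitmx by rewrite unitmxE unitfE.
exists (invmx X), [set c | C (X *m c)].
have fat : fatcone [set c | C (X *m c)].
  split=> [x y /= Cx Cy|a x /= a0 Cx|j /=|x /= Cx].
  - by rewrite mulmxDr; exact: CD.
  - by rewrite -scalemxAr; exact: CZ.
  - by rewrite -colE.
  - exact: Xfat.
have pres : preserves (conjmx (invmx X) A) [set c | C (X *m c)].
  by move=> g c /= Cc; rewrite /conjmx invmxK -!mulmxA mulKVmx//; exact: AC.
split=> //; first by rewrite unitmx_inv.
have N1 : 1 <= N%:R :> R by rewrite ler1n.
have N3 : 1 <= N%:R ^+ 3 :> R by exact: exprn_ege1.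
rewrite /gensize mulrDr mulr1; apply: lerD => //.
rewrite mulr_sumr; apply: ler_sum => i _; set g := nth _ _ _.
apply: le_trans (fatcone_mx fat (pres g)) _.
have -> : N%:R ^+ 3 * nrm (A g) = N%:R * (N%:R * (N%:R * nrm (A g))).
  by rewrite !exprS expr0 mulr1 !mulrA.
do 2!(apply: ler_wpM2l; first exact: ler0n).
by rewrite /conjmx invmxK -!mulmxA; exact: Xsum.
Qed.

(** The infimum over conjugates need not be attained, so a conjugate within a factor 2 of it is
    taken before [fat_position] is applied to its cone. The result is thus optimal up to a constant
    independent of the representation. *)
Lemma good_position A C : pcone C -> preserves A C -> exists S C',
  [/\ S \in unitmx, fatcone C', preserves (conjmx S A) C' &
      forall P, P \in unitmx ->
        gensize (conjmx S A) <= 2 * N%:R ^+ 3 * gensize (conjmx P (conjmx S A))].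
Proof.
move=> pC AC; pose E := [set gensize (conjmx P A) | P in [set P | P \in unitmx]].
have E0 : E !=set0 by exists (gensize (conjmx 1%:M A)), 1%:M => //=; exact: unitmx1.
have m1 : 1 <= inf E by apply: lb_le_inf => // _ [P _ <-]; exact: gensize_ge1.
have lbE : has_lbound E by exists 1 => _ [P _ <-]; exact: gensize_ge1.
have m2 : inf E < 2 * inf E by lra.
have [_ [P /= uP <-] Pm] := inf_lt E0 m2.
have uPV : invmx P \in unitmx by rewrite unitmx_inv.
have pC' := pcone_preim uPV pC.
have AC' : preserves (conjmx P A) [set x | C (invmx P *m x)].
  by move=> g c /= Cc; rewrite /conjmx !mulmxA mulVmx// mul1mx -mulmxA; exact: AC.
have [S [C' [uS fC' SC' Ssize]]] := fat_position pC' AC'.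
exists (S *m P), C'; rewrite -(conjmx_conj _ uP uS); split=> //.
  by rewrite unitmx_mul uS.
move=> Q uQ; rewrite !conjmx_conj ?unitmx_mul ?uS//.
have : inf E <= gensize (conjmx (Q *m (S *m P)) A).
  by apply: ge_inf => //; exists (Q *m (S *m P)); rewrite //= !unitmx_mul uQ uS.
move: Ssize; rewrite conjmx_conj// => Ssize Em.
apply: le_trans Ssize _.
have N3 : 0 <= N%:R ^+ 3 :> R by rewrite exprn_ge0.
have := ler_wpM2l N3 (ltW Pm); have := ler_wpM2l N3 Em; lra.
Qed.

End GoodPosition.

Lemma symmetric_generators (G : groupType) : finitely_generated G ->
  exists2 s : seq G, smallest (@is_subgroup G) [set` s] = setT &
    forall x, x \in s -> x^-1%g \in s.
Proof.
move=> [s0 gens]; exists (s0 ++ [seq x^-1%g | x <- s0]).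
  rewrite predeqE => x; split=> // _ H [sH Hs].
  have : [set: G] x by [].
  rewrite -gens; apply; split=> // y ys; apply: Hs => /=.
  by rewrite mem_cat; apply/orP; left.
move=> x; rewrite !mem_cat => /orP[xs|/mapP[y ys ->]]; apply/orP; last first.
  by left; rewrite invgK.
by right; apply/mapP; exists x.
Qed.

(** * Bounded traces and near-minimality bound the generators *)

Section Bounded.
Variables (R : realType) (n : nat) (G : groupType) (s : seq G) (T : Type) (U : set_system T).
Local Notation N := n.+1.
Variable A : T -> G -> 'M[R]_N.
Variable K : R.
Hypothesis UU : UltraFilter U.
Hypothesis K0 : 0 < K.
Hypothesis homA : \forall t \near U, hommx (A t).
Hypothesis minA : \forall t \near U, forall P, P \in unitmx ->
  gensize s (A t) <= K * gensize s (conjmx P (A t)).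
Hypothesis trA : forall g, exists B, \forall t \near U, `|\tr (A t g)| <= B.

(* Otherwise the rescaled generators converge to a tuple all of whose words have
   trace zero; conjugating it close to zero contradicts near-minimality. *)
Lemma gensize_bounded : exists B, \forall t \near U, gensize s (A t) <= B.
Proof.
have UF : Filter U by exact: filter_filter.
have PU : ProperFilter U by exact: ultra_proper.
apply: contrapT => /forallNP unb.
have big B : \forall t \near U, B < gensize s (A t).
  have := ultra_not UU (unb B); apply: filterS => t /negP.
  by rewrite -ltNge.
pose F t := gensize s (A t).
pose M t (i : 'I_(size s)) := (F t)^-1 *: A t (nth 1%g s i).
have F1 t : 1 <= F t by exact: gensize_ge1.
have F0 t : 0 < F t by exact: lt_le_trans ltr01 (F1 t).
have Mlim i : exists L, mcvg U (M ^~ i) L.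
  apply: (@ultra_mcvg _ _ _ _ _ _ 1) => //; apply: nearW => t.
  rewrite /M nrmZ ger0_norm ?invr_ge0 ?(ltW (F0 t))// ler_pdivrMl// mulr1.
  rewrite /F /gensize (bigD1 i)//= addrCA lerDl addr_ge0//.
  by apply: sumr_ge0 => j _; exact: nrm_ge0.
have [L LP] := choice Mlim.
(* The element [g] is the same for all [t], so its traces are bounded; for a nonempty word they are
   divided by at least [F t], which is unbounded. *)
have wM w : exists g, forall t, hommx (A t) -> wordmx (M t) w = (F t)^-1 ^+ size w *: A t g.
  elim: w => [|i w [g IH]] /=; first by exists 1%g => t [-> _]; rewrite expr0 scale1r.
  exists (nth 1%g s i * g)%g => t hA; rewrite (IH t hA) /M hA.2.
  by rewrite -scalemxAl -scalemxAr scalerA exprS.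
have trL i w : \tr (wordmx L (i :: w)) = 0.
  have lim : (fun t => \tr (wordmx (M t) (i :: w))) @ U --> \tr (wordmx L (i :: w)).
    by apply: mcvg_trace; apply: mcvg_wordmx.
  have lim0 : (fun t => \tr (wordmx (M t) (i :: w))) @ U --> (0 : R).
    have [g gP] := wM (i :: w); have [B trB] := trA g.
    apply/cvgrPdist_lt => e e0; have bigB := big ((1 + `|B|) / e).
    near=> t; have hA : hommx (A t) by near: t.
    have tB : `|\tr (A t g)| <= B by near: t.
    have Ft : (1 + `|B|) / e < F t by near: t.
    rewrite sub0r normrN gP// mxtraceZ normrM normrX normfV (gtr0_norm (F0 t)) /=.
    have FV1 : (F t)^-1 <= 1 by rewrite invf_le1.
    have FV0 : 0 <= (F t)^-1 by rewrite invr_ge0 ltW.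
    have h : (F t)^-1 ^+ (size w).+1 <= (F t)^-1.
      by rewrite exprS ler_piMr// exprn_ile1.
    apply: (@le_lt_trans _ _ ((F t)^-1 * `|B|)).
      by apply: ler_pM; rewrite ?exprn_ge0// (le_trans tB)// ler_norm.
    rewrite ltr_pdivrMl//; move: Ft; rewrite ltr_pdivrMr//.
    by have := normr_ge0 B; lra.
  exact: (cvg_unique (@Rhausdorff R) lim lim0).
(* With generators this small after rescaling, [K] times the size of the conjugate is at most
   [K + F t / 2], which is below [F t] once [F t] exceeds [2 * K]. *)
pose e := 1 / (2 * K * (1 + (size s)%:R)).
have s1 : 0 < 1 + (size s)%:R :> R by rewrite ltr_wpDr.
have e0 : 0 < e by rewrite divr_gt0// !mulr_gt0.
have [P [Q [[PQ QP] small]]] := nil_small e0 trL.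
have [uP uQ] := mulmx1_unit PQ.
have QE : Q = invmx P by rewrite -[LHS]mulmx1 -(mulmxV uP) mulmxA QP mul1mx.
have nearsmall : \forall t \near U, forall i, nrm (P *m M t i *m Q) < e.
  apply: filter_forall => i.
  have lim : mcvg U (fun t => P *m M t i *m Q) (P *m L i *m Q).
    by apply: mcvgM; [apply: mcvgM => //|]; exact: mcvg_cst.
  move/mcvgP: lim => /(_ (e - nrm (P *m L i *m Q))); rewrite subr_gt0 => /(_ (small i)).
  apply: filterS => t; rewrite ltrBrDr; apply: le_lt_trans.
  rewrite -[P *m M t i *m Q in leLHS](subrK (P *m L i *m Q)); exact: nrmD.
have bigK := big (2 * K).
have /filter_ex[t [[minT smallT] Ft]] : \forall t \near U,
   ((forall P, P \in unitmx -> gensize s (A t) <= K * gensize s (conjmx P (A t))) /\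
    (forall i, nrm (P *m M t i *m Q) < e)) /\ 2 * K < gensize s (A t).
  by apply: filterI => //; exact: filterI.
have := minT P uP; apply/negP; rewrite -ltNge.
have bound : gensize s (conjmx P (A t)) <= 1 + F t * ((size s)%:R * e).
  rewrite /gensize lerD2l mulrCA mulr_natl -[X in _ <= _ *+ X]card_ord -sumr_const.
  apply: ler_sum => i _.
  have -> : conjmx P (A t) (nth 1%g s i) = F t *: (P *m M t i *m Q).
    by rewrite /M /conjmx -QE -scalemxAr -scalemxAl scalerA mulfV ?scale1r// gt_eqF.
  rewrite nrmZ gtr0_norm//; apply: ler_wpM2l; first exact: ltW.
  exact: ltW.
have se : (size s)%:R * e * K <= 1 / 2.
  have sn : (0 : R) <= (size s)%:R by [].
  rewrite /e.
  have -> : (size s)%:R * (1 / (2 * K * (1 + (size s)%:R))) * K =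
      (size s)%:R / (2 * (1 + (size s)%:R)).
    by field; rewrite !gt_eqF.
  by rewrite ler_pdivrMr ?mulr_gt0//; lra.
have := ler_wpM2l (ltW K0) bound; rewrite -/(F t) in Ft *.
have := ler_wpM2l (ltW (F0 t)) se; lra.
Unshelve. all: end_near. Qed.

End Bounded.

Section Main.
Variables (R : realType) (n : nat) (G : groupType).
Local Notation N := n.+1.
Local Notation hom := (homspace R n G).

Definition signed (e : G -> R) := forall g, e g = 1 \/ e g = -1.

(* [A] is, up to signs [e], a lift of a holonomy in the class of [rho], moved
   into good position with respect to the cone it preserves. *)
Definition good_rep (s : seq G) (rho : hom) (A : G -> 'M[R]_N) (C : set 'cV[R]_N) (e : G -> R) :=
  [/\ [/\ hommx A, forall g, `|\det (A g)| = 1 & faithfulmx A],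
      exists2 d, 0 < d & discretemx A d,
      fatcone C /\ preserves A C,
      forall P, P \in unitmx -> gensize s A <= 2 * N%:R ^+ 3 * gensize s (conjmx P A) &
      signed e /\ exists2 X, homlift rho X & sametrace X (fun g => e g *: A g)].

Lemma good_rep_ex s (rho sigma : hom) : holonomies sigma -> chi sigma = chi rho ->
  exists A C e, good_rep s rho A C e.
Proof.
move=> /holonomy_conerep[[A [C [hA lA pC AC [fA [d d0 dA]]]]] _] /esym/chi_samelift.
move=> [X [Y [hX hY XY]]]; have [e eP YE] := homlift_sign lA hY.
have [S [C' [uS fC' AC' minS]]] := good_position s pC AC.
exists (conjmx S A), C', e; split=> //.
- split; [exact: conjmx_hom| |exact: conjmx_faithful].
  by move=> g; rewrite conjmx_det//; have [] := lA g.
- exact: conjmx_discrete dA.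
split=> //; exists X => // w; rewrite (XY w) YE !wordmx_scale !mxtraceZ.
by rewrite conjmx_word.
Qed.

Lemma closed_preimage_chi (D : set hom) :
  closed (@chi R n G @^-1` (@chi R n G @` D)) -> closed (@chi R n G @` D).
Proof.
move=> /closed_openC oD; rewrite -[X in closed X]setCK; apply: open_closedC.
by rewrite -[open _]/(open (@chi R n G @^-1` (~` (@chi R n G @` D)))).
Qed.

(** All limits are indexed by the space of homomorphisms itself, along an ultrafilter refining the
    neighbourhoods of [rho] within [D]. A point [t] of [D] only shares its class with a holonomy, so
    [A t] is tied to [t] by traces alone. *)
Lemma closed_holonomies : finitely_generated G -> no_normal_abelian_subgroup G ->
  closed (@chi R n G @^-1` (@chi R n G @` @holonomies R n G)).
Proof.
move=> /symmetric_generators[s gens sV] hG rho cl.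
set D := @chi R n G @^-1` _ in cl *.
have PF : ProperFilter (within D (nbhs rho)) by exact: within_nbhs_proper.
have [U [UU FU]] := ultraFilterLemma PF.
have PU : ProperFilter U by exact: ultra_proper.
have UF : Filter U by exact: filter_filter.
have UD : U D by apply: FU; apply: nearW.
have idU : id @ U --> rho by move=> B nB; apply: FU; apply: filterS nB => a Ba _.
(* A set of the ultrafilter is nonempty, and a single holonomy forces [G] to be torsion free. *)
have tfG (g : G) m : (g ^+ m.+1)%g = 1%g -> g = 1%g.
  have /filter_ex[_ [sigma hs _]] := UD.
  by have [_] := holonomy_conerep hs; apply.
have ex t : exists p : (G -> 'M[R]_N) * set 'cV[R]_N * (G -> R), D t -> good_rep s t p.1.1 p.1.2 p.2.
  have [[sigma hs st]|nD] := pselect (D t).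
    by have [A [C [e h]]] := good_rep_ex s hs st; exists (A, C, e).
  by exists (fun=> 0, set0, fun=> 0) => /nD.
have [p pP] := choice ex; pose A t := (p t).1.1; pose C t := (p t).1.2; pose e t := (p t).2.
have good : \forall t \near U, good_rep s t (A t) (C t) (e t).
  by apply: filterS UD => t /pP.
(* Up to sign these are the traces of lifts of [t] itself, and such lifts converge because [t] tends
   to [rho]. *)
have trA g : exists B, \forall t \near U, `|\tr (A t g)| <= B.
  have [X0 X0P] := homlift_ex rho.
  pose Q t X := D t -> homlift t X /\ sametrace X (fun g => e t g *: A t g).
  have exX t : exists X, Q t X.
    have [Dt|nD] := pselect (D t); last by exists (fun=> 0) => /nD.
    by have [_ _ _ _ [_ [X hX XA]]] := pP t Dt; exists X.
  have [X XP] := choice exX.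
  have ftg : (fun t => homval t g) @ U --> homval rho g by move/homspace_cvgP: idU; apply.
  have [|M lM XM] := lift1_limit (X := fun t => X t g) UU ftg.
    by apply: filterS UD => t /XP[].
  exists (nrm M + 1); have /cvg_nrm/cvgrPdist_lt/(_ _ ltr01) near1 := XM.
  near=> t; have Dt : D t by near: t.
  have [hX XA] := XP t Dt; have [_ _ _ _ [sg _]] := pP t Dt.
  have Xt : `|nrm M - nrm (X t g)| < 1 by near: t.
  have := XA [:: g]; rewrite /= !mulmx1 mxtraceZ => trE.
  have -> : `|\tr (A t g)| = `|\tr (X t g)|.
    by rewrite trE normrM /e; have [->|->] := sg g; rewrite ?normrN normr1 mul1r.
  apply: le_trans (nrm_trace _) _; move: Xt; rewrite ltr_distlC => /andP[]; lra.
have N3 : 0 < 2 * N%:R ^+ 3 :> R by rewrite mulr_gt0// exprn_gt0// ltr0n.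
have [B AB] : exists B, \forall t \near U, gensize s (A t) <= B.
  apply: gensize_bounded N3 _ _ trA => //.
  - by apply: filterS good => t [[]].
  - by apply: filterS good => t [].
have genB : \forall t \near U, forall x, x \in s -> nrm (A t x) <= Num.max 1 B.
  apply: filterS AB => t AtB x xs; rewrite le_max; apply/orP; right; apply: le_trans AtB.
  have xs' : (index x s < size s)%N by rewrite index_mem.
  rewrite /gensize (bigD1 (Ordinal xs'))//= nth_index// addrCA lerDl addr_ge0//.
  by apply: sumr_ge0 => j _; exact: nrm_ge0.
have ALim g : exists L, mcvg U (fun t => A t g) L.
  have [u us ->] := generated_words gens sV g.
  apply: (@ultra_mcvg _ _ _ _ _ _ (N.+1%:R * Num.max 1 B ^+ size u)) => //.
  near=> t; have genBt : forall x, x \in s -> nrm (A t x) <= Num.max 1 B by near: t.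
  have [[hA _ _] _ _ _ _] : good_rep s t (A t) (C t) (e t) by near: t.
  by apply: nrm_wprod hA _ genBt us; rewrite le_max lexx.
have [L LP] := choice ALim.
have [d d0 dP] := @uniform_discrete R N G s gens hG sV (Num.max 1 B).
have hL : hommx L.
  split=> [|g h].
    have h1 : mcvg U (fun t => A t 1%g) 1%:M.
      apply: (mcvg_near (X := fun=> 1%:M)); last exact: mcvg_cst.
      apply: filterS good => t [[[A1 _] _ _] _ _ _ _].
      by rewrite A1.
    exact: mcvg_unique (LP _) h1.
  apply: mcvg_unique (LP _) _; apply: mcvg_near (mcvgM (LP g) (LP h)).
  by apply: filterS good => t [[[_ AM] _ _] _ _ _ _].
have detL g : `|\det (L g)| = 1.
  have h : (fun t => `|\det (A t g)|) @ U --> `|\det (L g)|.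
    by apply: cvg_norm; exact: mcvg_det.
  have h1 : (fun t => `|\det (A t g)|) @ U --> (1 : R).
    apply: (@cvg_trans _ ((fun=> 1 : R) @ U)); last exact: cvg_cst.
    by apply: near_eq_cvg; apply: filterS good => t [[_ dA _] _ _ _ _].
  exact: (cvg_unique (@Rhausdorff R) h h1).
have fatC : \forall t \near U, fatcone (C t) by apply: filterS good => t [_ _ []].
have discL : discretemx L d.
  move=> g g1.
  have lim : (fun t => nrm (A t g - 1%:M)) @ U --> nrm (L g - 1%:M).
    by apply: cvg_nrm; apply: mcvgB => //; exact: mcvg_cst.
  apply: (cvgr_to_ge lim); near=> t.
  have [[hA _ fA] dA _ _ _] : good_rep s t (A t) (C t) (e t) by near: t.
  by apply: (dP (A t)) => //; near: t.
have fC := limcone_fat UU fatC.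
have LC : preserves L (limcone U C).
  move=> g; apply: (limcone_preserved UU _ (LP g)).
  by apply: filterS good => t [_ _ [_ pC] _ _]; exact: pC.
have [tau0 ltau] : exists tau : hom, homlift tau L.
  by apply: hom_of_lift => // g h; left; exact: hL.2.
have htau := fat_holonomies hL detL fC (limcone_closed UU) LC d0 discL tfG ltau.
(* The signs converge along the ultrafilter, again to signs; so [E g *: L g] is another lift of
   [tau0], with the traces of a lift of [rho]. *)
have eLim g : exists l : R, (fun t => e t g) @ U --> l.
  apply: (@ultra_cvg _ _ _ _ 1) => //; apply: filterS good => t [_ _ _ _ [sg _]].
  by case: (sg g) => eg; rewrite eg ?normrN normr1.
have [E EP] := choice eLim.
have sE : signed E.
  move=> g; have h : (fun t => e t g * e t g) @ U --> E g * E g by apply: cvgM.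
  have h1 : (fun t => e t g * e t g) @ U --> (1 : R).
    apply: (@cvg_trans _ ((fun=> 1 : R) @ U)); last exact: cvg_cst.
    apply: near_eq_cvg; apply: filterS good => t [_ _ _ _ [sg _]].
    by case: (sg g) => eg; rewrite eg ?mulrNN mulr1.
  have /eqP : E g * E g = 1 by exact: (cvg_unique (@Rhausdorff R) h h1).
  by rewrite -expr2 sqrf_eq1 => /orP[]/eqP; [left|right].
have [||X hX XL] := @samelift_limit _ _ _ _ U id rho (fun t g => e t g *: A t g) (fun g => E g *: L g) UU idU.
- by move=> g; apply: mcvgZ.
- by apply: filterS good => t [_ _ _ _ []].
exists tau0 => //; apply/esym/samelift_chi; exists X, (fun g => E g *: L g); split=> //.
exact: homlift_scale.
Unshelve. all: end_near. Qed.

End Main.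

Theorem theorem3p3 (R : realType) (n : nat) (G : groupType)
    (hfg : finitely_generated G) (hG : no_normal_abelian_subgroup G) :
  closed (@chi R n G @` @holonomies R n G).
Proof. exact/closed_preimage_chi/closed_holonomies. Qed.
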